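(* Let $(V,h)$ be a quadratic space of signature $(p,q)$ and $\gamma:\mathrm{Cl}(V,h)\to\mathrm{End}_{\mathbb R}(S)$ an irreducible real Clifford representation with $S\neq0$. Let $\mathrm{L}=\mathrm{L}^0\sqcup\mathrm{L}^1$ be its Lipschitz group, $\mathbb{S}$ its Schur algebra, $A$ its anticommutant subspace and $\mathrm{Ad}_s$ the Schur representation. Then there is a short exact sequence $$1\longrightarrow\mathrm{L}_\gamma\hookrightarrow\mathrm{L}\stackrel{\mathrm{Ad}_s}{\longrightarrow}\mathrm{Aut}_{\mathrm{Alg}}(\mathbb{S})\longrightarrow1 .$$ Moreover: 1. If $p-q\equiv0,2\pmod 8$: $\mathrm{Aut}_{\mathrm{Alg}}(\mathbb{S})\simeq1$, $\mathrm{L}=\mathrm{L}_\gamma=\gamma(\mathrm{G}(V,h))\simeq\mathrm{G}(V,h)$, $\mathrm{L}^0=\gamma(\mathrm{G}_+(V,h))\simeq\mathrm{G}_+(V,h)$ as groups, and $\mathrm{L}^1=\gamma(\mathrm{G}_-(V,h))\simeq\mathrm{G}_-(V,h)$ as sets. 2. If $p-q\equiv3,7\pmod 8$: $\mathrm{Aut}_{\mathrm{Alg}}(\mathbb{S})=\{\mathrm{id}_{\mathbb{S}},c\}\simeq\mathbb{Z}_2$, $\mathrm{L}_\gamma=\mathrm{L}^0=\gamma(\mathrm{G}^e(V,h))\simeq\mathrm{G}^e(V,h)=\mathrm{G}(V,h)\mathrm{U}(1)$ as groups, $\mathrm{L}^1=u\mathrm{L}^0=\mathrm{L}^0u\simeq\mathrm{L}^0$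 as sets, where $u\in A$ is a basis of $A$ over $\mathbb{S}$ satisfying $u^2=(-1)^{\frac{p-q+1}{4}}\mathrm{id}_S$ and $usu^{-1}=c(s)$ for $s\in\mathbb{S}$; and $\mathrm{Ad}_s(a)=\mathrm{id}_{\mathbb{S}}$ for $a\in\mathrm{L}^0$, $\mathrm{Ad}_s(a)=c$ for $a\in\mathrm{L}^1$. 3. If $p-q\equiv4,6\pmod 8$: $\mathrm{Aut}_{\mathrm{Alg}}(\mathbb{S})\simeq\mathrm{SO}(3,\mathbb{R})$ and $\mathrm{L}_\gamma=\gamma(\mathrm{G}(V,h))\simeq\mathrm{G}(V,h)$, $\mathrm{L}=\gamma(\mathrm{G}(V,h))\mathrm{U}(\mathbb{S})\simeq\gamma(\mathrm{G}(V,h))\cdot\mathrm{U}(\mathbb{S})\simeq\mathrm{G}(V,h)\cdot\mathrm{Sp}(1)$, $\mathrm{L}^0=\gamma(\mathrm{G}_+(V,h))\mathrm{U}(\mathbb{S})\simeq\gamma(\mathrm{G}_+(V,h))\cdot\mathrm{U}(\mathbb{S})\simeq\mathrm{G}_+(V,h)\cdot\mathrm{Sp}(1)$ as groups, and $\mathrm{L}^1=\gamma(\mathrm{G}_-(V,h))\mathrm{U}(\mathbb{S})\simeq\gamma(\mathrm{G}_-(V,h))\times\mathrm{U}(\mathbb{S})\simeq\mathrm{G}_-(V,h)\times\mathrm{Sp}(1)$ as sets. 4. If $p-q\equiv1\pmod 8$: $\mathrm{Aut}_{\mathrm{Alg}}(\mathbb{S})\simeq1$ and $\mathrm{L}=\mathrm{L}_\gamma=\mathrm{L}^0=\gamma(\mathrm{G}_+(V,h))\simeq\mathrm{G}_+(V,h)$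 as groups. 5. If $p-q\equiv5\pmod 8$: $\mathrm{Aut}_{\mathrm{Alg}}(\mathbb{S})\simeq\mathrm{SO}(3,\mathbb{R})$, $\mathrm{L}_\gamma=\gamma(\mathrm{G}_+(V,h))\simeq\mathrm{G}_+(V,h)$ and $\mathrm{L}=\mathrm{L}^0=\gamma(\mathrm{G}_+(V,h))\mathrm{U}(\mathbb{S})\simeq\gamma(\mathrm{G}_+(V,h))\cdot\mathrm{U}(\mathbb{S})\simeq\mathrm{G}_+(V,h)\cdot\mathrm{Sp}(1)$ as groups.
   Context: A quadratic space is a nonzero finite-dimensional real vector space with a nondegenerate symmetric bilinear form of signature $(p,q)$, $d=p+q$. $\mathrm{Cl}(V,h)$ is the real Clifford algebra with $v^2=h(v,v)$, $\mathrm{Cl}_\pm(V,h)$ its even/odd parts. Extended Clifford group: $\mathrm{G}^e(V,h)=\{a\in\mathrm{Cl}(V,h)^\times\,|\,aVa^{-1}=V\}$. Ordinary Clifford group: $\mathrm{G}(V,h)=\mathrm{G}_+(V,h)\sqcup\mathrm{G}_-(V,h)$ with $\mathrm{G}_\pm(V,h)=\mathrm{G}^e(V,h)\cap\mathrm{Cl}_\pm(V,h)$. $W=\gamma(V)$ (for irreducible $\gamma$ the restriction $\gamma|_V$ is injective, and $W$ carries the form transported from $h$). Schur algebra: $\mathbb{S}=\{a\in\mathrm{End}_{\mathbb R}(S)\,|\,aw=wa\ \forall w\in W\}$. Anticommutant subspace: $A=\{a\in\mathrm{End}_{\mathbb R}(S)\,|\,aw=-wa\ \forall w\in W\}$, a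 left $\mathbb{S}$-module. $\mathbb{S}$ is isomorphic to $\mathbb{R}$ if $p-q\equiv0,1,2$, to $\mathbb{C}$ if $p-q\equiv3,7$ (in which case $\mathbb{S}=\mathbb{R}\,\mathrm{id}_S\oplus\mathbb{R}\gamma(\nu)$ with $\nu$ the product of an orthonormal basis of $V$), to $\mathbb{H}$ if $p-q\equiv4,5,6\pmod 8$. $\mathrm{U}(\mathbb{S})$ is the group of unit norm elements; $c$ is the conjugation of $\mathbb{S}\simeq\mathbb{C}$. In item 2, $\mathrm{U}(1)$ denotes the unit group of norm one elements of the center $\mathbb{R}\oplus\mathbb{R}\nu\simeq\mathbb{C}$ of $\mathrm{Cl}(V,h)$. Lipschitz group: $\mathrm{L}=\{a\in\mathrm{Aut}_{\mathbb R}(S)\,|\,aWa^{-1}\subset W\}$, with $\mathrm{Ad}_0(a)=\mathrm{Ad}(a)|_W\in\mathrm{O}(W)$, $\mathrm{Ad}(a)(T)=aTa^{-1}$; $\mathrm{L}^0=\{a\in\mathrm{L}\,|\,\det\mathrm{Ad}_0(a)=1\}$, $\mathrm{L}^1=\{a\in\mathrm{L}\,|\,\det\mathrm{Ad}_0(a)=-1\}$. Schur representation: $\mathrm{Ad}_s(a)=\mathrm{Ad}(a)|_{\mathbb{S}}\in\mathrm{Aut}_{\mathrm{Alg}}(\mathbb{S})$ (unital $\mathbb{R}$-algebra automorphisms). $\mathrm{L}_\gamma=\gamma(\mathrm{G}^e(V,h))$ if $p-q\not\equiv1,5\pmod 8$, and $\mathrm{L}_\gamma=\gamma(\mathrm{G}_+(V,h))$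 if $p-q\equiv1,5\pmod 8$. $G_1\cdot G_2$ denotes $(G_1\times G_2)/\{(1,1),(-1,-1)\}$. *)

(* Defs.v *)
From HB Require Import structures.
From mathcomp Require Import all_boot all_order all_algebra all_field.
From mathcomp Require Import complex ring.
From mathcomp Require Import boolp classical_sets functions cardinality reals.

Set Implicit Arguments.
Unset Strict Implicit.
Unset Printing Implicit Defensive.

Import Order.TTheory GRing.Theory Num.Theory.
Local Open Scope ring_scope.
Local Open Scope classical_set_scope.

(* A subset of a type with a candidate operation and neutral element, so that *)
(* subsets of rings can be both compared as sets and treated as groups.       *)
Record pregroup := Pregroup {
  gsort : Type;
  gset : set gsort;
  gop : gsort -> gsort -> gsort;
  gid : gsort }.
Arguments gset : clear implicits.
Arguments gid : clear implicits.

Definition is_group (G : pregroup) : Prop :=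
  [/\ gset G (gid G),
      forall x y, gset G x -> gset G y -> gset G (gop x y),
      forall x y z, gset G x -> gset G y -> gset G z ->
        gop x (gop y z) = gop (gop x y) z,
      forall x, gset G x -> gop (gid G) x = x /\ gop x (gid G) = x &
      forall x, gset G x -> exists2 y, gset G y &
        gop x y = gid G /\ gop y x = gid G].

Definition is_group_hom (G H : pregroup) (f : gsort G -> gsort H) : Prop :=
  (forall x, gset G x -> gset H (f x)) /\
  (forall x y, gset G x -> gset G y -> f (gop x y) = gop (f x) (f y)).
Arguments is_group_hom : clear implicits.

Definition is_group_iso (G H : pregroup) (f : gsort G -> gsort H) : Prop :=
  [/\ is_group G, is_group H, is_group_hom G H f &
      set_bij (gset G) (gset H) f].
Arguments is_group_iso : clear implicits.

Definition group_isog (G H : pregroup) : Prop :=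
  exists f : gsort G -> gsort H, is_group_iso G H f.

Definition mulgrp (T : nzRingType) (A : set T) : pregroup := Pregroup A *%R 1.

Definition addgrp (T : zmodType) : pregroup := @Pregroup T setT +%R 0.

Definition trivgrp : pregroup := @Pregroup unit setT (fun _ _ => tt) tt.

Definition SO3 (R : realType) : pregroup :=
  mulgrp [set M : 'M[R]_3 | M *m M^T = 1%:M /\ \det M = 1].

(* Exactness of 1 -> N -> G -> H -> 1, where N -> G is the inclusion between  *)
(* two subsets of one ring.                                                   *)
Definition short_exact (T : nzRingType) (N G : set T) (H : pregroup)
    (f : T -> gsort H) : Prop :=
  [/\ [/\ is_group (mulgrp N), is_group (mulgrp G) & is_group H],
      is_group_hom (mulgrp G) H f,
      N `<=` G,
      [set a | G a /\ f a = gid H] = N &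
      f @` G = gset H].
Arguments short_exact {T} N G H f.

Definition mulset (T : nzRingType) (A B : set T) : set T :=
  [set a * b | a in A & b in B].

Section CentralProduct.
Variables T U : nzRingType.

Definition sign_coset (x : T * U) : set (T * U) :=
  [set x; (- x.1, - x.2)].

(* The quotient (A x B) / {(1,1), (-1,-1)}; its elements are the cosets, which *)
(* are multiplied as subsets of T x U.                                         *)
Definition central_prod (A : set T) (B : set U) : pregroup :=
  @Pregroup (set (T * U))
    [set sign_coset x | x in A `*` B]
    (fun C D => [set (x.1 * y.1, x.2 * y.2) | x in C & y in D])
    (sign_coset (1, 1)).

End CentralProduct.

(* The quaternion Quat a b c d stands for a + b i + c j + d k.                *)
Record quat (R : realType) := Quat { qr : R; qi : R; qj : R; qk : R }.

Definition quat_to_prod (R : realType) (x : quat R) : R * R * R * R :=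
  let: Quat a b c d := x in (a, b, c, d).
Definition quat_of_prod (R : realType) (x : R * R * R * R) : quat R :=
  let: (a, b, c, d) := x in Quat a b c d.
Fact quat_to_prodK (R : realType) : cancel (@quat_to_prod R) (@quat_of_prod R).
Proof. by case. Qed.

HB.instance Definition _ (R : realType) :=
  Choice.copy (quat R) (can_type (@quat_to_prodK R)).

Section Quaternion.
Variable R : realType.
Implicit Types x y z : quat R.

Definition quat_zero : quat R := Quat 0 0 0 0.
Definition quat_one : quat R := Quat 1 0 0 0.

Definition quat_opp x :=
  let: Quat a b c d := x in Quat (- a) (- b) (- c) (- d).

Definition quat_add x y :=
  let: Quat a1 b1 c1 d1 := x in
  let: Quat a2 b2 c2 d2 := y in
  Quat (a1 + a2) (b1 + b2) (c1 + c2) (d1 + d2).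

Definition quat_mul x y :=
  let: Quat a1 b1 c1 d1 := x in
  let: Quat a2 b2 c2 d2 := y in
  Quat (a1 * a2 - b1 * b2 - c1 * c2 - d1 * d2)
       (a1 * b2 + b1 * a2 + c1 * d2 - d1 * c2)
       (a1 * c2 - b1 * d2 + c1 * a2 + d1 * b2)
       (a1 * d2 + b1 * c2 - c1 * b2 + d1 * a2).

Definition quat_scale (k : R) x :=
  let: Quat a b c d := x in Quat (k * a) (k * b) (k * c) (k * d).

Fact quat_addA : associative quat_add.
Proof. by case=> ? ? ? ? [? ? ? ?] [? ? ? ?]; congr Quat; ring. Qed.
Fact quat_addC : commutative quat_add.
Proof. by case=> ? ? ? ? [? ? ? ?]; congr Quat; ring. Qed.
Fact quat_add0 : left_id quat_zero quat_add.
Proof. by case=> ? ? ? ?; congr Quat; ring. Qed.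
Fact quat_addN : left_inverse quat_zero quat_opp quat_add.
Proof. by case=> ? ? ? ?; congr Quat; ring. Qed.

HB.instance Definition _ := GRing.isZmodule.Build (quat R)
  quat_addA quat_addC quat_add0 quat_addN.

Fact quat_mulA : associative quat_mul.
Proof. by case=> ? ? ? ? [? ? ? ?] [? ? ? ?]; congr Quat; ring. Qed.
Fact quat_mul1q : left_id quat_one quat_mul.
Proof. by case=> ? ? ? ?; congr Quat; ring. Qed.
Fact quat_mulq1 : right_id quat_one quat_mul.
Proof. by case=> ? ? ? ?; congr Quat; ring. Qed.
Fact quat_mulDl : left_distributive quat_mul +%R.
Proof. by case=> ? ? ? ? [? ? ? ?] [? ? ? ?]; congr Quat; ring. Qed.
Fact quat_mulDr : right_distributive quat_mul +%R.
Proof. by case=> ? ? ? ? [? ? ? ?] [? ? ? ?]; congr Quat; ring. Qed.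
Fact quat_one_neq0 : quat_one != 0.
Proof. by apply/eqP => -[/eqP]; rewrite oner_eq0. Qed.

HB.instance Definition _ := GRing.Zmodule_isNzRing.Build (quat R)
  quat_mulA quat_mul1q quat_mulq1 quat_mulDl quat_mulDr quat_one_neq0.

Fact quat_scaleA a b x : quat_scale a (quat_scale b x) = quat_scale (a * b) x.
Proof. by case: x => ? ? ? ?; congr Quat; ring. Qed.
Fact quat_scale1 : left_id 1 quat_scale.
Proof. by case=> ? ? ? ?; congr Quat; ring. Qed.
Fact quat_scaleDr : right_distributive quat_scale +%R.
Proof. by move=> ? [? ? ? ?] [? ? ? ?]; congr Quat; ring. Qed.
Fact quat_scaleDl x : {morph quat_scale^~ x : a b / a + b}.
Proof. by case: x => ? ? ? ? ? ?; congr Quat; ring. Qed.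

HB.instance Definition _ := GRing.Zmodule_isLmodule.Build R (quat R)
  quat_scaleA quat_scale1 quat_scaleDr quat_scaleDl.

Fact quat_scaleAl (k : R) x y : k *: (x * y) = (k *: x) * y.
Proof. by case: x y => ? ? ? ? [? ? ? ?]; congr Quat; ring. Qed.

HB.instance Definition _ := GRing.Lmodule_isLalgebra.Build R (quat R)
  quat_scaleAl.

Fact quat_scaleAr (k : R) x y : k *: (x * y) = x * (k *: y).
Proof. by case: x y => ? ? ? ? [? ? ? ?]; congr Quat; ring. Qed.

HB.instance Definition _ := GRing.Lalgebra_isAlgebra.Build R (quat R)
  quat_scaleAr.

Definition quat_norm x : R :=
  let: Quat a b c d := x in
  Num.sqrt (a ^+ 2 + b ^+ 2 + c ^+ 2 + d ^+ 2).

Definition Sp1 : set (quat R) := [set x : quat R | quat_norm x = 1].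

End Quaternion.

(* The algebra End(S) of a nonzero space S, with a * b = a \o b.  The library *)
(* product on 'End(S) is the opposite one.                                    *)
Definition endo (K : fieldType) (S : vectType K) (S_gt0 : (0 < dim S)%N) : Type :=
  'End(S).

Section Endo.
Variables (K : fieldType) (S : vectType K) (S_gt0 : (0 < dim S)%N).

HB.instance Definition _ := Vector.copy (endo S_gt0) 'End(S).

HB.instance Definition _ := GRing.Zmodule_isNzRing.Build (endo S_gt0)
  (@comp_lfunA K S S S S) (@comp_lfun1l K S S) (@comp_lfun1r K S S)
  (@comp_lfunDl K S S S) (@comp_lfunDr K S S S) (lfun1_neq0 S_gt0).

HB.instance Definition _ := GRing.Lmodule_isLalgebra.Build K (endo S_gt0)
  (fun k x y => @comp_lfunZl K S S S k x y).

HB.instance Definition _ := GRing.Lalgebra_isAlgebra.Build K (endo S_gt0)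
  (fun k x y => @comp_lfunZr K S S S k x y).

HB.instance Definition _ := Algebra_isFalgebra.Build K (endo S_gt0).

End Endo.

Section QuadraticSpace.
Variables (R : realType) (V : vectType R) (h : {symmetric V}) (p q : nat).

Definition orthonormal_basis (e : (p + q).-tuple V) : Prop :=
  basis_of fullv e /\
  forall i j : 'I_(p + q), h (tnth e i) (tnth e j) =
    if i == j then if (i < p)%N then 1 else -1 else 0.

Definition is_quadratic_space : Prop :=
  [/\ (0 < p + q)%N, nondegenerate h & exists e, orthonormal_basis e].

End QuadraticSpace.

Section Clifford.
Variables (R : realType) (V : vectType R) (h : {symmetric V}).

(* The universal property defining the Clifford algebra of (V, h).            *)
Definition is_clifford_algebra (Cl : algType R) (iota : {linear V -> Cl}) :
    Prop :=
  (forall v, iota v * iota v = (h v v)%:A) /\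
  forall (B : algType R) (g : {linear V -> B}),
    (forall v, g v * g v = (h v v)%:A) ->
    exists f : {lrmorphism Cl -> B},
      (forall v, f (iota v) = g v) /\
      forall f' : {lrmorphism Cl -> B},
        (forall v, f' (iota v) = g v) -> f' =1 f.

Variables (Cl : unitAlgType R) (iota : {linear V -> Cl}).

(* Cl_+ for parity = false and Cl_- for parity = true.                        *)
Definition clifford_part (parity : bool) : set Cl :=
  [set a | exists (n : nat) (c : 'I_n -> R) (w : 'I_n -> seq V),
    (forall i, odd (size (w i)) = parity) /\
    a = \sum_i c i *: \prod_(v <- w i) iota v].

Definition ext_clifford_group : set Cl :=
  [set a | a \is a GRing.unit /\
    [set a * x / a | x in range iota] = range iota].

Definition clifford_group_part (parity : bool) : set Cl :=
  ext_clifford_group `&` clifford_part parity.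

Definition clifford_group : set Cl :=
  clifford_group_part false `|` clifford_group_part true.

Variables (p q : nat).

Definition volume (e : (p + q).-tuple V) : Cl := \prod_(v <- e) iota v.

(* Meant for p - q = 3, 7 mod 8, where the center R + R nu of Cl is identified *)
(* with the complex numbers by sending nu to the imaginary unit; nu is         *)
(* determined up to sign, which does not affect the set.                       *)
Definition clifford_U1 : set Cl :=
  [set a | exists (e : (p + q).-tuple V) (x y : R),
    [/\ orthonormal_basis h e, x ^+ 2 + y ^+ 2 = 1 &
        a = x%:A + y *: volume e]].

End Clifford.

Section Lipschitz.
Variables (R : realType) (V : vectType R) (h : {symmetric V}) (p q : nat).
Variables (Cl : unitAlgType R) (iota : {linear V -> Cl}).
Variables (S : vectType R) (S_gt0 : (0 < dim S)%N).
Variable gamma : {lrmorphism Cl -> endo S_gt0}.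

Definition irreducible_rep : Prop :=
  forall U : {vspace S},
    (forall a, ((gamma a : 'End(S)) @: U <= U)%VS) ->
    U = 0%VS \/ U = fullv.

Definition clifford_image : {vspace endo S_gt0} :=
  limg (linfun (gamma \o iota)).
Local Notation W := clifford_image.

Definition schur_algebra : {aspace endo S_gt0} := 'C(W)%AS.
Local Notation SS := schur_algebra.

Definition anticommutant : set (endo S_gt0) :=
  [set a | forall w, w \in W -> a * w = - (w * a)].

Definition Ad (a T : endo S_gt0) : endo S_gt0 := a * T / a.

Definition lipschitz_group : set (endo S_gt0) :=
  [set a | a \is a GRing.unit /\ forall w, w \in W -> Ad a w \in W].

Definition det_Ad0 (a : endo S_gt0) : R :=
  \det (\matrix_(i < \dim W, j < \dim W)
          coord (vbasis W) j (Ad a (tnth (vbasis W) i))).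

Definition lipschitz_group0 : set (endo S_gt0) :=
  [set a | lipschitz_group a /\ det_Ad0 a = 1].

Definition lipschitz_group1 : set (endo S_gt0) :=
  [set a | lipschitz_group a /\ det_Ad0 a = -1].

Definition schur_aut : set 'End(subvs_of SS) :=
  [set f | ahom_in fullv f /\ lker f == 0%VS].

Definition schur_aut_group : pregroup :=
  Pregroup schur_aut (fun f g => (f \o g)%VF) \1%VF.

(* For a in the Lipschitz group, Ad a preserves the Schur algebra, so that the *)
(* projection vsproj is the identity on Ad a s.                                *)
Definition Ad_s (a : endo S_gt0) : 'End(subvs_of SS) :=
  linfun (fun s => vsproj SS (Ad a (vsval s))).

Definition lipschitz_gamma : set (endo S_gt0) :=
  if ((p%:Z - q%:Z) %% 8)%Z \in [:: 1; 5 : int]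
  then gamma @` clifford_group_part iota false
  else gamma @` ext_clifford_group iota.

(* The norm of a Schur algebra isomorphic to the quaternions is the transport  *)
(* of the quaternionic norm; it does not depend on the isomorphism.            *)
Definition schur_unit_group : set (endo S_gt0) :=
  [set a | exists phi : {lrmorphism quat R -> subvs_of SS},
    bijective phi /\ exists2 x, Sp1 x & a = vsval (phi x)].

(* The transport of complex conjugation to a Schur algebra isomorphic to the   *)
(* complex numbers; it does not depend on the isomorphism.                     *)
Definition is_schur_conjugation (c : 'End(subvs_of SS)) : Prop :=
  exists phi : {lrmorphism Rcomplex R -> subvs_of SS},
    bijective phi /\ forall z, c (phi z) = phi (conjc z).

Definition is_anticommutant_basis (u : endo S_gt0) : Prop :=
  anticommutant u /\
  forall a, anticommutant a -> exists! s : subvs_of SS, a = vsval s * u.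

End Lipschitz.

(* Main.v *)
(* The products of distinct vectors of an orthonormal basis form, up to sign, a
   finite group of operators on S.  Averaging T |-> m T m^-1 over these monomials
   m, with or without the sign of the parity of m, projects End(S) onto the
   commutant, respectively the anticommutant, of W.  All monomials but 1 and
   possibly nu are traceless, which gives the trace of the projections; composing
   them with the adjoint for an inner product invariant under the monomials gives
   traces equal, up to a positive factor, to the real and imaginary parts of a
   Gaussian integer (1 + i)^p (1 - i)^(q + 1), whose argument depends on p - q mod 8.
   Together these are the dimensions of the symmetric and skew parts.  Self-adjoint
   elements of the commutant are scalars by Schur's lemma, so the commutant is R, C
   or H, and the anticommutant for p - q = 3, 7 is found in the same way.  A partial
   trace shows that whatever commutes with the Schur algebra lies in gamma(Cl).

   Hence the kernel of Ad_s is the intersection of L with gamma(Cl), that is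
   L_gamma, while every automorphism of the Schur algebra is conjugation by a
   nonzero element of it (R, H) or possibly of the anticommutant (C), and all these
   elements lie in L.  Since Ad(a) nu = det(Ad_0 a) nu, the subsets L^0 and L^1
   consist of the a in L that commute, respectively anticommute, with nu. *)

Require Import Defs.
From HB Require Import structures.
From mathcomp Require Import all_boot all_order all_fingroup all_algebra all_field.
From mathcomp Require Import complex spectral ring lra zify.
From mathcomp Require Import boolp classical_sets functions cardinality reals.

Set Implicit Arguments.
Unset Strict Implicit.
Unset Printing Implicit Defensive.

Import Order.TTheory GRing.Theory Num.Theory.
Local Open Scope ring_scope.

(** The dimension of [S] is not taken from a classification of Clifford algebras. It enters through
    one positive unknown, [t] in [epsum_scaled]: that the self-adjoint part of the commutant has
    dimension 1 is a quadratic equation for [t], and its positive root gives the dimension of the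
    skew part. The Gaussian integer comes from adjoining generators one at a time. Let [z0] be the
    sum of the squares of all monomials and [z1] the same sum signed by parity. A new generator of
    square h changes the pair to (z0 + h z1, z1 - h z0), which multiplies z0 - i z1 by 1 + h i. The
    empty product starts at (1, 1), that is at 1 - i; hence the exponent q + 1. The main obstacle is
    p - q = 1, 5 mod 8, where [nu] acts as 1 or -1 and [gamma] is not injective. It is still
    injective on the even and on the odd part, so elements pulled back through [gamma] are chosen
    homogeneous there. For the bijection of sets when p - q = 4, 6, multiplication itself is
    two-to-one; an injection in the other direction and Cantor-Bernstein replace an explicit
    bijection. *)

(** * Ordered monomials in anticommuting generators *)

Fixpoint subs (l : seq nat) : seq (seq nat) :=
  if l is i :: l' then subs l' ++ map (cons i) (subs l') else [:: [::]].

Lemma size_subs l : size (subs l) = (2 ^ size l)%N.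
Proof. by elim: l => //= i l IH; rewrite size_cat size_map IH addnn -mul2n expnS. Qed.

Lemma subs_subseq l s : s \in subs l -> subseq s l.
Proof.
elim: l s => [|i l IH] s /=; first by rewrite inE => /eqP ->.
rewrite mem_cat => /orP[/IH|/mapP[t /IH tl ->]]; last by rewrite eqxx.
by move=> sl; apply: subseq_trans sl (subseq_cons l i).
Qed.

Lemma subs_nil l : [::] \in subs l.
Proof. by elim: l => //= i l IH; rewrite mem_cat IH. Qed.

Lemma subs_full l : l \in subs l.
Proof. by elim: l => //= i l IH; rewrite mem_cat map_f ?orbT. Qed.

Lemma subs_uniq l : uniq l -> uniq (subs l).
Proof.
elim: l => //= i l IH /andP[il /IH ul].
rewrite cat_uniq ul /= map_inj_uniq ?ul ?andbT; last by move=> ? ? [].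
apply/hasPn => s /mapP[t tl ->]; apply/negP => /subs_subseq /mem_subseq.
by move=> /(_ i); rewrite mem_head (negPf il) => /(_ isT).
Qed.

(** Subsequences of [iota 0 d] are strictly increasing, hence determined by their members. *)
Lemma subs_iota_eq d s t : s \in subs (iota 0 d) -> t \in subs (iota 0 d) ->
  s =i t -> s = t.
Proof.
move=> /subs_subseq sd /subs_subseq td.
apply: (irr_sorted_eq ltn_trans ltnn); apply: (subseq_sorted ltn_trans);
  by [exact: sd|exact: td|exact: iota_ltn_sorted].
Qed.

Section Monomials.
Variables (R : numDomainType) (A : algType R) (d : nat).
Variables (e : nat -> A) (h : nat -> R).
Hypothesis h2 : forall i, (i < d)%N -> h i = 1 \/ h i = -1.
Hypothesis esq : forall i, (i < d)%N -> e i * e i = (h i)%:A.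
Hypothesis eac : forall i j, (i < d)%N -> (j < d)%N -> i != j ->
  e i * e j = - (e j * e i).

Definition mon (s : seq nat) : A := \prod_(i <- s) e i.

Lemma mon_cons i s : mon (i :: s) = e i * mon s.
Proof. by rewrite /mon big_cons. Qed.

Lemma mon_nil : mon [::] = 1. Proof. by rewrite /mon big_nil. Qed.

Lemma mon_cat s t : mon (s ++ t) = mon s * mon t.
Proof. by rewrite /mon big_cat. Qed.

Lemma mon_comm j s : (j < d)%N -> all (gtn d) s ->
  e j * mon s = (-1) ^+ (size s + count_mem j s) *: (mon s * e j).
Proof.
move=> jd; elim: s => [|i s IH] /=; first by rewrite mon_nil mulr1 mul1r scale1r.
move=> /andP[id /IH IHs]; rewrite mon_cons.
have [->|ij] := eqVneq i j.
  rewrite addSn addnS !exprS !mulN1r opprK.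
  by rewrite [in LHS]IHs -scalerAr mulrA.
rewrite mulrA eac // 1?eq_sym // mulNr -[e i * e j * _]mulrA IHs -scalerAr mulrA.
by rewrite add0n addSn exprS mulN1r scaleNr.
Qed.

(** Left multiplication by [e j] permutes the monomials up to sign and flips the parity of their
    length, and [g] ignores the sign. This change of variable stands behind every average below; it
    replaces translation in the finite group of signed monomials. The induction moves [e j] past the
    head letter and absorbs that letter into [g]. *)
Lemma sum_monM (X : zmodType) (g : bool -> A -> X) l j :
    (forall b x, g b (- x) = g b x) -> all (gtn d) l -> j \in l ->
  \sum_(s <- subs l) g (odd (size s)) (e j * mon s) =
  \sum_(s <- subs l) g (~~ odd (size s)) (mon s).
Proof.
move=> + ld jl; have jd : (j < d)%N := allP ld _ jl.
elim: l ld jl g => //= i l IH /andP[id ld] jl g gN.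
rewrite !big_cat !big_map /=; under [X in _ + X]eq_bigr do rewrite mon_cons.
under [X in _ = _ + X]eq_bigr do rewrite mon_cons negbK.
have [ij|ij] := eqVneq i j.
  subst i; rewrite addrC; congr (_ + _); apply: eq_bigr => s _.
  rewrite mulrA esq // mulr_algl.
  by case: (h2 jd) => ->; rewrite ?scaleN1r ?scale1r ?gN.
move: jl; rewrite inE eq_sym (negPf ij) /= => jl.
rewrite IH //; congr (_ + _).
under eq_bigr => s _ do rewrite mulrA eac // 1?eq_sym // mulNr gN -mulrA.
rewrite (IH ld jl (fun b x => g (~~ b) (e i * x))) => [|b x]; last by rewrite mulrN gN.
by apply: eq_bigr => s _; rewrite negbK.
Qed.

(** Span of the monomials of one parity, with one generator split off at a time. In this form,
    closure under multiplication by a generator requires no reordering of words. *)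
Fixpoint monspan (l : seq nat) (par : bool) (x : A) : Prop :=
  if l is i :: l' then
    exists a b, [/\ monspan l' par a, monspan l' (~~ par) b & x = a + e i * b]
  else exists2 k : R, x = k%:A & (par -> k = 0).

Lemma monspan0 l par : monspan l par 0.
Proof.
elim: l par => [|i l IH] par /=; first by exists 0; rewrite ?scale0r.
by exists 0, 0; split=> //; rewrite mulr0 addr0.
Qed.

Lemma monspanD l par x y :
  monspan l par x -> monspan l par y -> monspan l par (x + y).
Proof.
elim: l par x y => [|i l IH] par x y /=.
  by move=> [k -> k0] [m -> m0]; exists (k + m); rewrite ?scalerDl // => p;
    rewrite k0 // m0 // addr0.
move=> [a [b [sa sb ->]]] [a' [b' [sa' sb' ->]]].
exists (a + a'), (b + b'); split; [exact: IH|exact: IH|].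
by rewrite mulrDr addrACA.
Qed.

Lemma monspanZ l par k x : monspan l par x -> monspan l par (k *: x).
Proof.
elim: l par x => [|i l IH] par x /=.
  by move=> [m -> m0]; exists (k * m); rewrite ?scalerA // => p; rewrite m0 ?mulr0.
move=> [a [b [sa sb ->]]].
exists (k *: a), (k *: b); split; [exact: IH|exact: IH|].
by rewrite scalerDr scalerAr.
Qed.

Lemma monspan_sum l par (I : Type) (r : seq I) (P : pred I) (F : I -> A) :
  (forall i, P i -> monspan l par (F i)) -> monspan l par (\sum_(i <- r | P i) F i).
Proof.
by move=> HF; apply: big_ind => //; [exact: monspan0|exact: monspanD].
Qed.

Lemma monspan1 l : monspan l false 1.
Proof.
elim: l => [|i l IH] /=; first by exists 1; rewrite ?scale1r.
by exists 1, 0; split=> //; [exact: monspan0|rewrite mulr0 addr0].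
Qed.

Lemma monspanM l par j x : all (gtn d) l -> j \in l ->
  monspan l par x -> monspan l (~~ par) (e j * x).
Proof.
move=> + jl; move=> ld; have jd : (j < d)%N := allP ld _ jl.
elim: l ld jl par x => //= i l IH /andP[id ld] jl par x [a [b [sa sb ->]]].
have [ij|ij] := eqVneq i j.
  (* [e j] exchanges the two summands, because its square is the scalar [h j]. *)
  subst i; exists (h j *: b), a; split; [exact: monspanZ|by rewrite negbK|].
  by rewrite mulrDr mulrA esq // mulr_algl addrC.
move: jl; rewrite inE eq_sym (negPf ij) /= => jl.
exists (e j * a), (e j * (- b)); split; [exact: IH| |].
  by apply: IH => //; rewrite -scaleN1r; apply: monspanZ.
by rewrite mulrDr mulrA eac 1?eq_sym // mulNr mulrN mulrN mulrA.
Qed.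

Lemma monspan_coef l par x : uniq l -> monspan l par x ->
  exists c : seq nat -> R,
    x = \sum_(s <- subs l | odd (size s) == par) c s *: mon s.
Proof.
elim: l par x => [|i l IH] par x /=.
  move=> _ [k -> k0]; exists (fun _ => k).
  rewrite big_mkcond big_seq1 mon_nil /=; case: par k0 => //= -> //.
  by rewrite scale0r.
move=> /andP[il ul] [a [b [/(IH _ _ ul)[ca ->] /(IH _ _ ul)[cb ->] ->]]].
(* Since [i] is not in [l], membership of [i] tells the two halves of [subs (i :: l)] apart. *)
exists (fun s => if i \in s then cb (behead s) else ca s).
rewrite big_cat big_map /=; congr (_ + _).
  rewrite big_seq_cond [RHS]big_seq_cond; apply: eq_bigr => s /andP[/subs_subseq /mem_subseq sl _].
  by case: ifP => // /sl; rewrite (negPf il).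
rewrite mulr_sumr; apply: eq_big => s; first by case: (odd _) par => [] [].
by rewrite mem_head mon_cons -scalerAr.
Qed.

End Monomials.

(* Multiplication of [x.1 - i x.2] by [1 + i], respectively [1 - i]. *)
Definition rot_pos (R : pzRingType) (x : R * R) : R * R := (x.1 + x.2, x.2 - x.1).
Definition rot_neg (R : pzRingType) (x : R * R) : R * R := (x.1 - x.2, x.2 + x.1).

(** * Powers of 1 + i and 1 - i *)

Section GaussianPowers.
Variable R : rcfType.
Implicit Types (x : R * R) (c : R).
Local Notation Tp := (@rot_pos R).
Local Notation Tm := (@rot_neg R).
Local Notation sc c x := (c * x.1, c * x.2).

Lemma rot_posZ k c x : iter k Tp (sc c x) = sc c (iter k Tp x).
Proof. by elim: k => //= k ->; rewrite /rot_pos /= -mulrDr -mulrBr. Qed.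

Lemma rot_posK k x : iter k Tp (iter k Tm x) = sc (2 ^+ k) x.
Proof.
elim: k x => [|k IH] [a b]; first by rewrite /= !mul1r.
rewrite iterSr iterS.
have -> : Tp (Tm (iter k Tm (a, b))) = sc 2 (iter k Tm (a, b)).
  by case: (iter _ _ _) => u v; rewrite /rot_pos /rot_neg /=; congr pair; ring.
by rewrite rot_posZ IH /= !exprS !mulrA.
Qed.

Lemma rot_pos8 k x : iter (8 * k)%N Tp x = sc (16 ^+ k) x.
Proof.
elim: k x => [|k IH] [a b]; first by rewrite muln0 /= !mul1r.
rewrite mulnS iterD IH /= /rot_pos /=; congr pair; rewrite exprS; ring.
Qed.

(** Since (1 + i)(1 - i) = 2 and (1 + i)^8 = 16, only the difference of the two exponents modulo 8
    survives, up to a positive factor. *)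
Lemma rot_pos_mod p q r : p = (q + r)%N %[mod 8] ->
  exists2 c : R, 0 < c & iter p Tp (iter q Tm (1, 1)) = sc c (iter r Tp (1, 1)).
Proof.
move=> E.
(* Multiples of 8 on both sides turn the congruence into an equality of naturals, without
   subtraction. *)
have [a [b ab]] : exists a b, (p + 8 * a = q + (8 * b + r))%N.
  by exists ((q + r) %/ 8)%N, (p %/ 8)%N; lia.
exists (2 ^+ q * 16 ^+ b / 16 ^+ a); first by rewrite divr_gt0 ?mulr_gt0 ?exprn_gt0.
have a0 : (16 ^+ a : R) != 0 by rewrite expf_neq0 // pnatr_eq0.
have H : sc (16 ^+ a) (iter p Tp (iter q Tm (1, 1))) =
         sc (2 ^+ q * 16 ^+ b) (iter r Tp (1, 1)) :> R * R.
  rewrite -rot_posZ -rot_pos8 -iterD ab addnC iterD rot_posK.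
  by rewrite iterD rot_posZ rot_pos8 /=; congr pair; ring.
case: (iter p _ _) H => u v; case: (iter r _ _) => u' v' /= [H1 H2].
by congr pair; apply: (mulfI a0); rewrite ?H1 ?H2; field.
Qed.

(** Each factor 1 + i or 1 - i doubles the squared modulus, which is 2 at the start. *)
Lemma rot_norm p q : let z := iter p Tp (iter q Tm (1, 1)) in
  z.1 ^+ 2 + z.2 ^+ 2 = 2 * 2 ^+ (p + q).
Proof.
elim: p => [|p IH]; last first.
  rewrite addSn exprS mulrCA -IH /=.
  by case: (iter _ _ _) => u v /=; ring.
elim: q => [|q IH]; first by rewrite /=; ring.
rewrite addnS exprS mulrCA -IH /=.
by case: (iter _ _ _) => u v /=; ring.
Qed.

Lemma odd_bin2 n : odd 'C(n, 2) = ((n %% 4)%N \in [:: 2; 3]).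
Proof.
have H a b : odd 'C(4 * a + b, 2) = odd 'C(b, 2).
  elim: a => [|a IH]; first by rewrite muln0.
  have -> : (4 * a.+1 + b = (4 * a + b).+4)%N by lia.
  by rewrite !binS !bin1 !bin0 -IH; lia.
rewrite {1}(divn_eq n 4) mulnC H; have := ltn_pmod n (isT : (0 < 4)%N).
by move: (n %% 4)%N => [|[|[|[|b]]]].
Qed.

End GaussianPowers.

(** * Averaging over the monomials *)

(** In a rank factorization P = C B, idempotence cancels to B C = 1, and the trace is cyclic. *)
Lemma mxtrace_idem (F : fieldType) n (P : 'M[F]_n) : P *m P = P -> \tr P = (\rank P)%:R.
Proof.
move=> PP; have := mulmx_base P; set C := col_base P; set B := row_base P => CB.
have BC : B *m C = 1%:M.
  have : C *m (B *m C *m B) = C *m (1%:M *m B).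
    by rewrite mul1mx mulmxA mulmxA CB -mulmxA CB.
  by move=> /(row_full_inj (col_base_full P)) /(row_free_inj (row_base_free P)).
by rewrite -{1}CB mxtrace_mulC BC mxtrace1.
Qed.

Section OpTrace.
Import VectorInternalTheory.
Variables (F : fieldType) (n : nat).
Implicit Types (f g : 'M[F]_n -> 'M[F]_n) (A B : 'M[F]_n).

(** Trace of an operator on matrices, summed over the matrix units. Taking a plain function as
    argument lets it be evaluated on formulas such as [A *m T *m B] without packing them as linear
    maps. *)
Definition optr f : F := \sum_i \sum_j f (delta_mx i j) i j.

Lemma optrE f : optr f = \tr (lin_mx f).
Proof.
rewrite /optr pair_big /= /mxtrace (reindex _ (curry_mxvec_bij _ _)) /=.
by apply: eq_bigr => [[i j]] _ /=; rewrite !mxE /= mxvecE vec_mx_delta.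
Qed.

(** [linfun] uses the coordinates [v2r] of the vector space of matrices, [lin_mx] those of [mxvec];
    [D] and [D'] are the changes of basis between them. *)
Lemma optr_lfun (f : {linear 'M[F]_n -> 'M[F]_n}) : optr f = \tr (f2mx (linfun f)).
Proof.
pose D : 'M_(n * n, dim 'M[F]_n) := lin1_mx (v2r \o vec_mx).
pose D' : 'M_(dim 'M[F]_n, n * n) := lin1_mx (mxvec \o r2v).
have DD' : D *m D' = 1%:M.
  apply/row_matrixP => i; rewrite !rowE mulmxA !mul_rV_lin1 /= v2rK vec_mxK.
  by rewrite mulmx1.
have -> : f2mx (linfun f) = D' *m lin_mx f *m D.
  rewrite unlock; apply/row_matrixP => i; rewrite !rowE !mulmxA !mul_rV_lin1 /=.
  by rewrite !mxvecK.
by rewrite mxtrace_mulC mulmxA DD' mul1mx optrE.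
Qed.

Lemma optr_idem (f : {linear 'M[F]_n -> 'M[F]_n}) :
  (forall X, f (f X) = f X) -> optr f = (\dim (limg (linfun f)))%:R.
Proof.
move=> ff; rewrite optr_lfun.
have -> (g : 'End('M[F]_n)) : \dim (limg g) = \rank (f2mx g).
  by rewrite unlock /dimv /= !genmxE (eqmxMr _ (genmxE 1%:M)) mul1mx.
apply: mxtrace_idem; rewrite unlock; apply/row_matrixP => i.
by rewrite !rowE mulmxA !mul_rV_lin1 /= v2rK ff.
Qed.

Lemma optr_conj A B : optr (fun T => A *m T *m B) = \tr A * \tr B.
Proof.
rewrite /optr /mxtrace mulr_suml; apply: eq_bigr => i _; rewrite mulr_sumr.
apply: eq_bigr => j _; rewrite mxE (bigD1 j) //= big1 => [|k kj].
  rewrite addr0 mxE (bigD1 i) //= big1 => [|k ki]; last by rewrite mxE (negPf ki) mulr0.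
  by rewrite addr0 mxE !eqxx mulr1.
rewrite mxE big1 ?mul0r // => l _.
by rewrite mxE (negPf kj) andbF mulr0.
Qed.

Lemma optr_conj_tr A B : optr (fun T => A *m T^T *m B) = \tr (A^T *m B).
Proof.
rewrite /optr /mxtrace exchange_big; apply: eq_bigr => j _; rewrite mxE.
apply: eq_bigr => i _; rewrite mxE (bigD1 i) //= big1 => [|k ki].
  rewrite addr0 mxE (bigD1 j) //= big1 => [|k kj].
    by rewrite addr0 !mxE !eqxx mulr1.
  by rewrite !mxE (negPf kj) andbF mulr0.
rewrite mxE big1 ?mul0r // => l _.
by rewrite !mxE (negPf ki) mulr0.
Qed.

Lemma optr_comb (a k : F) f g :
  optr (fun T => a *: (f T + k *: g T)) = a * (optr f + k * optr g).
Proof.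
rewrite /optr [k * _]mulr_sumr -big_split mulr_sumr; apply: eq_bigr => i _ /=.
rewrite [k * _]mulr_sumr -big_split mulr_sumr; apply: eq_bigr => j _ /=.
by rewrite !mxE.
Qed.

(* Evaluating on the matrix units [delta_mx i j] with [l = i] takes the trace
   of the left factors. *)
Lemma conj_sum0_trace (I : Type) (r : seq I) (A B : I -> 'M[F]_n) :
    (forall T, \sum_(k <- r) A k *m T *m B k = 0) ->
  \sum_(k <- r) \tr (A k) *: B k = 0.
Proof.
move=> H; apply/matrixP => j m.
transitivity (\sum_i (\sum_(k <- r) A k *m delta_mx i j *m B k) i m); last first.
  by rewrite mxE big1 // => i _; rewrite H mxE.
rewrite summxE; under [RHS]eq_bigr do rewrite summxE.
rewrite exchange_big; apply: eq_bigr => k _; rewrite mxE /mxtrace mulr_suml.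
apply: eq_bigr => i _; rewrite mxE (bigD1 j) //= big1 => [|t tj].
  rewrite addr0 mxE (bigD1 i) //= big1 => [|t ti]; last by rewrite mxE (negPf ti) mulr0.
  by rewrite addr0 mxE !eqxx mulr1.
rewrite mxE big1 ?mul0r // => l _.
by rewrite mxE (negPf tj) andbF mulr0.
Qed.

End OpTrace.

(** A complex eigenvalue a + b i exists, and the real and imaginary parts of an eigenvector are both
    killed by (X - a)^2 + b^2. This replaces an eigenvalue when Schur's lemma is applied over the
    reals. *)
Lemma real_quadratic_eigen (R : rcfType) n (X : 'M[R]_n.+1) :
  exists a b, (X - a%:A) * (X - a%:A) + (b ^+ 2)%:A \isn't a GRing.unit.
Proof.
have [[a b] /eigenvalueP[v vX v0]] := eigenvalue_closed (map_mx (real_complex R) X) isT.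
pose x := map_mx (@complex.Re R) v; pose y := map_mx (@complex.Im R) v.
have ReM (z : R[i]) (t : R) : complex.Re (z * t%:C%C) = complex.Re z * t.
  by case: z => u w /=; rewrite mulr0 subr0.
have ImM (z : R[i]) (t : R) : complex.Im (z * t%:C%C) = complex.Im z * t.
  by case: z => u w /=; rewrite mulr0 add0r.
have xX : x *m X = a *: x - b *: y.
  apply/rowP => j; have /rowP/(_ j)/(congr1 (@complex.Re R)) := vX.
  rewrite !mxE raddf_sum /=; case: (v 0 j) => u w /= <-.
  by apply: eq_bigr => k _; rewrite !mxE ReM.
have yX : y *m X = a *: y + b *: x.
  apply/rowP => j; have /rowP/(_ j)/(congr1 (@complex.Im R)) := vX.
  rewrite !mxE raddf_sum /=; case: (v 0 j) => u w /= <-.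
  by apply: eq_bigr => k _; rewrite !mxE ImM.
have xa : x *m (X - a%:A) = - b *: y.
  by rewrite mulmxBr xX -scalemxAr mulmx1 addrAC subrr add0r scaleNr.
have ya : y *m (X - a%:A) = b *: x.
  by rewrite mulmxBr yX -scalemxAr mulmx1 addrAC subrr add0r.
exists a, b; apply/negP => U.
have inj (z : 'rV[R]_n.+1) : z *m ((X - a%:A) * (X - a%:A) + (b ^+ 2)%:A) = 0 -> z = 0.
  by move=> z0; rewrite -[z](mulmxK (U : _ \in unitmx)) z0 mul0mx.
have x0 : x = 0.
  apply: inj; rewrite mulmxDr -mulmxE mulmxA xa -scalemxAl ya scalerA -scalemxAr mulmx1.
  by rewrite -scalerDl mulNr -expr2 addNr scale0r.
have y0 : y = 0.
  apply: inj; rewrite mulmxDr -mulmxE mulmxA ya -scalemxAl xa scalerA -scalemxAr mulmx1.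
  by rewrite -scalerDl mulrN -expr2 addNr scale0r.
move/negP: v0; apply; apply/eqP/rowP => j.
have /rowP/(_ j) := x0; have /rowP/(_ j) := y0; rewrite !mxE.
by case: (v 0 j) => u w /= -> ->.
Qed.

(** * Matrices satisfying the Clifford relations *)

Section CliffordMatrices.
Variables (R : rcfType) (n p q : nat) (e : nat -> 'M[R]_n.+1).
Let d := (p + q)%N.
Definition sgn_at (i : nat) : R := if (i < p)%N then 1 else -1.
Local Notation h := sgn_at.
Hypothesis esq : forall i, (i < d)%N -> e i * e i = (h i)%:A.
Hypothesis eac : forall i j, (i < d)%N -> (j < d)%N -> i != j ->
  e i * e j = - (e j * e i).

(** One predicate covers the commutant ([false]) and the anticommutant ([true]), so that averages
    and traces are treated once. The hypothesis [schur] is what irreducibility provides for both. *)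
Definition twcomm (s : bool) (X : 'M[R]_n.+1) : Prop :=
  forall j, (j < d)%N -> X * e j = (-1) ^+ s *: (e j * X).

Hypothesis schur : forall s X, twcomm s X -> X = 0 \/ X \is a GRing.unit.

Local Notation l := (iota 0 d).
Local Notation mon := (mon e).
Local Notation N := ((2 ^ d)%:R : R).

Lemma sgn_at_pm1 i : h i = 1 \/ h i = -1.
Proof. by rewrite /h; case: ifP; [left|right]. Qed.

Lemma sgn_at_sq i : h i * h i = 1.
Proof. by case: (sgn_at_pm1 i) => ->; rewrite ?mulrNN mulr1. Qed.

Lemma all_iota : all (gtn d) l.
Proof. by apply/allP => j; rewrite mem_iota. Qed.

Lemma mem_iota0 j : (j \in l) = (j < d)%N.
Proof. by rewrite mem_iota. Qed.

Lemma subs_all s : s \in subs l -> all (gtn d) s.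
Proof. by move=> /subs_subseq /mem_subseq sl; apply/allP => j /sl; rewrite mem_iota0. Qed.

Lemma e_unit j : (j < d)%N -> e j \is a GRing.unit.
Proof.
move=> jd; apply/unitrP; exists (h j *: e j).
by rewrite -scalerAl -scalerAr !esq // scalerA sgn_at_sq scale1r.
Qed.

Lemma e_inv j : (j < d)%N -> (e j)^-1 = h j *: e j.
Proof.
move=> jd; apply: (mulrI (e_unit jd)); rewrite mulrV ?e_unit //.
by rewrite -scalerAr esq // scalerA sgn_at_sq scale1r.
Qed.

Lemma mon_unit s : all (gtn d) s -> mon s \is a GRing.unit.
Proof.
elim: s => [|i s IH] /=; first by rewrite mon_nil unitr1.
by move=> /andP[id /IH ?]; rewrite mon_cons unitrMr ?e_unit.
Qed.

Lemma N_gt0 : 0 < N. Proof. by rewrite ltr0n expn_gt0. Qed.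
Lemma N_neq0 : N != 0. Proof. exact: lt0r_neq0 N_gt0. Qed.

Lemma twcomm_mon b X s : twcomm b X -> all (gtn d) s ->
  X * mon s = (-1) ^+ (b && odd (size s)) *: (mon s * X).
Proof.
move=> cX; elim: s => [|i s IH] /=.
  by rewrite mon_nil andbF scale1r mulr1 mul1r.
move=> /andP[id /IH IHs]; rewrite mon_cons mulrA cX // -scalerAl -[e i * X * _]mulrA IHs.
rewrite -scalerAr scalerA mulrA -signr_addb; congr (_ ^+ _ *: _).
by case: b {cX IH IHs} => //=; case: (odd _).
Qed.

(** The monomial acts by conjugation, so its sign does not matter: this is the condition of
    [sum_monM] on [g]. *)
Definition avg_term (s b : bool) (T x : 'M[R]_n.+1) : 'M[R]_n.+1 :=
  (-1) ^+ (s && b) *: (x * T * x^-1).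

Definition avg (s : bool) (T : 'M[R]_n.+1) : 'M[R]_n.+1 :=
  N^-1 *: \sum_(t <- subs l) avg_term s (odd (size t)) T (mon t).

Lemma avg_is_linear s : linear (avg s).
Proof.
move=> k T U; rewrite /avg [k *: (_ *: _)]scalerA [k * _]mulrC -[_ * k *: _]scalerA.
rewrite -scalerDr; congr (_ *: _); rewrite scaler_sumr -big_split /=.
apply: eq_bigr => t _; rewrite /avg_term [k *: (_ *: _)]scalerA [k * _]mulrC.
rewrite -[_ * k *: _]scalerA -scalerDr; congr (_ *: _).
by rewrite mulrDr mulrDl -scalerAr -scalerAl.
Qed.
HB.instance Definition _ s := GRing.isLinear.Build R _ _ _ (avg s) (avg_is_linear s).

Lemma avg_termN s T b x : avg_term s b T (- x) = avg_term s b T x.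
Proof. by rewrite /avg_term invrN mulrN mulNr mulNr opprK. Qed.

Lemma avg_comm s T : twcomm s (avg s T).
Proof.
move=> j jd; have ju := e_unit jd.
suff H : e j * avg s T * (e j)^-1 = (-1) ^+ s *: avg s T.
  move: (avg s T) H => X H.
  rewrite -[e j * _](divrK ju) H -scalerAl scalerA -expr2 sqrr_sign.
  by rewrite scale1r.
rewrite /avg -scalerAr -scalerAl scalerA [_ * N^-1]mulrC -scalerA; congr (_ *: _).
transitivity (\sum_(t <- subs l) avg_term s (odd (size t)) T (e j * mon t)).
  rewrite mulr_sumr mulr_suml; apply: eq_big_seq => t tl.
  rewrite /avg_term -scalerAr -scalerAl invrM ?mon_unit ?subs_all //.
  by rewrite !mulrA.
rewrite (sum_monM (fun i _ => sgn_at_pm1 i) esq eac (g := fun b => avg_term s b T));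
  rewrite ?all_iota ?mem_iota0 //; last by move=> b x; rewrite avg_termN.
rewrite scaler_sumr; apply: eq_bigr => t _.
rewrite /avg_term scalerA -signr_addb; congr (_ ^+ _ *: _).
by case: s; case: (odd _).
Qed.

Lemma avg_id s T : twcomm s T -> avg s T = T.
Proof.
move=> cT; rewrite /avg.
rewrite (eq_big_seq (fun _ => T)) => [|t tl].
  rewrite big_const_seq count_predT size_subs size_iota iter_addr_0.
  by rewrite -scaler_nat scalerA mulVf ?N_neq0 // scale1r.
have tu := mon_unit (subs_all tl).
rewrite /avg_term -{2}(mulrK tu T) (twcomm_mon cT (subs_all tl)).
by rewrite -scalerAl.
Qed.

Lemma optr_avg s : optr (avg s) =
  N^-1 * \sum_(t <- subs l) (-1) ^+ (s && odd (size t)) * (\tr (mon t) * \tr (mon t)^-1).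
Proof.
transitivity (N^-1 * \sum_(t <- subs l) (-1) ^+ (s && odd (size t)) *
   optr (fun T => mon t *m T *m (mon t)^-1)); last first.
  by congr (_ * _); apply: eq_bigr => t _; rewrite optr_conj.
rewrite /optr; under [X in _ = _ * X]eq_bigr => t _.
  rewrite mulr_sumr; under eq_bigr => i _ do rewrite mulr_sumr.
  over.
rewrite [in RHS]exchange_big mulr_sumr; apply: eq_bigr => i _.
rewrite [in RHS]exchange_big mulr_sumr; apply: eq_bigr => j _.
rewrite /avg mxE summxE; congr (_ * _); apply: eq_bigr => t _.
by rewrite /avg_term mxE.
Qed.

Lemma mxtraceN m (X : 'M[R]_m) : \tr (- X) = - \tr X.
Proof. by rewrite raddfN. Qed.

Lemma mxtrace_anti j X : (j < d)%N -> e j * X = - (X * e j) -> \tr X = 0.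
Proof.
move=> jd eX; have ju := e_unit jd.
have : \tr X = - \tr X.
  transitivity (\tr (e j * X * (e j)^-1)); last by rewrite eX mulNr mulrK // mxtraceN.
  by rewrite -mulmxE mxtrace_mulC mulmxE mulrA mulVr // mul1r.
by move/eqP; rewrite -subr_eq0 opprK -mulr2n mulrn_eq0 /= => /eqP.
Qed.

Definition trivial_index (t : seq nat) : bool := (t == [::]) || odd d && (t == l).

Lemma mxtrace_mon t : t \in subs l -> ~~ trivial_index t -> \tr (mon t) = 0.
Proof.
move=> tl; rewrite negb_or => /andP[t0 tF]; have td := subs_all tl.
have ut : uniq t := subseq_uniq (subs_subseq tl) (iota_uniq 0 d).
(* By [mon_comm], [e j] anticommutes with [mon t] when [size t] plus the multiplicity of [j] is odd.
   For even length any [j] in [t] will do, for odd length any [j] outside [t]; the trivial indices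
   are those without such a [j]. *)
have [j jd jt] : exists2 j, (j < d)%N & (j \in t) != odd (size t).
  case: (boolP (odd (size t))) => ot; last first.
    case: t t0 tl td {ut tF ot} => // j t _ _ /andP[jd _] ; exists j => //.
    by rewrite mem_head.
  case: (boolP (all (mem t) l)) => [/allP lt|/allPn[j]]; last first.
    by rewrite mem_iota0 => jd jt; exists j => //; rewrite (negPf (jt : j \notin t)).
  have tE : t = l.
    apply: (subs_iota_eq tl (subs_full _)) => i; apply/idP/idP; last exact: lt.
    by move/(allP td); rewrite mem_iota0.
  by move: tF; rewrite tE -{1}(size_iota 0 d) -tE ot eqxx.
apply: (mxtrace_anti jd); rewrite (mon_comm eac) // count_uniq_mem //.
rewrite -signr_odd oddD; move: jt.
by case: (j \in t); case: (odd (size t)) => //= _; rewrite expr1 scaleN1r.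
Qed.

Local Notation nu := (mon l).
Local Notation dimS := ((n.+1)%:R : R).

Lemma dimS_gt0 : 0 < dimS. Proof. by rewrite ltr0n. Qed.

Lemma sum_trivial_index (X : zmodType) (F : seq nat -> X) :
    (forall t, t \in subs l -> ~~ trivial_index t -> F t = 0) ->
  \sum_(t <- subs l) F t = F [::] + (if odd d then F l else 0).
Proof.
move=> F0; have ul := subs_uniq (iota_uniq 0 d).
rewrite (bigD1_seq [::]) ?subs_nil //=; congr (_ + _); case: ifP => od; last first.
  rewrite big_seq_cond big1 // => t /andP[tl t0].
  by apply: F0 => //; rewrite /trivial_index od orbF.
have l0 : l != [::] by rewrite -size_eq0 size_iota; case: (d) od.
rewrite big_mkcond (bigD1_seq l) ?subs_full //= l0 big_seq_cond big1 ?addr0 //.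
move=> t /andP[tl tF]; case: ifP => // t0; apply: F0 => //.
by rewrite /trivial_index negb_or t0 (negPf tF) andbF.
Qed.

Lemma optr_avg_even s : ~~ odd d -> optr (avg s) = N^-1 * dimS ^+ 2.
Proof.
move=> od; rewrite optr_avg sum_trivial_index ?(negPf od) => [|t tl tt].
  by rewrite addr0 andbF mon_nil invr1 mxtrace1 mul1r expr2.
by rewrite (mxtrace_mon tl tt) mul0r mulr0.
Qed.

Lemma optr_avg_odd s : odd d ->
  optr (avg s) = N^-1 * (dimS ^+ 2 + (-1) ^+ s * (\tr nu * \tr nu^-1)).
Proof.
move=> od; rewrite optr_avg sum_trivial_index ?od => [|t tl tt].
  by rewrite andbF mon_nil invr1 mxtrace1 mul1r expr2 size_iota od andbT.
by rewrite (mxtrace_mon tl tt) mul0r mulr0.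
Qed.

(* Up to signs the monomials form a finite group, so averaging yields an inner
   product for which they are orthogonal; [star] is its adjoint. *)
Definition Gram : 'M[R]_n.+1 := \sum_(t <- subs l) (mon t)^T * mon t.
Local Notation Q := Gram.

Lemma trM (X Y : 'M[R]_n.+1) : (X * Y)^T = Y^T * X^T.
Proof. exact: trmx_mul. Qed.

Lemma GramT : Q^T = Q.
Proof.
rewrite /Q raddf_sum; apply: eq_bigr => t _ /=.
by rewrite -mulmxE trmx_mul trmxK.
Qed.

Lemma row_sq_ge0 m (v : 'rV[R]_m) : 0 <= (v *m v^T) 0 0.
Proof. by rewrite mxE sumr_ge0 // => i _; rewrite mxE -expr2 sqr_ge0. Qed.

Lemma row_sq_gt0 m (v : 'rV[R]_m) : v != 0 -> 0 < (v *m v^T) 0 0.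
Proof.
move=> v0; rewrite lt_neqAle row_sq_ge0 andbT; apply: contra v0.
rewrite mxE eq_sym psumr_eq0 => [/allP H|i _]; last by rewrite mxE -expr2 sqr_ge0.
apply/eqP/rowP => i; have := H i (mem_index_enum _).
by rewrite !mxE -expr2 sqrf_eq0 => /eqP.
Qed.

Lemma Gram_gt0 (v : 'rV[R]_n.+1) : v != 0 -> 0 < (v *m Q *m v^T) 0 0.
Proof.
move=> v0; rewrite /Q mulmx_sumr mulmx_suml summxE.
rewrite (bigD1_seq [::]) ?subs_nil ?subs_uniq ?iota_uniq //=.
apply: ltr_wpDr; last by rewrite mon_nil trmx1 mulr1 mulmx1 row_sq_gt0.
apply: sumr_ge0 => t _; rewrite -mulmxE mulmxA -mulmxA.
by have := row_sq_ge0 (v *m (mon t)^T); rewrite trmx_mul trmxK.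
Qed.

Lemma Gram_unit : Q \is a GRing.unit.
Proof.
rewrite -[_ \is a _]/(Q \in unitmx) unitmxE unitfE; apply/negP => /det0P[v v0 vQ].
by have := Gram_gt0 v0; rewrite vQ mul0mx mxE ltxx.
Qed.

Lemma Gram_e j : (j < d)%N -> (e j)^T * Q * e j = Q.
Proof.
move=> jd; pose g (_ : bool) (x : 'M[R]_n.+1) := x^T * x.
have gN b x : g b (- x) = g b x by rewrite /g raddfN mulrNN.
(* [sum_monM] multiplies on the left, while the conjugated sum contains [mon t * e j]. The two
   products differ by a sign, which the quadratic [g] ignores. *)
rewrite {2}/Q -(sum_monM (fun i _ => sgn_at_pm1 i) esq eac gN all_iota (j := j)) ?mem_iota0 //.
rewrite /Q mulr_sumr mulr_suml; apply: eq_big_seq => t tl.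
have [b E] : exists b : bool, e j * mon t = (-1) ^+ b *: (mon t * e j).
  by exists (odd (size t + count_mem j t)); rewrite signr_odd (mon_comm eac) // subs_all.
rewrite E /g linearZ /= -scalerAl -scalerAr scalerA -expr2 sqrr_sign scale1r.
by rewrite -!mulmxE trmx_mul !mulmxA.
Qed.

Definition star (T : 'M[R]_n.+1) : 'M[R]_n.+1 := Q^-1 * T^T * Q.

Lemma star_is_linear : linear star.
Proof. by move=> k T U; rewrite /star linearP mulrDr mulrDl -scalerAr -scalerAl. Qed.
HB.instance Definition _ := GRing.isLinear.Build R _ _ _ star star_is_linear.

Lemma starZ k T : star (k *: T) = k *: star T. Proof. exact: linearZ. Qed.

Lemma starD T U : star (T + U) = star T + star U. Proof. exact: linearD. Qed.

Lemma starM (T U : 'M[R]_n.+1) : star (T * U) = star U * star T.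
Proof. by rewrite /star trM !mulrA (mulrK Gram_unit). Qed.

Lemma star1 : star 1 = 1.
Proof. by rewrite /star trmx1 mulr1 mulVr ?Gram_unit. Qed.

Lemma starK T : star (star T) = T.
Proof.
have QT : (Q^-1)^T = Q^-1 by rewrite -[Q^-1]/(invmx Q) trmx_inv GramT.
rewrite /star !trM trmxK QT GramT !mulrA.
by rewrite mulVr ?Gram_unit // mul1r mulrVK ?Gram_unit.
Qed.

Lemma star_e j : (j < d)%N -> star (e j) = (e j)^-1.
Proof.
move=> jd; apply: (mulIr (e_unit jd)); rewrite mulVr ?e_unit //.
by rewrite /star -!mulrA [_ * (Q * _)]mulrA Gram_e // mulVr ?Gram_unit.
Qed.

Lemma star_mon t : all (gtn d) t -> star (mon t) = (mon t)^-1.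
Proof.
elim: t => [|i t IH] /=; first by rewrite mon_nil star1 invr1.
by move=> /andP[id td]; rewrite mon_cons starM IH // star_e // invrM ?e_unit ?mon_unit.
Qed.

Lemma mxtrace_star T : \tr (star T) = \tr T.
Proof.
rewrite /star -!mulmxE mxtrace_mulC mulmxA mulmxE mulrV ?Gram_unit // mul1r.
exact: mxtrace_tr.
Qed.

(** The hypothesis reads X^T Q X = k Q, so [k] is a quotient of two positive values of the inner
    product. Every sign of a square below is decided in this way. *)
Lemma star_sq_gt0 X k : star X * X = k%:A -> X != 0 -> 0 < k.
Proof.
move=> E X0.
have E' : X^T * Q * X = k *: Q.
  have <- : Q * star X = X^T * Q by rewrite /star !mulrA mulrV ?Gram_unit // mul1r.
  by rewrite -mulrA E -scalerAr mulr1.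
have [v v0 vX] : exists2 v : 'rV[R]_n.+1, v != 0 & v *m X^T != 0.
  have : X^T != 0 by rewrite trmx_eq0.
  move=> /rowV0Pn[w /submxP[v ->]] w0; exists v => //.
  by apply: contraNneq w0 => ->; rewrite mul0mx.
have EQ : (v *m X^T) *m Q *m (v *m X^T)^T = k *: (v *m Q *m v^T).
  rewrite trmx_mul trmxK mulmxA -[v *m X^T *m Q]mulmxA -[v *m (X^T *m Q) *m X]mulmxA.
  by rewrite (E' : X^T *m Q *m X = _) -scalemxAr -scalemxAl.
by have := Gram_gt0 vX; rewrite EQ mxE pmulr_lgt0 // Gram_gt0.
Qed.

Lemma twcomm_star s X : twcomm s X -> twcomm s (star X).
Proof.
move=> cX j jd; have := cX _ jd => /(congr1 star); rewrite linearZ /= !starM.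
rewrite star_e // e_inv // -scalerAl -scalerAr [_ *: (_ *: (_ * _))]scalerA.
rewrite [_ * h j]mulrC -scalerA => /(congr1 (fun Y => h j *: Y)).
rewrite !(scalerA (h j) (h j)) sgn_at_sq !scale1r => ->.
by rewrite scalerA -expr2 sqrr_sign scale1r.
Qed.

Lemma star_avg s T : star (avg s T) = avg s (star T).
Proof.
rewrite /avg linearZ /= raddf_sum; congr (_ *: _); apply: eq_big_seq => t tl /=.
rewrite /avg_term linearZ /= !starM -star_mon ?subs_all // starK star_mon ?subs_all //.
by rewrite mulrA.
Qed.

Lemma twcommD s X Y : twcomm s X -> twcomm s Y -> twcomm s (X + Y).
Proof. by move=> cX cY j jd; rewrite mulrDl cX // cY // -scalerDr mulrDr. Qed.

Lemma twcommZ s k X : twcomm s X -> twcomm s (k *: X).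
Proof.
by move=> cX j jd; rewrite -scalerAl cX // -scalerAr !scalerA mulrC.
Qed.

Lemma twcommM s s' X Y : twcomm s X -> twcomm s' Y -> twcomm (s (+) s') (X * Y).
Proof.
move=> cX cY j jd; rewrite -[X * Y * _]mulrA cY // -scalerAr [X * (_ * _)]mulrA cX //.
by rewrite -scalerAl scalerA mulrA addbC signr_addb.
Qed.

Lemma twcomm_scalar k : twcomm false k%:A.
Proof. by move=> j jd; rewrite mulr_algl mulr_algr scale1r. Qed.

(** The matrix (X - a)^2 + b^2 of [real_quadratic_eigen] commutes with the generators and is
    singular, so it is 0 by [schur]. Then X - a is self-adjoint with square -b^2, which contradicts
    positivity unless X = a. *)
Lemma commutant_sym_scalar X : twcomm false X -> star X = X -> exists k, X = k%:A.
Proof.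
move=> cX sX.
have [a [b ab]] := real_quadratic_eigen X.
exists a; apply/eqP; rewrite -subr_eq0; apply/negP => /negP X0.
have cY : twcomm false (X - a%:A).
  by apply: twcommD => //; rewrite -scaleN1r; apply/twcommZ/twcomm_scalar.
have sY : star (X - a%:A) = X - a%:A by rewrite raddfB /= linearZ /= star1 sX.
have YY : (X - a%:A) * (X - a%:A) = (- b ^+ 2)%:A.
  have cZ : twcomm false ((X - a%:A) * (X - a%:A) + (b ^+ 2)%:A).
    apply: twcommD; last exact: twcomm_scalar.
    exact: (twcommM (s := false) (s' := false)).
  case: (schur cZ) => [/eqP|u]; last by rewrite u in ab.
  by rewrite addr_eq0 scaleNr => /eqP.
have := star_sq_gt0 (X := X - a%:A); rewrite sY => /(_ _ YY X0).
by rewrite oppr_gt0 ltNge sqr_ge0.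
Qed.

Definition proj (s b : bool) (T : 'M[R]_n.+1) : 'M[R]_n.+1 :=
  2^-1 *: (avg s T + (-1) ^+ b *: star (avg s T)).

Lemma proj_is_linear s b : linear (proj s b).
Proof.
move=> k T U; rewrite /proj [avg s _]linearP [star _]linearP.
rewrite [k *: (2^-1 *: _)]scalerA [k * _]mulrC -[_ * k *: _]scalerA -scalerDr.
congr (_ *: _); rewrite !scalerDr -!addrA; congr (_ + _); rewrite addrCA; congr (_ + _).
by rewrite !scalerA [k * _]mulrC.
Qed.
HB.instance Definition _ s b := GRing.isLinear.Build R _ _ _ (proj s b) (proj_is_linear s b).

Definition starspace (s b : bool) (T : 'M[R]_n.+1) : Prop := twcomm s T /\ star T = (-1) ^+ b *: T.

Lemma proj_starspace s b T : starspace s b (proj s b T).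
Proof.
have cA := avg_comm s T; split.
  by apply/twcommZ/twcommD => //; apply/twcommZ/twcomm_star.
rewrite /proj starZ starD [star (_ ^+ _ *: _)]starZ starK.
rewrite [RHS]scalerA [_ * 2^-1]mulrC -[RHS]scalerA; congr (_ *: _).
move: (avg s T) (star _) => X Y.
by rewrite scalerDr scalerA -expr2 sqrr_sign scale1r addrC.
Qed.

Lemma proj_id s b T : starspace s b T -> proj s b T = T.
Proof.
move=> [cT sT]; rewrite /proj avg_id // sT scalerA -expr2 sqrr_sign scale1r.
by rewrite -[X in X + X]scale1r -scalerDl scalerA mulVf ?scale1r // pnatr_eq0.
Qed.

Definition starimg s b : {vspace 'M[R]_n.+1} := limg (linfun (proj s b)).

Lemma starimgP s b T : reflect (starspace s b T) (T \in starimg s b).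
Proof.
apply: (iffP idP) => [/memv_imgP[U _ ->]|sT]; first by rewrite lfunE; apply: proj_starspace.
have -> : T = linfun (proj s b) T by rewrite lfunE /= proj_id.
exact/memv_img/memvf.
Qed.

Lemma starspace_split s T : twcomm s T -> exists A B,
  [/\ starspace s false A, starspace s true B & T = A + B].
Proof.
move=> cT; exists (proj s false T), (proj s true T); split; try exact: proj_starspace.
rewrite /proj avg_id // -scalerDr scale1r scaleN1r addrACA subrr addr0.
by rewrite -[X in X + X]scale1r -scalerDl scalerA mulVf ?scale1r // pnatr_eq0.
Qed.

(** The sign of the square of [mon t]: the second copy of the head letter passes through the tail
    and meets the first copy, where they give [h i]. *)
Fixpoint eps (t : seq nat) : R :=
  if t is i :: t' then (-1) ^+ odd (size t' + count_mem i t') * h i * eps t' else 1.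

Lemma mon_sq t : all (gtn d) t -> mon t * mon t = (eps t)%:A.
Proof.
elim: t => [|i t IH] /=; first by rewrite mon_nil mulr1 scale1r.
move=> /andP[id td]; rewrite mon_cons.
have E : mon t * e i = (-1) ^+ odd (size t + count_mem i t) *: (e i * mon t).
  by rewrite (mon_comm eac) // signr_odd scalerA -expr2 sqrr_sign scale1r.
rewrite -mulrA [mon t * _]mulrA E -scalerAl -scalerAr -[e i * _ * mon t]mulrA IH // mulrA esq //.
by rewrite mulr_algl scalerA scalerA.
Qed.

Lemma eps_sq t : eps t * eps t = 1.
Proof.
elim: t => [|i t IH] /=; first by rewrite mulr1.
by rewrite mulrACA IH mulr1 mulrACA sgn_at_sq mulr1 -expr2 sqrr_sign.
Qed.

Lemma mon_inv t : all (gtn d) t -> (mon t)^-1 = eps t *: mon t.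
Proof.
move=> td; have mu := mon_unit td; apply: (mulrI mu).
by rewrite mulrV // -scalerAr mon_sq // scalerA eps_sq scale1r.
Qed.

Lemma mon_invsq t : all (gtn d) t -> (mon t)^-1 * (mon t)^-1 = (eps t)%:A.
Proof.
move=> td; rewrite mon_inv //.
by rewrite -scalerAl -scalerAr mon_sq // !scalerA eps_sq mul1r.
Qed.

Definition epsum (s : bool) (L : seq nat) : R :=
  \sum_(t <- subs L) (-1) ^+ (s && odd (size t)) * eps t.

(** As for a Frobenius-Schur indicator, the term of a monomial m contributes the trace of m^-2,
    because [star] inverts m; and m^-2 is the scalar [eps]. *)
Lemma optr_star_avg s : optr (fun T => star (avg s T)) = N^-1 * (dimS * epsum s l).
Proof.
transitivity (N^-1 * \sum_(t <- subs l) (-1) ^+ (s && odd (size t)) *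
   optr (fun T => mon t *m Q^-1 *m T^T *m (Q *m (mon t)^-1))); last first.
  congr (_ * _); rewrite mulr_sumr; apply: eq_big_seq => t tl.
  rewrite mulrCA; congr (_ * _); rewrite optr_conj_tr mulmxE.
  have QT : (Q^-1)^T = Q^-1 by rewrite -[Q^-1]/(invmx Q) trmx_inv GramT.
  rewrite trM QT mulrA -[_ * Q * _]/(star (mon t) * _) star_mon ?subs_all //.
  by rewrite mon_invsq ?subs_all // mxtraceZ mxtrace1 mulrC.
rewrite /optr; under [X in _ = _ * X]eq_bigr => t _.
  rewrite mulr_sumr; under eq_bigr => i _ do rewrite mulr_sumr.
  over.
rewrite [in RHS]exchange_big mulr_sumr; apply: eq_bigr => i _.
rewrite [in RHS]exchange_big mulr_sumr; apply: eq_bigr => j _.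
rewrite star_avg /avg mxE summxE; congr (_ * _); apply: eq_bigr => t _.
by rewrite /avg_term mxE /star !mulmxE !mulrA.
Qed.

Lemma proj_idem s b T : proj s b (proj s b T) = proj s b T.
Proof. exact/proj_id/proj_starspace. Qed.

(** [proj s b] is idempotent, so the dimension of its image is its trace, a combination of the two
    traces already computed. *)
Lemma dim_starimg s b : 2 * (\dim (starimg s b))%:R =
  optr (avg s) + (-1) ^+ b * (N^-1 * (dimS * epsum s l)).
Proof.
rewrite -optr_idem; last exact: proj_idem.
by rewrite optr_comb optr_star_avg mulrA divff ?mul1r // pnatr_eq0.
Qed.

(** A monomial t preceded by the new letter carries the extra sign (-1)^|t| [h i], which exchanges
    the plain sum with the one signed by parity. The resulting map on the pair of sums is [rot_pos]
    or [rot_neg]. *)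
Lemma epsum_cons s i L : i \notin L ->
  epsum s (i :: L) = epsum s L + (-1) ^+ s * h i * epsum (~~ s) L.
Proof.
move=> iL; rewrite /epsum /= big_cat big_map; congr (_ + _).
rewrite mulr_sumr; apply: eq_big_seq => t tl /=.
have -> : count_mem i t = 0%N.
  apply/count_memPn; apply: contra iL; exact: (mem_subseq (subs_subseq tl)).
by rewrite addn0; case: s; case: (odd _); rewrite /= ?expr0 ?expr1; ring.
Qed.

(** Reversing a word of length k takes 'C(k, 2) transpositions, and [k - (p - j)] of its letters
    have square -1. The inner subtraction is truncated to 0 once [j] exceeds [p]. *)
Lemma eps_iota j k : (j + k = d)%N ->
  eps (iota j k) = (-1) ^+ ('C(k, 2) + (k - (p - j)))%N.
Proof.
elim: k j => [|k IH] j jk /=; first by rewrite bin0n expr0.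
rewrite IH; last by lia.
have -> : count_mem j (iota j.+1 k) = 0%N.
  by apply/count_memPn; rewrite mem_iota ltnn.
rewrite size_iota addn0 signr_odd binS bin1 /h.
case: ltnP => jp.
  by rewrite mulr1 -exprD; congr (_ ^+ _); lia.
by rewrite mulrN1 mulNr -exprD -mulN1r -exprS; congr (_ ^+ _); lia.
Qed.

Lemma epsum_iota j k : (j + k = d)%N ->
  (epsum false (iota j k), epsum true (iota j k)) =
  iter (p - j) (@rot_pos R) (iter (k - (p - j)) (@rot_neg R) (1, 1)).
Proof.
elim: k j => [|k IH] j jk.
  have -> : (p - j = 0)%N by lia.
  by rewrite /epsum /= !big_seq1 /= expr0 mulr1.
have jn : j \notin iota j.+1 k by rewrite mem_iota ltnn.
rewrite /= !epsum_cons //=; have := IH j.+1; rewrite addSnnS => /(_ jk).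
rewrite /h expr0 expr1 mul1r; case: ltnP => jp.
  have -> : (p - j = (p - j.+1).+1)%N by lia.
  rewrite subSS /= => <-; rewrite /rot_pos /=; congr pair; ring.
have -> : (p - j = 0)%N by lia.
have -> : (p - j.+1 = 0)%N by lia.
rewrite !subn0 /= => <-; rewrite /rot_neg /=; congr pair; ring.
Qed.

Lemma epsum_full :
  (epsum false l, epsum true l) = iter p (@rot_pos R) (iter q (@rot_neg R) (1, 1)).
Proof. by rewrite epsum_iota // subn0 /d addKn. Qed.

Local Notation z0 := (epsum false l).
Local Notation z1 := (epsum true l).

Lemma epsum_norm : z0 ^+ 2 + z1 ^+ 2 = 2 * N.
Proof. by have := rot_norm R p q; rewrite -epsum_full /= => ->; rewrite natrX. Qed.

Lemma nu_twcomm : twcomm (~~ odd d) nu.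
Proof.
move=> j jd; rewrite (mon_comm eac) ?all_iota // size_iota count_uniq_mem ?iota_uniq //.
by rewrite mem_iota0 jd addn1 -[_ ^+ d.+1]signr_odd /= scalerA -signr_addb addbb scale1r.
Qed.

(** * Commutant and anticommutant for each residue of p - q modulo 8 *)

Section Residue.
Variable r : nat.
Hypotheses (r8 : (r < 8)%N) (pqr : p = (q + r)%N %[mod 8]).

Lemma residue_odd : odd d = odd r.
Proof. by rewrite /d; lia. Qed.

Lemma nu_sq : nu * nu = ((-1) ^+ odd ('C(d, 2) + q))%:A.
Proof.
by rewrite mon_sq ?all_iota // eps_iota // subn0 {2}/d addKn signr_odd.
Qed.

Lemma nu_sq_pos : r \in [:: 1; 5]%N -> nu * nu = 1.
Proof.
move=> ro; rewrite nu_sq oddD odd_bin2.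
suff -> : ((d %% 4)%N \in [:: 2; 3]) (+) odd q = false by rewrite expr0 scale1r.
by move: ro pqr; rewrite /d !inE; lia.
Qed.

Lemma nu_sq_neg : r \in [:: 3; 7]%N -> nu * nu = -1.
Proof.
move=> ro; rewrite nu_sq oddD odd_bin2.
suff -> : ((d %% 4)%N \in [:: 2; 3]) (+) odd q = true by rewrite expr1 scaleN1r.
by move: ro pqr; rewrite /d !inE; lia.
Qed.

(** Here [nu] is central with square 1, so (nu - 1)(nu + 1) = 0, and [schur] applies to nu - 1. *)
Lemma nu_pm1 : r \in [:: 1; 5]%N -> nu = 1 \/ nu = -1.
Proof.
move=> ro; have od : odd d by rewrite residue_odd; move: ro; rewrite !inE; lia.
have := nu_twcomm; rewrite od /= => cnu.
have c1 : twcomm false (nu - 1).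
  apply: twcommD => //; rewrite -scaleN1r; exact: twcomm_scalar.
case: (schur c1) => [/eqP|u]; first by rewrite subr_eq0 => /eqP; left.
right; apply/eqP; rewrite -addr_eq0; apply/eqP/(mulrI u).
by rewrite mulr0 mulrDr mulr1 mulrBl nu_sq_pos // mul1r addrA subrK subrr.
Qed.

Lemma nu_unit : nu \is a GRing.unit.
Proof. exact/mon_unit/all_iota. Qed.

(** The adjoint of [nu] is its inverse, which is [- nu], while [star] preserves the trace. *)
Lemma mxtrace_nu : r \in [:: 3; 7]%N -> \tr nu = 0.
Proof.
move=> ro; have : nu^-1 = - nu.
  by apply: (mulrI nu_unit); rewrite mulrV ?nu_unit // mulrN nu_sq_neg ?opprK.
rewrite -star_mon ?all_iota // => /(congr1 mxtrace).
rewrite mxtrace_star mxtraceN => /eqP.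
by rewrite -subr_eq0 opprK -mulr2n mulrn_eq0 /= => /eqP.
Qed.

Local Notation tau := (dimS ^+ 2 / N).

(** When [nu] is 1 or -1, its term repeats that of the empty monomial with the sign (-1)^s: the
    trace doubles on the commutant and vanishes on the anticommutant. Otherwise only the empty
    monomial contributes. *)
Lemma optr_avg_val s : optr (avg s) =
  (if r \in [:: 1; 5]%N then if s then 0 else 2 else 1) * tau.
Proof.
case: ifP => [ro|rn].
  have od : odd d by rewrite residue_odd; move: ro; rewrite !inE; lia.
  rewrite (optr_avg_odd _ od) -mxtraceZ.
  have -> : \tr (\tr nu *: nu^-1) = dimS ^+ 2.
    case: (nu_pm1 ro) => ->; rewrite ?invrN invr1 mxtraceZ ?mxtraceN mxtrace1 ?mulrNN //.
  by case: s; rewrite ?expr0 ?expr1; ring.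
rewrite mul1r; case: (boolP (odd d)) => od; last by rewrite optr_avg_even // mulrC.
rewrite (optr_avg_odd _ od) mxtrace_nu ?mul0r ?mulr0 ?addr0 1?mulrC //.
by move: rn od; rewrite residue_odd !inE; move: r8; lia.
Qed.

Lemma epsum_val : exists2 c : R, 0 < c &
  (z0, z1) = (c * (iter r (@rot_pos R) (1, 1)).1, c * (iter r (@rot_pos R) (1, 1)).2).
Proof. by rewrite epsum_full; have [c c0 E] := rot_pos_mod R pqr; exists c. Qed.

(** The squared modulus of (z0, z1) is 2 N by [epsum_norm]; eliminating N expresses [tau] through
    the same unknown [t] as the other two traces. *)
Lemma epsum_scaled : exists t x y : R, [/\ 0 < t, (x, y) = iter r (@rot_pos R) (1, 1),
  N^-1 * (dimS * z0) = t * x, N^-1 * (dimS * z1) = t * y &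
  tau = t ^+ 2 * ((x ^+ 2 + y ^+ 2) / 2)].
Proof.
have [c c0 []] := epsum_val; have := epsum_norm; case: (iter r _ _) => x y /= zN zx zy.
have N0 := N_neq0; exists (N^-1 * dimS * c), x, y; split=> //.
- by rewrite !mulr_gt0 ?invr_gt0 ?N_gt0 ?dimS_gt0.
- by rewrite zx !mulrA.
- by rewrite zy !mulrA.
have -> : (x ^+ 2 + y ^+ 2) / 2 = N / c ^+ 2.
  have := lt0r_neq0 c0 => c0'; rewrite zx zy in zN.
  have -> : N = (c * x ^+ 2 + c * y ^+ 2) * c / 2.
    by apply: (mulfI (_ : 2 != 0)); rewrite ?pnatr_eq0 // -zN; field.
  by field.
by field; rewrite N0 lt0r_neq0.
Qed.

Lemma dim_sym_commutant : \dim (starimg false false) = 1%N.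
Proof.
have -> : starimg false false = <[1 : 'M[R]_n.+1]>%VS.
  apply/vspaceP => X; apply/idP/idP => [/starimgP[cX sX]|/vlineP[k ->]].
    have [k ->] := commutant_sym_scalar cX (etrans sX (scale1r _)).
    exact/memvZ/memv_line.
  apply/starimgP; split; first exact: twcomm_scalar.
  by rewrite starZ star1 scale1r.
by rewrite dim_vline oner_eq0.
Qed.

(** The trace formula for the self-adjoint part, whose dimension is 1, determines [t]; the formula
    for the skew part then gives its dimension. *)
Lemma dim_skew_commutant : \dim (starimg false true) =
  (if r \in [:: 0; 1; 2] then 0 else if r \in [:: 3; 7] then 1 else 3)%N.
Proof.
have [t [x [y [t0 xyE z0E z1E tE]]]] := epsum_scaled.
apply/eqP; rewrite -(eqr_nat R).
have := dim_starimg false false; have := dim_starimg false true.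
rewrite dim_sym_commutant optr_avg_val expr0 expr1 mul1r z0E tE.
(* With [s] equal to t, 2t, 4t or 8t, the equation becomes s^2 + s = 2 for residues 0, 1, 2, where x
   > 0, and s^2 - s = 2 for residues 4, 5, 6, where x < 0. For 3 and 7, x = 0 and no root has to be
   extracted. *)
have F1 (s : R) : 0 < s -> 2 = s ^+ 2 + s -> s = 1.
  move=> s0 E; have : (s - 1) * (s + 2) = 0 by rewrite mulrDr !mulrBl; lra.
  by move/eqP; rewrite mulf_eq0 => /orP[] /eqP; lra.
have F2 (s : R) : 0 < s -> 2 = s ^+ 2 - s -> s = 2.
  move=> s0 E; have : (s + 1) * (s - 2) = 0 by rewrite mulrBr !mulrDl; lra.
  by move/eqP; rewrite mulf_eq0 => /orP[] /eqP; lra.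
move: (\dim _)%:R => k; move: r r8 xyE => [|[|[|[|[|[|[|[|]]]]]]]] //= _ [-> ->] E1 E0;
 rewrite ?inE /= in E1 E0 *; apply/eqP.
- have := F1 t t0; lra.
- have := F1 (2 * t); rewrite mulr_gt0 // => /(_ isT); lra.
- have := F1 (2 * t); rewrite mulr_gt0 // => /(_ isT); lra.
- lra.
- have := F2 (4 * t); rewrite mulr_gt0 // => /(_ isT); lra.
- have := F2 (8 * t); rewrite mulr_gt0 // => /(_ isT); lra.
- have := F2 (8 * t); rewrite mulr_gt0 // => /(_ isT); lra.
- lra.
Qed.

(** The number y is -4 for residue 3 and 16 for residue 7, so the chosen symmetry makes both terms
    of the trace positive. *)
Lemma anticommutant_star_exists : r \in [:: 3; 7]%N ->
  exists2 u, u != 0 & starspace true (r == 3) u.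
Proof.
move=> ro; suff : (0 < \dim (starimg true (r == 3%N)))%N.
  rewrite lt0n dimv_eq0 -vpick0 => u0; exists (vpick (starimg true (r == 3%N))) => //.
  exact/starimgP/memv_pick.
have [t [x [y [t0 xyE z0E z1E tE]]]] := epsum_scaled.
rewrite -(ltr_nat R) -(@pmulr_rgt0 _ 2) // dim_starimg optr_avg_val z1E tE.
move: ro xyE; rewrite !inE => /orP[] /eqP-> /= [-> ->]; rewrite ?expr0 ?expr1; nra.
Qed.

Lemma commutant_real X : r \in [:: 0; 1; 2]%N -> twcomm false X -> exists k, X = k%:A.
Proof.
move=> ro cX; have [A [B [[cA sA] /starimgP sB ->]]] := starspace_split cX.
have := dim_skew_commutant; rewrite ro => /eqP; rewrite dimv_eq0 => /eqP E.
move: sB; rewrite E memv0 => /eqP ->; rewrite addr0.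
by apply: commutant_sym_scalar => //; rewrite sA expr0 scale1r.
Qed.

Lemma nu_starspace : r \in [:: 3; 7]%N -> starspace false true nu.
Proof.
move=> ro; have od : odd d by rewrite residue_odd; move: ro; rewrite !inE; lia.
split; first by have := nu_twcomm; rewrite od.
rewrite star_mon ?all_iota //; apply: (mulrI nu_unit).
by rewrite mulrV ?nu_unit // -scalerAr nu_sq_neg // expr1 scaleN1r opprK.
Qed.

Lemma commutant_complex X : r \in [:: 3; 7]%N -> twcomm false X ->
  exists a b, X = a%:A + b *: nu.
Proof.
move=> ro cX; have [A [B [[cA sA] /starimgP sB ->]]] := starspace_split cX.
have [a ->] : exists k, A = k%:A.
  by apply: commutant_sym_scalar => //; rewrite sA expr0 scale1r.
have dim1 : \dim (starimg false true) = 1%N.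
  by rewrite dim_skew_commutant; move: ro; rewrite !inE => /orP[] /eqP->.
have nu0 : nu != 0.
  by apply: contraTneq nu_unit => ->; rewrite unitr0.
have E : starimg false true = <[nu]>%VS.
  apply/eqP; rewrite eq_sym eqEdim dim_vline nu0 dim1 andbT -memvE.
  exact/starimgP/nu_starspace.
by move: sB; rewrite E => /vlineP[b ->]; exists a, b.
Qed.

(** The square of X is self-adjoint in the commutant, hence a scalar, and a negative one by
    positivity. *)
Lemma skew_normalize X : starspace false true X -> X != 0 ->
  exists2 k, k != 0 & (k *: X) * (k *: X) = -1.
Proof.
move=> [cX sX] X0; rewrite expr1 scaleN1r in sX.
have [m mE] : exists m, X * X = m%:A.
  apply: commutant_sym_scalar; first exact: (twcommM (s := false) (s' := false)).
  by rewrite starM sX mulrNN.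
have m0 : 0 < - m.
  by apply: (@star_sq_gt0 X) => //; rewrite sX mulNr mE scaleNr.
exists (Num.sqrt (- m))^-1; first by rewrite invr_eq0 sqrtr_eq0 -ltNge.
rewrite -scalerAl -scalerAr mE !scalerA -expr2 exprVn sqr_sqrtr ?ltW //.
by rewrite invrN mulNr mulVf ?scaleN1r // -oppr_eq0 lt0r_neq0.
Qed.

Lemma starspaceZ s b k X : starspace s b X -> starspace s b (k *: X).
Proof.
move=> [cX sX]; split; first exact: twcommZ.
by rewrite starZ sX !scalerA mulrC.
Qed.

Lemma starspaceD s b X Y : starspace s b X -> starspace s b Y -> starspace s b (X + Y).
Proof.
move=> [cX sX] [cY sY]; split; first exact: twcommD.
by rewrite starD sX sY scalerDr.
Qed.

(** The anticommutator is self-adjoint in the commutant. It serves as the symmetric bilinear form on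
    the skew part for which quaternion units are found by orthogonalization. *)
Lemma skew_anticomm X Y : starspace false true X -> starspace false true Y ->
  exists m, X * Y + Y * X = m%:A.
Proof.
move=> [cX sX] [cY sY]; rewrite expr1 !scaleN1r in sX sY.
apply: commutant_sym_scalar.
  by apply: twcommD; apply: (twcommM (s := false) (s' := false)).
by rewrite starD !starM sX sY !mulrNN addrC.
Qed.

Lemma commutant_quaternion : r \in [:: 4; 5; 6]%N -> exists i j,
  [/\ twcomm false i, twcomm false j & i * i = -1] /\ [/\ j * j = -1, i * j = - (j * i) &
   forall X, twcomm false X -> exists a b c k,
     X = a%:A + b *: i + c *: j + k *: (i * j)].
Proof.
move=> ro.
have dim3 : \dim (starimg false true) = 3%N.
  by rewrite dim_skew_commutant; move: ro; rewrite !inE => /or3P[] /eqP->.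
have [i si ii] : exists2 i, starspace false true i & i * i = -1.
  have v0 : vpick (starimg false true) != 0 by rewrite vpick0 -dimv_eq0 dim3.
  have [k _ kk] := skew_normalize (elimT (starimgP _ _ _) (memv_pick _)) v0.
  by exists (k *: vpick (starimg false true)) => //; apply/starspaceZ/starimgP/memv_pick.
(* Gram-Schmidt for the anticommutator form: orthogonal means anticommuting. *)
have orth (Y X : 'M[R]_n.+1) (m : R) : Y * Y = -1 -> X * Y + Y * X = m%:A ->
    (X + (m / 2) *: Y) * Y = - (Y * (X + (m / 2) *: Y)).
  move=> YY E; apply/eqP; rewrite -addr_eq0 mulrDl mulrDr addrACA E.
  rewrite -scalerAl -scalerAr YY -scalerDl.
  by rewrite (_ : m / 2 + m / 2 = m) ?scalerN ?subrr //; lra.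
have [j sj [jj ij]] : exists2 j, starspace false true j & j * j = -1 /\ i * j = - (j * i).
  have [Y YI Yi] : exists2 Y, Y \in starimg false true & Y \notin <[i]>%VS.
    apply/subvPn; apply: contraTN isT => /dimvS; rewrite dim3 dim_vline.
    by case: (i != 0).
  have sY := elimT (starimgP _ _ _) YI; have [m mE] := skew_anticomm sY si.
  have Z0 : Y + (m / 2) *: i != 0.
    apply: contraNneq Yi => /eqP; rewrite addr_eq0 => /eqP ->.
    by rewrite -scaleNr memvZ ?memv_line.
  have sZ : starspace false true (Y + (m / 2) *: i) by apply/starspaceD/starspaceZ.
  have [k _ kk] := skew_normalize sZ Z0.
  exists (k *: (Y + (m / 2) *: i)); first exact: starspaceZ.
  split=> //; rewrite -scalerAr -scalerAl (orth _ _ _ ii mE) scalerN opprK //.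
exists i, j; split; first by case: si; case: sj.
split=> // X cX; have [A [B [[cA sA] sB ->]]] := starspace_split cX.
have [a ->] : exists k, A = k%:A.
  by apply: commutant_sym_scalar => //; rewrite sA expr0 scale1r.
have sk : starspace false true (i * j).
  case: si sj => ci si' [cj sj']; split.
    exact: (twcommM (s := false) (s' := false)).
  by rewrite starM si' sj' !expr1 !scaleN1r mulrNN ij opprK.
have kk : (i * j) * (i * j) = -1.
  by rewrite {2}ij mulrN -mulrA [j * (j * i)]mulrA jj mulN1r mulrN opprK ii.
have ik : i * (i * j) = - (i * j * i).
  by rewrite -mulrA -[j * i]opprK -ij mulrN opprK.
have jk : j * (i * j) = - (i * j * j).
  by rewrite mulrA -[j * i]opprK -ij mulNr.
have [m1 E1] := skew_anticomm sB si; have [m2 E2] := skew_anticomm sB sj.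
have [m3 E3] := skew_anticomm sB sk.
set k := i * j in sk kk ik jk E3 *.
(* [B'] is the part of [B] orthogonal to i, j and k, so it anticommutes with all three. As k = i j,
   anticommuting with i and j makes it commute with k, and so B' = 0. *)
pose B' := B + (m1 / 2) *: i + (m2 / 2) *: j + (m3 / 2) *: k.
have antE (Y : 'M[R]_n.+1) : B' * Y + Y * B' = (B * Y + Y * B) +
    (m1 / 2) *: (i * Y + Y * i) + (m2 / 2) *: (j * Y + Y * j) + (m3 / 2) *: (k * Y + Y * k).
  rewrite /B' !mulrDl !mulrDr -!scalerAl -!scalerAr !scalerDr.
  by rewrite addrACA; congr (_ + _); rewrite addrACA; congr (_ + _); rewrite addrACA.
have half (m : R) : m%:A + (m / 2) *: (-1 + -1) = 0 :> 'M[R]_n.+1.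
  by rewrite scalerDr !scalerN -opprD -scalerDl (_ : m / 2 + m / 2 = m) ?subrr //; lra.
have Bi : B' * i = - (i * B').
  apply/eqP; rewrite -addr_eq0 antE E1 ii half ij ik !subrr.
  by rewrite !scaler0 !addr0.
have Bj : B' * j = - (j * B').
  apply/eqP; rewrite -addr_eq0 antE E2 jj ij jk addNr subrr scaler0 addr0 half add0r.
  by rewrite scaler0.
have Bk : B' * k = - (k * B').
  by apply/eqP; rewrite -addr_eq0 antE E3 kk ik jk !addNr !scaler0 !addr0 half.
have B0 : B' = 0.
  have : B' * k = k * B' by rewrite /k mulrA Bi mulNr -[i * B' * j]mulrA Bj mulrN opprK mulrA.
  rewrite Bk => /eqP.
  rewrite eq_sym -subr_eq0 opprK -mulr2n -scaler_nat scaler_eq0 pnatr_eq0 /= => /eqP kB.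
  by rewrite -[B']opprK -[- B']mulN1r -kk -mulrA kB mulr0 oppr0.
exists a, (- (m1 / 2)), (- (m2 / 2)), (- (m3 / 2)).
rewrite -!addrA; congr (_ + _); apply/eqP; rewrite !scaleNr -!opprD -addr_eq0.
by rewrite !addrA; apply/eqP.
Qed.

(** Since [star u] is u or -u, positivity of [star u * u] fixes the sign of the scalar [u * u], and
    rescaling makes it 1 or -1. *)
Lemma anticommutant_unit : r \in [:: 3; 7]%N ->
  exists2 u, twcomm true u & u * u = ((-1) ^+ (r == 3))%:A.
Proof.
move=> ro; have [u u0 [cu su]] := anticommutant_star_exists ro.
have [m mE] : exists m, u * u = m%:A.
  apply: commutant_sym_scalar; first exact: (twcommM (s := true) (s' := true)).
  by rewrite starM su -scalerAl -scalerAr scalerA -expr2 sqrr_sign scale1r.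
have k0 : 0 < (-1) ^+ (r == 3) * m.
  by apply: (@star_sq_gt0 u) => //; rewrite su -scalerAl mE scalerA.
exists ((Num.sqrt ((-1) ^+ (r == 3) * m))^-1 *: u); first exact: twcommZ.
rewrite -scalerAl -scalerAr mE !scalerA -expr2 exprVn sqr_sqrtr ?ltW //.
have m0 : m != 0 by apply: contraTneq k0 => ->; rewrite mulr0 ltxx.
by rewrite invfM -mulrA mulVf // mulr1 invr_sign.
Qed.

(* [a] commutes with the average of [m T m^-1] over the monomials [m], for all
   [T]; the trace over the first factor expresses [a] through the monomials. *)
Lemma double_commutant a : (forall X, twcomm false X -> a * X = X * a) ->
  exists c : seq nat -> R, a = \sum_(t <- subs l) c t *: mon t.
Proof.
move=> ca.
(* The relation a avg(T) - avg(T) a = 0 is written as one sum of terms A T B; the tags [true] and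
   [false] distinguish the two products with [a]. *)
have := @conj_sum0_trace R n.+1 _
  ([seq (true, t) | t <- subs l] ++ [seq (false, t) | t <- subs l])
  (fun k => if k.1 then a * mon k.2 else - mon k.2)
  (fun k => if k.1 then (mon k.2)^-1 else (mon k.2)^-1 * a).
rewrite big_cat !big_map /= => H.
have {H} : \sum_(t <- subs l) \tr (a * mon t) *: (mon t)^-1 =
    (\sum_(t <- subs l) \tr (mon t) *: (mon t)^-1) * a.
  apply/eqP; rewrite -subr_eq0; apply/eqP; rewrite -[RHS]H.
    congr (_ + _); rewrite mulr_suml -sumrN; apply: eq_bigr => t _.
    by rewrite mxtraceN scaleNr scalerAl.
  move=> T; rewrite big_cat !big_map /=.
  have := ca _ (@avg_comm false T); rewrite /avg -scalerAl -scalerAr.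
  move/(scalerI (invr_neq0 N_neq0)); rewrite mulr_sumr mulr_suml => E.
  apply/eqP.
  rewrite -[X in _ == X](subrr (\sum_(t <- subs l) a * avg_term false (odd (size t)) T (mon t))).
  apply/eqP; rewrite [X in _ = _ - X]E -sumrN; congr (_ + _); apply: eq_bigr => t _.
    by rewrite /avg_term scale1r !mulmxE !mulrA.
  by rewrite /avg_term scale1r !mulmxE !mulrA !mulNr.
(* Traceless monomials drop out. What remains is dim S, or 2 dim S when [nu] is 1 or -1, and the
   formula can be solved for [a]. *)
have [k k0 ->] : exists2 k : R, k != 0 &
    \sum_(t <- subs l) \tr (mon t) *: (mon t)^-1 = k%:A.
  rewrite sum_trivial_index => [|t tl tt]; last by rewrite (mxtrace_mon tl tt) scale0r.
  rewrite mon_nil invr1 mxtrace1.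
  have D0 : dimS != 0 by rewrite pnatr_eq0.
  case: (boolP (r \in [:: 1; 5]%N)) => [ro|rn].
    have -> : odd d by rewrite residue_odd; move: ro; rewrite !inE; lia.
    exists (2 * dimS); first by rewrite mulf_neq0 ?pnatr_eq0.
    rewrite mulrDl mul1r scalerDl; congr (_ + _).
    by case: (nu_pm1 ro) => ->; rewrite ?invrN invr1 ?mxtraceN mxtrace1 // scalerN scaleNr opprK.
  exists dimS => //; case: ifP => [od|]; last by rewrite addr0.
  rewrite mxtrace_nu ?scale0r ?addr0 //.
  by move: rn od; rewrite residue_odd !inE; move: r8; lia.
rewrite mulr_algl => E.
exists (fun t => k^-1 * \tr (a * mon t) * eps t).
apply: (scalerI k0); rewrite -E scaler_sumr; apply: eq_big_seq => t tl.
by rewrite mon_inv ?subs_all // !scalerA !mulrA divff // mul1r.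
Qed.

End Residue.

(** The trace against [mon t] isolates [c t]: a product of two distinct monomials of equal parity
    anticommutes with any generator that occurs in just one of them. The parity is fixed because
    complementary monomials become proportional when d is odd and [nu] is 1 or -1. *)
Lemma mon_even_free (c : seq nat -> R) b :
    \sum_(t <- subs l | odd (size t) == b) c t *: mon t = 0 ->
  forall t, t \in subs l -> odd (size t) = b -> c t = 0.
Proof.
move=> H t tl tb.
have := congr1 (fun X => \tr (X * mon t)) H; rewrite mul0r mxtrace0 mulr_suml raddf_sum /=.
rewrite big_mkcond (bigD1_seq t) ?subs_uniq ?iota_uniq //= tb eqxx -scalerAl mxtraceZ.
rewrite mon_sq ?subs_all // mxtraceZ mxtrace1 big_seq_cond big1 => [|s /andP[sl st]].
  rewrite addr0 => /eqP; rewrite !mulf_eq0 pnatr_eq0 orbF => /orP[/eqP //|/eqP e0].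
  by have := eps_sq t; rewrite e0 mulr0 => /eqP; rewrite eq_sym oner_eq0.
case: eqP => // sb.
rewrite -scalerAl mxtraceZ -mon_cat.
have [j jd jst] : exists2 j, (j < d)%N & (j \in s) != (j \in t).
  case: (boolP (all (fun j => (j \in s) == (j \in t)) l)) => [/allP H'|/allPn[j]].
    case/negP: st; apply/eqP/(subs_iota_eq sl tl) => j.
    have [jl|jl] := boolP (j \in l); first exact/eqP/H'.
    have H2 u : u \in subs l -> (j \in u) = false.
      by move=> /subs_subseq/mem_subseq ul; apply: contraNF jl => /ul.
    by rewrite !H2.
  by rewrite mem_iota0; exists j.
rewrite (mxtrace_anti jd) ?mulr0 // (mon_comm eac) //; last first.
  by rewrite all_cat !subs_all.
rewrite size_cat count_cat !count_uniq_mem ?(subseq_uniq (subs_subseq _) (iota_uniq 0 d)) //.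
rewrite -signr_odd !oddD sb tb addbb; move: jst.
by case: (j \in s); case: (j \in t) => //= _; rewrite expr1 scaleN1r.
Qed.

End CliffordMatrices.

(** * Products of anticommuting elements and determinants *)

Section AnticommutingProducts.
Variables (K : numFieldType) (A : algType K).

Definition anticommuting n (f : 'I_n -> A) := forall i j, i != j -> f i * f j = - (f j * f i).

Lemma anticomm_lift n (f : 'I_n.+1 -> A) j :
  anticommuting f -> anticommuting (fun i => f (lift j i)).
Proof. by move=> fa i k ik; apply: fa; rewrite (inj_eq lift_inj). Qed.

Lemma anticomm_move_front n (f : 'I_n.+1 -> A) j : anticommuting f ->
  f j * \prod_(i < n) f (lift j i) = (-1) ^+ j *: \prod_(i < n.+1) f i.
Proof.
elim: n f j => [|n IH] f j fa.
  by rewrite (ord1 j) big_ord0 big_ord1 mulr1 expr0 scale1r.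
case: (unliftP ord0 j) => [j'|] ->; last by rewrite [in RHS]big_ord_recl expr0 scale1r.
rewrite big_ord_recl.
have -> : lift (lift ord0 j') ord0 = ord0 by apply: val_inj; rewrite /= /bump.
rewrite mulrA fa; last by rewrite eq_sym neq_lift.
rewrite mulNr -mulrA.
have -> : \prod_(i < n) f (lift (lift ord0 j') (lift ord0 i)) =
          \prod_(i < n) (fun k => f (lift ord0 k)) (lift j' i).
  by apply: eq_bigr => i _; congr f; apply: val_inj; apply: bumpS.
rewrite (IH (fun k => f (lift ord0 k)) j' (@anticomm_lift _ f ord0 fa)).
rewrite [in RHS]big_ord_recl -scalerAr -scaleNr; congr (_ *: _).
by rewrite -mulN1r -exprS.
Qed.

(** Splits off the image of 0, to match the first factor of the product in the induction of
    [prod_perm_anticomm]. *)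
Lemma perm_lift_exists n (s : 'S_n.+1) : exists t : 'S_n, s = lift_perm ord0 (s ord0) t.
Proof.
have tP i : {k | s (lift ord0 i) = lift (s ord0) k}.
  case: (unliftP (s ord0) (s (lift ord0 i))) => [k E|/perm_inj E]; first by exists k.
  by have := neq_lift ord0 i; rewrite E eqxx.
pose t i := sval (tP i).
have ti : injective t.
  move=> i k E; apply: (@lift_inj _ ord0); apply: (@perm_inj _ s).
  by rewrite (svalP (tP i)) (svalP (tP k)) -/(t i) -/(t k) E.
exists (perm ti); apply/permP => i; case: (unliftP ord0 i) => [k|] ->.
  by rewrite lift_perm_lift permE (svalP (tP k)).
by rewrite lift_perm_id.
Qed.

Lemma prod_perm_anticomm n (f : 'I_n -> A) (s : 'S_n) : anticommuting f ->
  \prod_i f (s i) = (-1) ^+ s *: \prod_i f i.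
Proof.
elim: n f s => [|n IH] f s fa.
  by rewrite !big_ord0 (_ : s = 1%g) ?odd_perm1 ?scale1r //; apply/permP => -[].
have [t E] := perm_lift_exists s; rewrite big_ord_recl.
have -> : \prod_(i < n) f (s (lift ord0 i)) = \prod_(i < n) (fun k => f (lift (s ord0) k)) (t i).
  by apply: eq_bigr => i _; rewrite {1}E lift_perm_lift.
rewrite (IH (fun k => f (lift (s ord0) k)) t (@anticomm_lift _ f (s ord0) fa)) -scalerAr.
rewrite (anticomm_move_front _ fa) scalerA.
have -> : odd_perm s = odd (s ord0) (+) odd_perm t by rewrite {1}E odd_lift_perm.
by rewrite signr_addb signr_odd mulrC.
Qed.

Lemma sum_perm_const n (x : A) : \sum_(s : 'S_n) x = (n`!)%:R *: x.
Proof.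
rewrite -(card_Sn n) scaler_nat -sumr_const; apply: eq_bigl => s.
by rewrite inE.
Qed.

(** As in an exterior algebra, except that the squares of the [e i] need not vanish. Summing over
    all orders of the factors yields n! times the product and turns the coefficient of each word
    into a determinant, which has two equal rows when an index repeats. *)
Lemma prod_anticomm_det n (e : 'I_n -> A) (M : 'M[K]_n) :
    anticommuting e -> anticommuting (fun i => \sum_j M i j *: e j) ->
  \prod_i (\sum_j M i j *: e j) = \det M *: \prod_i e i.
Proof.
move=> ea fa; set f := fun i => \sum_j M i j *: e j.
have n0 : (n`!)%:R != 0 :> K by rewrite pnatr_eq0 -lt0n fact_gt0.
apply: (scalerI n0).
transitivity (\sum_(s : 'S_n) (-1) ^+ s *: \prod_i f (s i)).
  rewrite -sum_perm_const; apply: eq_bigr => s _.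
  by rewrite prod_perm_anticomm // scalerA -expr2 sqrr_sign scale1r.
pose F := ('I_n ^ n)%type.
transitivity (\sum_(g : F) \det (\matrix_(i, j) M j (g i)) *: \prod_i e (g i)).
  under eq_bigr => s _.
    rewrite (bigA_distr_bigA (fun i j => M (s i) j *: e j)) scaler_sumr.
    under eq_bigr => g _ do rewrite scaler_prod scalerA.
    over.
  rewrite exchange_big; apply: eq_bigr => g _; rewrite -scaler_suml; congr (_ *: _).
  by apply: eq_bigr => s _; congr (_ * _); apply: eq_bigr => i _; rewrite mxE.
rewrite (bigID (fun g : F => injectiveb g)) /= addrC big1 ?add0r => [|g Ug]; last first.
  case/injectivePn: Ug => i1 [i2 Di12 Ef12].
  by rewrite (determinant_alternate Di12) ?scale0r // => j; rewrite !mxE Ef12.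
rewrite (reindex (@pval _)) /=; last first.
  pose in_Sn := insubd (1%g : 'S_n).
  by exists in_Sn => /= g Ug; first apply: val_inj; apply: insubdK.
rewrite -sum_perm_const; apply: eq_big => [s|s _]; first exact: (valP s).
have -> : \det (\matrix_(i, j) M j (pval s i)) = (-1) ^+ s * \det M.
  rewrite -[\det M]det_tr -det_perm -det_mulmx -row_permE; congr (\det _).
  by apply/matrixP => i j; rewrite !mxE -pvalE.
under eq_bigr => i _ do rewrite pvalE.
by rewrite prod_perm_anticomm // scalerA mulrAC -expr2 sqrr_sign mul1r.
Qed.

End AnticommutingProducts.

(** Moves [det_Ad0], defined with [vbasis], to the images of an orthonormal basis. The two lengths
    [n] and [m] are only provably equal there. *)
Lemma det_basis_change (K : fieldType) (vT : vectType K) (U : {vspace vT})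
    (f : 'End(vT)) n m (X : n.-tuple vT) (Y : m.-tuple vT) :
    basis_of U X -> basis_of U Y -> (forall x, x \in U -> f x \in U) ->
  \det (\matrix_(i < n, j < n) coord X j (f (tnth X i))) =
  \det (\matrix_(i < m, j < m) coord Y j (f (tnth Y i))).
Proof.
move=> bX bY fU.
have nm : n = m by rewrite -(size_basis bX) (size_basis bY).
subst m; set MX := \matrix_(i, j) _; set MY := \matrix_(i, j) _.
have memX i : tnth X i \in U by apply: (basis_mem bX); apply: mem_tnth.
have memY i : tnth Y i \in U by apply: (basis_mem bY); apply: mem_tnth.
pose P := \matrix_(i, j) coord Y j (tnth X i); pose Q := \matrix_(i, j) coord X j (tnth Y i).
have QP : Q *m P = 1%:M.
  apply/matrixP => i k; rewrite !mxE.
  have := congr1 (coord Y k) (coord_basis bX (memY i)).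
  rewrite (tnth_nth 0) coord_free ?(basis_free bY) // => ->.
  by rewrite raddf_sum; apply: eq_bigr => j _; rewrite /= linearZ /= !mxE !(tnth_nth 0).
have MP : MX *m P = P *m MY.
  apply/matrixP => i k; rewrite !mxE.
  transitivity (coord Y k (f (tnth X i))).
    rewrite {1}(coord_basis bX (fU _ (memX i))) raddf_sum.
    by apply: eq_bigr => j _; rewrite /= linearZ /= !mxE (tnth_nth 0 X j).
  rewrite {1}(coord_basis bY (memX i)) !raddf_sum.
  by apply: eq_bigr => j _; rewrite /= !linearZ /= !mxE (tnth_nth 0 Y j).
have : \det P * \det MX = \det P * \det MY by rewrite mulrC -det_mulmx MP det_mulmx.
apply: mulfI; apply/negP => /eqP P0.
by have := det_mulmx Q P; rewrite QP det1 P0 mulr0 => /eqP; rewrite oner_eq0.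
Qed.

Local Open Scope classical_set_scope.

(** * Even and odd parts of the Clifford algebra *)

Section CliffordParts.
Variables (R : realType) (V : vectType R) (Cl : unitAlgType R) (iota : {linear V -> Cl}).
Local Notation part := (clifford_part iota).

Lemma part_term par k (w : seq V) : odd (size w) = par ->
  part par (k *: \prod_(v <- w) iota v).
Proof. by move=> wp; exists 1%N, (fun _ => k), (fun _ => w); rewrite big_ord1. Qed.

Lemma part0 par : part par 0.
Proof.
by exists 0%N, (fun _ => 0), (fun _ => [::]); split; [case|rewrite big_ord0].
Qed.

Lemma partD par x y : part par x -> part par y -> part par (x + y).
Proof.
move=> [n [c [w [wp ->]]]] [m [c' [w' [wp' ->]]]].
exists (n + m)%N, (fun i => match fintype.split i with inl j => c j | inr j => c' j end),
  (fun i => match fintype.split i with inl j => w j | inr j => w' j end).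
split; first by move=> i; case: (fintype.split i).
rewrite big_split_ord; congr (_ + _); apply: eq_bigr => i _.
  by rewrite -[lshift m i]/(unsplit (inl i)) unsplitK.
by rewrite -[rshift n i]/(unsplit (inr i)) unsplitK.
Qed.

Lemma part_sum par (I : Type) (r : seq I) (F : I -> Cl) :
  (forall i, part par (F i)) -> part par (\sum_(i <- r) F i).
Proof. by move=> FP; apply: big_ind => //; [exact: part0|exact: partD]. Qed.

Lemma partZ par k x : part par x -> part par (k *: x).
Proof.
move=> [n [c [w [wp ->]]]]; rewrite scaler_sumr; apply: part_sum => i.
by rewrite scalerA; apply: part_term.
Qed.

Lemma partM par par' x y : part par x -> part par' y -> part (par (+) par') (x * y).
Proof.
move=> [n [c [w [wp ->]]]] [m [c' [w' [wp' ->]]]].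
rewrite mulr_suml; apply: part_sum => i; rewrite mulr_sumr; apply: part_sum => j.
rewrite -scalerAl -scalerAr scalerA -big_cat; apply: part_term.
by rewrite size_cat oddD wp wp'.
Qed.

Lemma part_iota v : part true (iota v).
Proof. by have := part_term 1 (erefl (odd (size [:: v]))); rewrite big_seq1 scale1r. Qed.

Lemma part1 : part false 1.
Proof. by have := part_term 1 (erefl (odd (@size V [::]))); rewrite big_nil scale1r. Qed.

(** A subalgebra containing V, to which the universal property is applied in order to show that it
    is the whole algebra. *)
Definition clifford_sum_pred : {pred Cl} :=
  fun x => `[< exists a b, [/\ part false a, part true b & x = a + b] >].

Lemma clifford_sum_subalg : GRing.subalg_closed clifford_sum_pred.
Proof.
split=> [|k x y|x y].
- by apply/asboolP; exists 1, 0; split; [exact: part1|exact: part0|rewrite addr0].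
- move=> /asboolP[a [b [pa pb ->]]] /asboolP[a' [b' [pa' pb' ->]]]; apply/asboolP.
  exists (k *: a + a'), (k *: b + b'); split; try by apply: partD => //; apply: partZ.
  by rewrite scalerDr addrACA.
- move=> /asboolP[a [b [pa pb ->]]] /asboolP[a' [b' [pa' pb' ->]]]; apply/asboolP.
  exists (a * a' + b * b'), (a * b' + b * a'); split.
  + by apply: partD; [exact: (partM pa pa')|exact: (partM pb pb')].
  + by apply: partD; [exact: (partM pa pb')|exact: (partM pb pa')].
  + by rewrite mulrDl !mulrDr [b * a' + _]addrC addrACA.
Qed.

HB.instance Definition _ :=
  GRing.isSubalgClosed.Build R Cl clifford_sum_pred clifford_sum_subalg.

Definition clifford_sum : Type := {x : Cl | x \in clifford_sum_pred}.
HB.instance Definition _ :=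
  [isSub of clifford_sum for (@sval Cl (fun x => x \in clifford_sum_pred))].
HB.instance Definition _ := [Choice of clifford_sum by <:].
HB.instance Definition _ := [SubChoice_isSubAlgebra of clifford_sum by <:].

Fact clifford_sum_iota_subproof v : iota v \in clifford_sum_pred.
Proof.
by apply/asboolP; exists 0, (iota v); split; [exact: part0|exact: part_iota|rewrite add0r].
Qed.

Definition clifford_sum_iota v : clifford_sum := exist _ (iota v) (clifford_sum_iota_subproof v).

Fact clifford_sum_iota_linear : linear clifford_sum_iota.
Proof. by move=> k u v; apply: val_inj; rewrite /= linearP. Qed.
HB.instance Definition _ :=
  GRing.isLinear.Build R V clifford_sum _ clifford_sum_iota clifford_sum_iota_linear.

Definition clifford_sum_val : clifford_sum -> Cl := \val.

Fact clifford_sum_val_linear : linear clifford_sum_val.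
Proof. by []. Qed.
HB.instance Definition _ :=
  GRing.isLinear.Build R clifford_sum Cl _ clifford_sum_val clifford_sum_val_linear.

Fact clifford_sum_val_monoid : monoid_morphism clifford_sum_val.
Proof. by []. Qed.
HB.instance Definition _ :=
  GRing.isMonoidMorphism.Build clifford_sum Cl clifford_sum_val clifford_sum_val_monoid.

Variable h : {symmetric V}.
Hypothesis hCl : is_clifford_algebra h iota.

(** The morphism into [clifford_sum] followed by the inclusion extends [iota], so by uniqueness it
    is the identity. *)
Lemma clifford_split x : exists a b, [/\ part false a, part true b & x = a + b].
Proof.
have [iota2 univ] := hCl.
have [f [fi _]] := univ (clifford_sum : algType R) clifford_sum_iota
  (fun v => val_inj (iota2 v : val (clifford_sum_iota v * clifford_sum_iota v) =
                               val ((h v v)%:A : clifford_sum))).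
have [g [gi guniq]] := univ Cl iota iota2.
have xE : x = val (f x).
  pose vf : {lrmorphism Cl -> Cl} := clifford_sum_val \o f.
  rewrite -[RHS]/(vf x) (guniq vf) => [|v]; last by rewrite /= fi.
  by rewrite -(guniq (idfun : {lrmorphism Cl -> Cl})).
by have /asboolP := valP (f x); rewrite -xE.
Qed.

(** [al] extends v -> -v. Being a morphism with the two parts as eigenspaces, it shows that they
    meet in 0 and that inverses stay homogeneous. *)
Lemma grading_exists : exists al : {lrmorphism Cl -> Cl}, forall par x,
  part par x <-> al x = (-1) ^+ par *: x.
Proof.
have [iota2 univ] := hCl.
pose g : {linear V -> Cl} := -%R \o iota.
have [al [aliota _]] := univ Cl g (fun v => etrans (mulrNN _ _) (iota2 v)).
have al_part par x : part par x -> al x = (-1) ^+ par *: x.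
  move=> [n [c [w [wp ->]]]]; rewrite raddf_sum scaler_sumr; apply: eq_bigr => i _ /=.
  rewrite linearZ /= scalerA [_ * c i]mulrC -scalerA; congr (_ *: _).
  rewrite rmorph_prod -(wp i) signr_odd; elim: (w i) => [|v s IH].
    by rewrite !big_nil scale1r.
  by rewrite !big_cons IH /= aliota /= -scalerAr mulNr exprS mulN1r scaleNr scalerN.
exists al => par x; split; first exact: al_part.
have [a [b [pa pb ->]]] := clifford_split x.
rewrite raddfD /= (al_part _ _ pa) (al_part _ _ pb) expr0 expr1 scale1r scaleN1r => E.
have E2 (y : Cl) : y = - y -> y = 0.
  by move/eqP; rewrite -subr_eq0 opprK -mulr2n -scaler_nat scaler_eq0 pnatr_eq0 => /eqP.
case: par E; rewrite ?expr1 ?expr0 ?scaleN1r ?scale1r.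
  rewrite opprD => /addIr /E2 ->; by rewrite add0r.
by move/addrI/esym/E2 => ->; rewrite addr0.
Qed.

End CliffordParts.

(** * Endomorphisms as matrices *)

Section EndoMatrix.
Import VectorInternalTheory.
Variables (K : fieldType) (S : vectType K) (S_gt0 : (0 < dim S)%N).
Local Notation n := (dim S).-1.

(** Library matrices act on row vectors, so the transpose is what makes the map multiplicative; the
    cast exhibits the size as a successor, as the ring structure on square matrices demands. *)
Definition endo_mx (a : endo S_gt0) : 'M[K]_n.+1 :=
  castmx (esym (prednK S_gt0), esym (prednK S_gt0)) (f2mx (a : 'End(S)))^T.

Fact f2mxE (f : 'End(S)) u : u *m f2mx f = v2r (f (r2v u)).
Proof. by rewrite unlock /= !r2vK. Qed.

Fact f2mx_linear : linear (f2mx : 'End(S) -> _).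
Proof.
move=> k a b; apply/row_matrixP => i; rewrite !rowE mulmxDr -scalemxAr.
by rewrite !f2mxE lfunE /= lfunE /= linearP.
Qed.

Fact f2mx_comp (a b : 'End(S)) : f2mx (a \o b)%VF = f2mx b *m f2mx a.
Proof.
apply/row_matrixP => i; rewrite !rowE mulmxA.
by rewrite !f2mxE v2rK lfunE /=.
Qed.

Fact endo_mx_linear : linear endo_mx.
Proof.
move=> k a b; rewrite /endo_mx.
rewrite -[f2mx (_ : 'End(S))]/(f2mx (k *: (a : 'End(S)) + (b : 'End(S)))).
rewrite f2mx_linear linearP /=.
by case: _ / (esym _).
Qed.
HB.instance Definition _ := GRing.isLinear.Build K (endo S_gt0) _ _ endo_mx endo_mx_linear.

Fact endo_mx_monoid : monoid_morphism endo_mx.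
Proof.
split=> [|a b]; rewrite /endo_mx.
  have -> : f2mx ((1 : endo S_gt0) : 'End(S)) = 1%:M.
    apply/row_matrixP => i; rewrite !rowE mulmx1.
    rewrite -[f2mx _]/(f2mx (\1%VF : 'End(S))).
    by rewrite f2mxE id_lfunE r2vK.
  by rewrite trmx1; case: _ / (esym _).
rewrite -[f2mx ((a * b) : 'End(S))]/(f2mx ((a : 'End(S)) \o (b : 'End(S)))%VF).
by rewrite f2mx_comp trmx_mul; case: _ / (esym _).
Qed.
HB.instance Definition _ :=
  GRing.isMonoidMorphism.Build (endo S_gt0) 'M[K]_n.+1 endo_mx endo_mx_monoid.

Lemma endo_mx_bij : bijective endo_mx.
Proof.
exists (fun M => Hom ((castmx (prednK S_gt0, prednK S_gt0) M)^T) : endo S_gt0) => [a|M].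
  rewrite /endo_mx castmx_comp /= castmx_id trmxK; by case: a.
by rewrite /endo_mx /= trmxK castmx_comp castmx_id.
Qed.

End EndoMatrix.

(** * Groups and central products *)

Lemma group_isog_sym (G H : pregroup) : group_isog G H -> group_isog H G.
Proof.
move=> [f [gG gH [fH fM] [_ finj fsurj]]].
have inv y : exists x, gset H y -> gset G x /\ f x = y.
  have [yH|nyH] := pselect (gset H y); last by exists (gid G) => /nyH.
  by have [x xG <-] := fsurj y yH; exists x.
have [g gP] := choice inv; exists g; split=> //; last first.
  split=> [y /gP[]//|y z /set_mem/gP[_ E] /set_mem/gP[_ E'] gg|x xG].
    by rewrite -E -E' gg.
  exists (f x); first exact: fH.
  by have [gfG E] := gP _ (fH _ xG); apply: finj; rewrite ?inE.
split=> [y /gP[]//|x y xH yH].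
have [gx ex] := gP _ xH; have [gy ey] := gP _ yH.
have [_ mH _ _ _] := gH; have [_ mG _ _ _] := gG.
have [gxy exy] := gP _ (mH _ _ xH yH).
apply: finj; rewrite ?inE //; first exact: mG.
by rewrite exy fM // ex ey.
Qed.

Section UnitGroups.
Variable T : unitRingType.
Implicit Types A B : set T.

Lemma mulgrp_group A : A 1 -> (forall x y, A x -> A y -> A (x * y)) ->
  (forall x, A x -> x \is a GRing.unit /\ A x^-1) -> is_group (mulgrp A).
Proof.
move=> A1 AM AV; split=> //= [x y z _ _ _|x _|x /AV[xu xV]]; rewrite ?mulrA ?mul1r ?mulr1 //.
by exists x^-1 => //; rewrite mulrV ?mulVr.
Qed.

Lemma group_unit A x : is_group (mulgrp A) -> A x -> x \is a GRing.unit /\ A x^-1.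
Proof.
move=> [_ _ _ _ AV] /AV[/= y Ay [xy yx]].
have xu : x \is a GRing.unit by apply/unitrP; exists y.
by split=> //; rewrite -[x^-1]mulr1 -xy mulKr.
Qed.

Lemma image_group_iso (U : nzRingType) (f : {rmorphism T -> U}) A :
    is_group (mulgrp A) -> {in A &, injective f} ->
  is_group_iso (mulgrp A) (mulgrp (f @` A)) f.
Proof.
move=> gA fi; have [A1 AM AA A1l AV] := gA; split=> //.
- split=> /=; first by exists 1; rewrite ?rmorph1.
  + by move=> _ _ [x Ax <-] [y Ay <-]; exists (x * y); [exact: AM|rewrite rmorphM].
  + by move=> *; rewrite mulrA.
  + by move=> *; rewrite mul1r mulr1.
  + move=> _ [x /AV[y Ay /= [xy yx]] <-]; exists (f y); first by exists y.
    by rewrite -!rmorphM xy yx rmorph1.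
- by split=> [x Ax|x y _ _]; [exists x|rewrite /= rmorphM].
- by split=> // x Ax; exists x.
Qed.

End UnitGroups.

Section CentralProducts.

Lemma sign_cosetM (T U : nzRingType) (A : set T) (B : set U) x y :
  @gop (central_prod A B) (sign_coset x) (sign_coset y) = sign_coset (x.1 * y.1, x.2 * y.2).
Proof.
apply/seteqP; split=> /= [_ [u [->|->] [v [->|->] <-]]|_ [->|->]] /=.
- by left.
- by right; rewrite /= !mulrN.
- by right; rewrite /= !mulNr.
- by left; rewrite /= !mulrNN.
- by exists x; [left|exists y => //; left].
- by exists (- x.1, - x.2); [right|exists y; [left|rewrite /= !mulNr]].
Qed.

Lemma sign_coset_eq (T U : nzRingType) (x y : T * U) :
  sign_coset x = sign_coset y -> x = y \/ x = (- y.1, - y.2).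
Proof.
by move=> E; have : sign_coset y x by rewrite -E; left.
Qed.

Lemma central_prod_group (T U : nzRingType) (A : set T) (B : set U) :
  is_group (mulgrp A) -> is_group (mulgrp B) -> is_group (central_prod A B).
Proof.
move=> [A1 AM AA A1l AV] [B1 BM BA B1l BV]; split.
- by exists (1, 1).
- move=> _ _ [x [xA xB] <-] [y [yA yB] <-]; rewrite sign_cosetM.
  by exists (x.1 * y.1, x.2 * y.2) => //; split; [exact: AM|exact: BM].
- move=> _ _ _ [x _ <-] [y _ <-] [z _ <-].
  by rewrite !sign_cosetM /= !mulrA.
- move=> _ [[a b] _ <-]; rewrite (sign_cosetM A B (1, 1)) (sign_cosetM A B _ (1, 1)) /=.
  by rewrite !mul1r !mulr1.
- move=> _ [[a b] [/= /AV[a' Aa' [/= aa' a'a]] /BV[b' Bb' [/= bb' b'b]]] <-].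
  exists (sign_coset (a', b')); first by exists (a', b').
  split; first by apply: etrans (sign_cosetM A B (a, b) (a', b')) _; rewrite /= aa' bb'.
  by apply: etrans (sign_cosetM A B (a', b') (a, b)) _; rewrite /= a'a b'b.
Qed.

Lemma central_prod_isog (T T' U U' : nzRingType) (f : {rmorphism T -> T'})
    (g : {rmorphism U -> U'}) (A : set T) (B : set U) :
    is_group (mulgrp A) -> is_group (mulgrp B) -> A (-1) -> B (-1) ->
    {in A &, injective f} -> {in B &, injective g} ->
    is_group (mulgrp (f @` A)) -> is_group (mulgrp (g @` B)) ->
  group_isog (central_prod A B) (central_prod (f @` A) (g @` B)).
Proof.
move=> gA gB AN BN fi gi gfA ggB.
have [A1 AM _ _ _] := gA; have [B1 BM _ _ _] := gB.
pose F (C : set (T * U)) : set (T' * U') := [set (f x.1, g x.2) | x in C].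
have FE x : F (sign_coset x) = sign_coset (f x.1, g x.2).
  apply/seteqP; split=> [_ [u [->|->] <-]|_ [->|->]] /=.
  - by left.
  - by right; rewrite /= !rmorphN.
  - by exists x => //; left.
  - by exists (- x.1, - x.2); [right|rewrite /= !rmorphN].
have NA x : A x -> A (- x) by move=> Ax; rewrite -mulN1r; apply: AM.
have NB x : B x -> B (- x) by move=> Bx; rewrite -mulN1r; apply: BM.
exists F; split; [exact: central_prod_group|exact: central_prod_group| |].
  split=> [_ [x [xA xB] <-]|_ _ [x _ <-] [y _ <-]].
    by rewrite FE; exists (f x.1, g x.2) => //; split; [exists x.1|exists x.2].
  by rewrite sign_cosetM !FE sign_cosetM /= !rmorphM.
split=> [_ [x [xA xB] <-]||_ [[u v] [/= [a Aa <-] [b Bb <-]] <-]].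
- by rewrite FE; exists (f x.1, g x.2) => //; split; [exists x.1|exists x.2].
- move=> _ _ /set_mem[[a b] [/= Aa Bb] <-] /set_mem[[a' b'] [/= Aa' Bb'] <-].
  rewrite !FE /= => /sign_coset_eq[] [] /=.
    by move=> /fi -> ; rewrite ?inE // => /gi -> ; rewrite ?inE.
  rewrite -!rmorphN => /fi -> ; rewrite ?inE //; last exact: NA.
  move=> /gi -> ; rewrite ?inE //; last exact: NB.
  apply/seteqP; split=> z [->|->].
  - by right.
  - by left; rewrite /= !opprK.
  - by right; rewrite /= !opprK.
  - by left.
- by exists (sign_coset (a, b)); [exists (a, b)|rewrite FE].
Qed.

Lemma mulset_group (T : unitRingType) (A B : set T) :
    is_group (mulgrp A) -> is_group (mulgrp B) ->
    (forall a b, A a -> B b -> a * b = b * a) -> is_group (mulgrp (mulset A B)).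
Proof.
move=> gA gB AB; have [A1 AM _ _ _] := gA; have [B1 BM _ _ _] := gB.
apply: mulgrp_group => [|_ _ [a Aa [b Bb <-]] [a' Aa' [b' Bb' <-]]|_ [a Aa [b Bb <-]]].
- by exists 1 => //; exists 1 => //; rewrite mulr1.
- exists (a * a'); first exact: AM.
  exists (b * b'); first exact: BM.
  by rewrite !mulrA -[a * b * a']mulrA -(AB a' b) // mulrA.
- have [au Av] := group_unit gA Aa; have [bu Bv] := group_unit gB Bb.
  split; first by rewrite unitrMl.
  by exists a^-1 => //; exists b^-1 => //; rewrite invrM // (AB _ _ Av Bv).
Qed.

Lemma mulset_isog (T : unitRingType) (A B : set T) :
    is_group (mulgrp A) -> is_group (mulgrp B) ->
    (forall a b, A a -> B b -> a * b = b * a) ->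
    A (-1) -> B (-1) -> (forall a, A a -> B a -> a = 1 \/ a = -1) ->
  group_isog (mulgrp (mulset A B)) (central_prod A B).
Proof.
move=> gA gB AB AN BN ABI; have [A1 AM _ _ _] := gA; have [B1 BM _ _ _] := gB.
(* The image of [t] is the set of all its factorizations, so none has to be chosen. Two
   factorizations differ by an element of both A and B, that is by a sign, so the set is a single
   coset. *)
pose F (t : T) : set (T * T) := [set x | [/\ A x.1, B x.2 & x.1 * x.2 = t]].
have NA x : A x -> A (- x) by move=> Ax; rewrite -mulN1r; apply: AM.
have NB x : B x -> B (- x) by move=> Bx; rewrite -mulN1r; apply: BM.
have FE x : A x.1 -> B x.2 -> F (x.1 * x.2) = sign_coset x.
  case: x => a b /= Aa Bb; apply/seteqP; split=> [[a' b'] [/= Aa' Bb' E]|z [->|->]]; last first.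
  - by split; rewrite /= ?mulrNN //; [exact: NA|exact: NB].
  - by split.
  have [au Av] := group_unit gA Aa; have [bu Bv] := group_unit gB Bb.
  have [bu' Bv'] := group_unit gB Bb'.
  have E2 : a^-1 * a' = b / b'.
    by apply: (mulrI au); apply: (mulIr bu'); rewrite mulrA mulrV // mul1r E mulrA mulrVK.
  have := ABI (a^-1 * a') (AM _ _ Av Aa'); rewrite {1}E2 => /(_ (BM _ _ Bb Bv')) [] t1.
    left; congr pair; apply/esym.
      by rewrite -[a]mulr1 -t1 mulrA mulrV // mul1r.
    by rewrite -[b'](mul1r) -t1 E2 mulrVK.
  right; rewrite /sign_coset /=; congr pair.
    by rewrite -mulrN1 -t1 mulrA mulrV // mul1r.
  by rewrite -[b](mulrVK bu') -E2 t1 mulN1r opprK.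
exists F; split; [exact: mulset_group|exact: central_prod_group| |].
  split=> [_ [a Aa [b Bb <-]]|_ _ [a Aa [b Bb <-]] [a' Aa' [b' Bb' <-]]].
    by exists (a, b) => //; rewrite -(FE (a, b)).
  rewrite (FE (a, b)) // (FE (a', b')) // sign_cosetM /= -(FE (a * a', b * b')) /=; last first.
  - exact: BM.
  - exact: AM.
  congr F; by rewrite !mulrA -[a * b * a']mulrA -(AB a' b) // mulrA.
split=> [_ [a Aa [b Bb <-]]||_ [[a b] [/= Aa Bb] <-]].
- by exists (a, b) => //; rewrite -(FE (a, b)).
- move=> _ _ /set_mem[a Aa [b Bb <-]] /set_mem[a' Aa' [b' Bb' <-]].
  rewrite (FE (a, b)) // (FE (a', b')) // => /sign_coset_eq[] [] -> -> //=.
  by rewrite mulrNN.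
- exists (a * b); first by exists a => //; exists b.
  exact: (FE (a, b)).
Qed.

End CentralProducts.

(** * Quaternions and rotations *)

Definition quat_I (R : realType) : quat R := Quat 0 1 0 0.
Definition quat_J (R : realType) : quat R := Quat 0 0 1 0.
Definition quat_K (R : realType) : quat R := Quat 0 0 0 1.

Lemma quatE (R : realType) (x : quat R) :
  x = qr x *: 1 + qi x *: quat_I R + qj x *: quat_J R + qk x *: quat_K R.
Proof. by case: x => a b c d; congr Quat => /=; ring. Qed.

Lemma quat_units_mul (R : realType) (I := quat_I R) (J := quat_J R) (K := quat_K R) :
  [/\ [/\ I * I = -1, J * J = -1 & K * K = -1],
      [/\ I * J = K, J * K = I & K * I = J] &
      [/\ J * I = - K, K * J = - I & I * K = - J]].
Proof. by split; split; congr Quat; ring. Qed.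

Lemma quat_lin_ext (R : realType) (U : lmodType R) (f g : {linear quat R -> U}) :
  f 1 = g 1 -> f (quat_I R) = g (quat_I R) -> f (quat_J R) = g (quat_J R) ->
  f (quat_K R) = g (quat_K R) -> f =1 g.
Proof.
by move=> f1 fI fJ fK x; rewrite (quatE x) !linearD !linearZ /= f1 fI fJ fK.
Qed.

Section QuatMap.
Variables (R : realType) (B : algType R) (i j : B).
Hypotheses (ii : i * i = -1) (jj : j * j = -1) (ij : i * j = - (j * i)).

(** The relations are arguments of the map, so that its linear and multiplicative structures can be
    declared. *)
Definition quat_map of i * i = -1 & j * j = -1 & i * j = - (j * i) : quat R -> B :=
  fun x => let: Quat a b c d := x in a%:A + b *: i + c *: j + d *: (i * j).

Local Notation qm := (quat_map ii jj ij).

Fact quat_map_linear : linear qm.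
Proof.
move=> k [a b c d] [a' b' c' d'] /=; rewrite !scalerDl !scalerDr -!scalerA.
by rewrite [RHS]addrACA; congr (_ + _); rewrite [RHS]addrACA; congr (_ + _); rewrite [RHS]addrACA.
Qed.
HB.instance Definition _ := GRing.isLinear.Build R (quat R) B _ qm quat_map_linear.

Fact quat_map_monoid : monoid_morphism qm.
Proof.
have ji : j * i = - (i * j) by rewrite ij opprK.
have ik : i * (i * j) = - j by rewrite mulrA ii mulN1r.
have ki : i * j * i = j by rewrite -mulrA ji mulrN mulrA ii mulN1r opprK.
have jk : j * (i * j) = i by rewrite mulrA ji mulNr -mulrA jj mulrN1 opprK.
have kj : i * j * j = - i by rewrite -mulrA jj mulrN1.
have kk : i * j * (i * j) = -1 by rewrite mulrA ki jj.
have q1 : qm 1 = 1 by rewrite /= !scale0r !addr0 scale1r.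
have qI : qm (quat_I R) = i by rewrite /= !scale0r add0r !addr0 scale1r.
have qJ : qm (quat_J R) = j by rewrite /= !scale0r !add0r !addr0 scale1r.
have qK : qm (quat_K R) = i * j by rewrite /= !scale0r !add0r scale1r.
have [[II JJ KK] [IJ JK KI] [JI KJ IK]] := quat_units_mul R.
split=> // x y.
(* An abstract linear [f] with the same values on the units keeps [quat_map] from unfolding while
   both products are expanded. *)
suff main (f : {linear quat R -> B}) : f 1 = 1 -> f (quat_I R) = i -> f (quat_J R) = j ->
    f (quat_K R) = i * j -> f (x * y) = f x * f y by exact: (main qm).
move=> {}q1 {}qI {}qJ {}qK; rewrite (quatE x) (quatE y).
move: (qr x) (qi x) (qj x) (qk x) (qr y) (qi y) (qj y) (qk y) => a b c d a' b' c' d'.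
rewrite !mulrDl !mulrDr -!scalerAl -!scalerAr !(mul1r, mulr1).
rewrite II JJ KK IJ JI JK KJ KI IK !linearD !linearZ !linearN.
rewrite q1 qI qJ qK !mulrDl !mulrDr -!scalerAl -!scalerAr !(mul1r, mulr1).
by rewrite ii jj kk ji jk kj ki ik.
Qed.
HB.instance Definition _ := GRing.isMonoidMorphism.Build (quat R) B qm quat_map_monoid.

End QuatMap.

Section QuatNorm.
Variable R : realType.
Implicit Types x y u : quat R.

Definition quat_conj x : quat R := let: Quat a b c d := x in Quat a (- b) (- c) (- d).
Definition quat_nsq x : R := let: Quat a b c d := x in a ^+ 2 + b ^+ 2 + c ^+ 2 + d ^+ 2.

Lemma quat_nsqM x y : quat_nsq (x * y) = quat_nsq x * quat_nsq y.
Proof. by case: x y => a b c d [a' b' c' d'] /=; ring. Qed.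

Lemma quat_nsq_ge0 x : 0 <= quat_nsq x.
Proof. by case: x => a b c d /=; rewrite !addr_ge0 ?sqr_ge0. Qed.

Lemma quat_nsq_eq0 x : quat_nsq x = 0 -> x = 0.
Proof.
case: x => a b c d /= /eqP.
rewrite !paddr_eq0 ?addr_ge0 ?sqr_ge0 // !sqrf_eq0.
by move=> /andP[/andP[/andP[/eqP-> /eqP->] /eqP->] /eqP->].
Qed.

Lemma quat_mul_conj x : x * quat_conj x = (quat_nsq x)%:A.
Proof. by case: x => a b c d; congr Quat; rewrite /=; ring. Qed.

Lemma quat_conj_mul x : quat_conj x * x = (quat_nsq x)%:A.
Proof. by case: x => a b c d; congr Quat; rewrite /=; ring. Qed.

Lemma quat_nsqZ k x : quat_nsq (k *: x) = k ^+ 2 * quat_nsq x.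
Proof. by case: x => a b c d /=; ring. Qed.

Lemma Sp1E x : Sp1 x <-> quat_nsq x = 1.
Proof.
rewrite /Sp1 /=; have -> : quat_norm x = Num.sqrt (quat_nsq x) by case: x.
split=> [E|->]; last exact: sqrtr1.
by rewrite -[LHS]sqr_sqrtr ?quat_nsq_ge0 // E expr1n.
Qed.

Lemma Sp1_group : is_group (mulgrp (@Sp1 R)).
Proof.
have conj1 x : Sp1 x -> Sp1 (quat_conj x).
  by rewrite !Sp1E; case: x => a b c d /=; rewrite !sqrrN.
split=> /= [|x y|x y z _ _ _|x _|x Sx]; rewrite ?mulrA ?mul1r ?mulr1 //.
- by apply/Sp1E; rewrite /= expr1n expr0n /= !addr0.
- by rewrite !Sp1E quat_nsqM => -> ->; rewrite mulr1.
exists (quat_conj x); first exact: conj1.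
by rewrite quat_mul_conj quat_conj_mul; move/Sp1E: Sx => ->; rewrite scale1r.
Qed.

Lemma Sp1N1 : Sp1 (-1 : quat R).
Proof. by apply/Sp1E => /=; rewrite sqrrN expr1n !oppr0 expr0n /= !addr0. Qed.

Lemma quat_normalize x : x != 0 -> exists2 k, 0 < k & quat_nsq (k *: x) = 1.
Proof.
move=> x0; have n0 : 0 < quat_nsq x.
  by rewrite lt_neqAle quat_nsq_ge0 andbT eq_sym; apply: contraNneq x0 => /quat_nsq_eq0 ->.
exists (Num.sqrt (quat_nsq x))^-1; first by rewrite invr_gt0 sqrtr_gt0.
by rewrite quat_nsqZ exprVn sqr_sqrtr ?ltW // mulVf // lt0r_neq0.
Qed.

(** Skolem-Noether by averaging: every [U x] intertwines [F] with the identity, and it remains to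
    find a nonzero one. *)
Lemma quat_inner (F : {lrmorphism quat R -> quat R}) :
  exists2 u, quat_nsq u = 1 & forall x, F x * u = u * x.
Proof.
set I := quat_I R; set J := quat_J R; set K := quat_K R.
have [[II JJ KK] [IJ JK KI] [JI KJ IK]] := quat_units_mul R.
rewrite -/I -/J -/K in II JJ KK IJ JK KI JI KJ IK.
(* U x averages [F g * x * g^-1] over the units g = 1, I, J, K. *)
pose U x := x - F I * x * I - F J * x * J - F K * x * K.
have FII : F I * F I = -1 by rewrite -rmorphM II rmorphN1.
have FJJ : F J * F J = -1 by rewrite -rmorphM JJ rmorphN1.
have FIJ : F I * F J = F K by rewrite -rmorphM IJ.
have FIK : F I * F K = - F J by rewrite -rmorphM IK rmorphN.
have FJI : F J * F I = - F K by rewrite -rmorphM JI rmorphN.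
have FJK : F J * F K = F I by rewrite -rmorphM JK.
have UI x : F I * U x = U x * I.
  rewrite /U !mulrBr !mulrBl -!(mulrA _ _ I) II JI KI !mulrA FII FIJ FIK.
  rewrite !(mulNr, mulrN, mul1r, mulr1).
  move: (F I * x) (x * I) (F K * x * J) (F J * x * K).
  by move=> [????] [????] [????] [????]; congr Quat; ring.
have UJ x : F J * U x = U x * J.
  rewrite /U !mulrBr !mulrBl -!(mulrA _ _ J) IJ JJ KJ !mulrA FJI FJJ FJK.
  rewrite !(mulNr, mulrN, mul1r, mulr1).
  move: (F J * x) (x * J) (F I * x * K) (F K * x * I).
  by move=> [????] [????] [????] [????]; congr Quat; ring.
have Uall x y : F y * U x = U x * y.
  have UK : F K * U x = U x * K by rewrite -FIJ -mulrA UJ mulrA UI -mulrA IJ.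
  move: (U x) (UI x) (UJ x) UK => z zI zJ zK.
  rewrite (quatE y) !rmorphD /= !linearZ /= rmorph1 !mulrDl !mulrDr -!scalerAl -!scalerAr.
  by rewrite -/I -/J -/K zI zJ zK mul1r mulr1.
have [x x0] : exists x, U x != 0.
  apply: contrapT => /forallNP Un.
  have U0 x : U x = 0 by apply/eqP/negPn/negP => /Un.
  (* This combination of the values of [U] is 4 whatever [F I], [F J] and [F K] are, so [U] cannot
     vanish at all four units. *)
  have : U 1 - U I * I - U J * J - U K * K = Quat 4 0 0 0.
    rewrite /U; move: (F I) (F J) (F K) => [????] [????] [????].
    by congr Quat; rewrite /=; ring.
  rewrite !U0 !mul0r !subr0 => /(congr1 (@qr R)) /= /esym/eqP.
  by rewrite pnatr_eq0.
have [k k0 kU] := quat_normalize x0.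
exists (k *: U x) => // y; by rewrite -scalerAr Uall scalerAl.
Qed.
End QuatNorm.

Definition o0 : 'I_3 := ord0.
Definition o1 : 'I_3 := lift ord0 ord0.
Definition o2 : 'I_3 := lift ord0 (lift ord0 ord0).

Lemma ord3P (P : 'I_3 -> Prop) : P o0 -> P o1 -> P o2 -> forall i, P i.
Proof.
move=> P0 P1 P2 i; case: (unliftP ord0 i) => [j|] -> //.
case: (unliftP ord0 j) => [k|] -> //; by rewrite (ord1 k).
Qed.

Lemma sum3 (V : nmodType) (F : 'I_3 -> V) : \sum_i F i = F o0 + F o1 + F o2.
Proof. by rewrite !big_ord_recl big_ord0 addr0 addrA. Qed.

Lemma lift3E : [/\ lift o0 (ord0 : 'I_2) = o1, lift o0 (ord_max : 'I_2) = o2,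
  lift o1 (ord0 : 'I_2) = o0 & lift o1 (ord_max : 'I_2) = o2] /\
  lift o2 (ord0 : 'I_2) = o0 /\ lift o2 (ord_max : 'I_2) = o1.
Proof. by split; split; apply: val_inj. Qed.

Lemma cofactor3 (R : comNzRingType) (M : 'M[R]_3) i j : cofactor M i j =
  (-1) ^+ (i + j) * (M (lift i ord0) (lift j ord0) * M (lift i ord_max) (lift j ord_max) -
    M (lift i ord0) (lift j ord_max) * M (lift i ord_max) (lift j ord0)).
Proof.
rewrite /cofactor; congr (_ * _).
rewrite (expand_det_row _ ord0) !big_ord_recl big_ord0 /cofactor !det_mx11 !mxE /=.
have -> : lift (ord0 : 'I_2) ord0 = ord_max by apply: val_inj.
have -> : lift (ord_max : 'I_2) ord0 = ord0 by apply: val_inj.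
by rewrite expr0 expr1; ring.
Qed.

Lemma det3 (R : comNzRingType) (M : 'M[R]_3) : \det M =
  M o0 o0 * (M o1 o1 * M o2 o2 - M o1 o2 * M o2 o1)
  - M o0 o1 * (M o1 o0 * M o2 o2 - M o1 o2 * M o2 o0)
  + M o0 o2 * (M o1 o0 * M o2 o1 - M o1 o1 * M o2 o0).
Proof.
rewrite (expand_det_row _ o0) sum3 !cofactor3.
by have [[-> -> -> ->] [-> ->]] := lift3E; rewrite /=; ring.
Qed.

Section QuatSO3.
Variable R : realType.
Implicit Types (x u : quat R) (F G : {lrmorphism quat R -> quat R}).

Definition quat_im x (i : 'I_3) : R := [:: qi x; qj x; qk x]`_i.
Definition quat_unit (i : 'I_3) : quat R := [:: quat_I R; quat_J R; quat_K R]`_i.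
Definition quat_mx (F : quat R -> quat R) : 'M[R]_3 :=
  \matrix_(i, j) quat_im (F (quat_unit j)) i.

Lemma quat_lrE F : exists2 u, quat_nsq u = 1 & forall x, F x = u * x * quat_conj u.
Proof.
have [u u1 uF] := quat_inner F; exists u => // x.
by rewrite -uF -mulrA quat_mul_conj u1 scale1r mulr1.
Qed.

Lemma quat_lr_nsq F x : quat_nsq (F x) = quat_nsq x.
Proof.
have [u u1 ->] := quat_lrE F; rewrite !quat_nsqM u1 mul1r.
have -> : quat_nsq (quat_conj u) = quat_nsq u; last by rewrite u1 mulr1.
by case: u {u1} => a b c d /=; rewrite !sqrrN.
Qed.

Lemma quat_lr_re F x : qr (F x) = qr x.
Proof.
have [u u1 ->] := quat_lrE F; have -> : qr x = quat_nsq u * qr x by rewrite u1 mul1r.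
by case: u {u1} => a b c d; case: x => a' b' c' d' /=; ring.
Qed.

Lemma quat_mx_SO3 F : gset (SO3 R) (quat_mx F).
Proof.
have [[a b c d] /= u1 uF] := quat_lrE F.
have mE i j : quat_mx F i j = quat_im (Quat a b c d * quat_unit j * quat_conj (Quat a b c d)) i.
  by rewrite mxE uF.
split; last first.
  rewrite det3 !mE /quat_im /quat_unit /=.
  (* The determinant of the Euler-Rodrigues matrix of a quaternion is the cube of its squared
     norm. *)
  transitivity ((a ^+ 2 + b ^+ 2 + c ^+ 2 + d ^+ 2) ^+ 3); first by ring.
  by rewrite u1 expr1n.
(* The rows of that matrix are orthogonal, each with squared length equal to the square of the
   quaternion's squared norm. *)
have sq1 : (a ^+ 2 + b ^+ 2 + c ^+ 2 + d ^+ 2) ^+ 2 = 1 by rewrite u1 expr1n.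
apply/matrixP; apply: ord3P; apply: ord3P;
  rewrite !mxE sum3 ![_^T _ _]mxE !mE /quat_im /quat_unit -?val_eqE /=;
  rewrite ?mulr1n ?mulr0n -?[in RHS]sq1; ring.
Qed.

Lemma quat_imE x : qr x = 0 -> x = \sum_i quat_im x i *: quat_unit i.
Proof.
by case: x => a b c d /= ->; rewrite sum3 /quat_im /quat_unit /=; congr Quat => /=; ring.
Qed.

Lemma quat_mx_comp F G : quat_mx (F \o G) = quat_mx F *m quat_mx G.
Proof.
apply/matrixP => i j; rewrite !mxE /= {1}(@quat_imE (G (quat_unit j))); last first.
  by rewrite quat_lr_re /quat_unit; move: j; apply: ord3P.
rewrite raddf_sum /=.
have sum_im (H : 'I_3 -> quat R) : quat_im (\sum_k H k) i = \sum_k quat_im (H k) i.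
  rewrite !sum3; case: (H o0) (H o1) (H o2) => ? ? ? ? [? ? ? ?] [? ? ? ?].
  by rewrite /quat_im /=; move: i; apply: ord3P.
rewrite sum_im; apply: eq_bigr => k _; rewrite linearZ /= !mxE [RHS]mulrC.
case: (F _) => ? ? ? ?; rewrite {1 3}/quat_im /= {sum_im}.
by move: i; apply: ord3P.
Qed.

Lemma quat_mx_inj F G : quat_mx F = quat_mx G -> F =1 G.
Proof.
move=> /matrixP E.
have EU j : F (quat_unit j) = G (quat_unit j).
  have re0 H : qr ((H : {lrmorphism quat R -> quat R}) (quat_unit j)) = 0.
    by rewrite quat_lr_re; move: j; apply: ord3P.
  rewrite (quat_imE (re0 F)) (quat_imE (re0 G)).
  by apply: eq_bigr => i _; have := E i j; rewrite !mxE => ->.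
apply: quat_lin_ext; first by rewrite !rmorph1.
- exact: (EU o0).
- exact: (EU o1).
- exact: (EU o2).
Qed.

(** The columns of M, read as imaginary quaternions, are orthonormal, hence anticommuting square
    roots of -1; the first two define the morphism. Determinant 1 enters as M^T = adj M, which says
    that the third column is the product of the first two. *)
Lemma quat_mx_surj (M : 'M[R]_3) : gset (SO3 R) M ->
  exists F, quat_mx F = M.
Proof.
move=> [/= MT detM].
have TM : M^T *m M = 1%:M by apply: mulmx1C.
have adjM : M^T = \adj M.
  by rewrite -[RHS]mulmx1 -MT mulmxA mul_adj_mx detM mul1mx.
pose v (j : 'I_3) := Quat 0 (M o0 j) (M o1 j) (M o2 j).
have dot j k : M o0 j * M o0 k + M o1 j * M o1 k + M o2 j * M o2 k = (j == k)%:R.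
  by have /matrixP/(_ j k) := TM; rewrite !mxE sum3 !mxE => ->.
have vv : forall j, v j * v j = -1.
  move=> j; have := dot j j; rewrite eqxx /= => E; congr Quat; rewrite /=; try ring.
  by apply: etrans (congr1 -%R E); ring.
have v01 : v o0 * v o1 = - (v o1 * v o0).
  have E : M o0 o0 * M o0 o1 + M o1 o0 * M o1 o1 + M o2 o0 * M o2 o1 = 0 := dot o0 o1.
  by congr Quat; rewrite /=; lra.
exists (quat_map (vv o0) (vv o1) v01 : {lrmorphism quat R -> quat R}).
have cof (i : 'I_3) : M i o2 = cofactor M i o2.
  by have /matrixP/(_ o2 i) := adjM; rewrite !mxE.
have v2 : v o0 * v o1 = v o2.
  have E : M o0 o0 * M o0 o1 + M o1 o0 * M o1 o1 + M o2 o0 * M o2 o1 = 0 := dot o0 o1.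
  have [[l1 l2 l3 l4] [l5 l6]] := lift3E.
  by congr Quat; rewrite /= ?cof ?cofactor3 ?l1 ?l2 ?l3 ?l4 ?l5 ?l6 /=; first lra; ring.
apply/matrixP => i j; rewrite mxE.
transitivity (quat_im (v j) i); [congr (quat_im _ i)|].
  move: j; apply: ord3P; rewrite /quat_unit /quat_map /= ?v2 ?scale0r ?scale1r ?addr0 ?add0r //.
by move: i; apply: ord3P.
Qed.

End QuatSO3.

(** * Subalgebras and groups of algebra automorphisms *)

Lemma lrmorphism_inverse (R : nzRingType) (A B : algType R) (f : {lrmorphism A -> B}) :
  bijective f -> exists g : {lrmorphism B -> A}, cancel f g /\ cancel g f.
Proof.
move=> [g fK gK]; have fi := can_inj fK.
have glin : linear g by move=> k x y; apply: fi; rewrite gK linearP /= !gK.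
have gmon : monoid_morphism g.
  by split=> [|x y]; apply: fi; rewrite gK ?rmorph1 ?rmorphM /= ?gK.
by exists (HB.pack_for {lrmorphism B -> A} g (GRing.isLinear.Build R B A _ g glin)
  (GRing.isMonoidMorphism.Build B A g gmon)).
Qed.

Section AspaceVal.
Variables (K : fieldType) (A : falgType K) (U : {aspace A}).
Hypothesis U1 : 1 \in U.

(** The unit of [subvs_of U] is [algid U], which is 1 when 1 lies in U. That membership is an
    argument so that the inclusion can be declared a unital morphism. *)
Definition aspace_val of 1 \in U : subvs_of U -> A := vsval.
Local Notation av := (aspace_val U1).

Fact aspace_val_linear : linear av. Proof. exact: linearP. Qed.
HB.instance Definition _ := GRing.isLinear.Build K (subvs_of U) A _ av aspace_val_linear.

Fact aspace_val_monoid : monoid_morphism av.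
Proof. by split=> //; apply/eqP; rewrite algid_eq1. Qed.
HB.instance Definition _ := GRing.isMonoidMorphism.Build (subvs_of U) A av aspace_val_monoid.

Lemma aspace_val_inj : injective av. Proof. exact: val_inj. Qed.

End AspaceVal.

Section ComplexMap.
Variables (R : realType) (B : algType R) (j : B).
Hypothesis jj : j * j = -1.

Definition complex_map of j * j = -1 : Rcomplex R -> B :=
  fun z => (complex.Re z)%:A + complex.Im z *: j.
Local Notation cm := (complex_map jj).

Fact complex_map_linear : linear cm.
Proof.
move=> k [a b] [a' b']; rewrite /complex_map /= !scalerDl !scalerDr -!scalerA.
by rewrite [RHS]addrACA.
Qed.
HB.instance Definition _ := GRing.isLinear.Build R (Rcomplex R) B _ cm complex_map_linear.

Fact complex_map_monoid : monoid_morphism cm.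
Proof.
split=> [|[a b] [a' b']]; first by rewrite /complex_map /= scale1r scale0r addr0.
rewrite /complex_map /= mulrDl !mulrDr -!scalerAl -!scalerAr !mul1r !mulr1 jj.
rewrite !scalerN !scalerA scalerBl scalerDl addrACA [- _ + _]addrC -!addrA; congr (_ + _).
Qed.
HB.instance Definition _ := GRing.isMonoidMorphism.Build (Rcomplex R) B cm complex_map_monoid.

Lemma complex_map_inj : injective cm.
Proof.
apply: raddf_inj => -[a b] E.
have : cm (Complex a b) * cm (Complex a (- b)) = 0 by rewrite E mul0r.
rewrite -rmorphM.
have -> : (Complex a b : Rcomplex R) * Complex a (- b) = Complex (a ^+ 2 + b ^+ 2) 0.
  by congr Complex; ring.
rewrite /= /complex_map /= scale0r addr0 => /eqP; rewrite scaler_eq0 oner_eq0 orbF.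
by rewrite paddr_eq0 ?sqr_ge0 // !sqrf_eq0 => /andP[/eqP-> /eqP->].
Qed.

End ComplexMap.

Lemma quat_lr_injective (R : realType) (B : algType R) (f : {lrmorphism quat R -> B}) :
  injective f.
Proof.
apply: raddf_inj => x fx; apply: quat_nsq_eq0; apply/eqP.
have : f (quat_conj x * x) = 0 by rewrite rmorphM fx mulr0.
rewrite quat_conj_mul linearZ /= rmorph1 => /eqP.
by rewrite scaler_eq0 oner_eq0 orbF.
Qed.

Section AlgebraAutomorphisms.
Variables (K : fieldType) (B : falgType K).
Implicit Types f g : 'End(B).

(** For [B = subvs_of SS] this is convertible with [schur_aut], so results on it apply directly to
    [schur_aut_group]. *)
Definition alg_aut : set 'End(B) := [set f | ahom_in fullv f /\ lker f == 0%VS].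

Definition alg_aut_group : pregroup := Pregroup alg_aut (fun f g => (f \o g)%VF) \1%VF.

Lemma alg_autP f : alg_aut f <->
  [/\ forall x y, f (x * y) = f x * f y, f 1 = 1 & injective f].
Proof.
split=> [[/ahom_inP[fM f1] /lker0P fi]|[fM f1 fi]]; first by split=> // x y; rewrite fM ?memvf.
by split; [apply/ahom_inP; split=> // x y _ _|apply/lker0P].
Qed.

Lemma alg_aut_id : alg_aut \1%VF.
Proof. by apply/alg_autP; split=> [x y||x y]; rewrite !id_lfunE. Qed.

Lemma alg_aut_group_group : is_group alg_aut_group.
Proof.
split=> /=.
- exact: alg_aut_id.
- move=> f g /alg_autP[fM f1 fi] /alg_autP[gM g1 gi]; apply/alg_autP.
  by split=> [x y||x y]; rewrite !comp_lfunE ?gM ?fM ?g1 ?f1 // => /fi/gi.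
- by move=> f g k _ _ _; rewrite comp_lfunA.
- by move=> f _; rewrite comp_lfun1l comp_lfun1r.
- move=> f Af; have [fM f1 fi] := (alg_autP f).1 Af; have [_ k0] := Af.
  exists f^-1%VF; last by split; [exact: lker0_compfV|exact: lker0_compVf].
  apply/alg_autP; split=> [x y||]; try by apply: fi; rewrite ?fM !lker0_lfunVK ?f1.
  exact: (can_inj (lker0_lfunVK k0)).
Qed.

Lemma alg_aut_lr f : alg_aut f -> exists F : {lrmorphism B -> B}, forall x, F x = f x.
Proof.
by move=> [fh _]; exists (AHom fh).
Qed.

Lemma lr_alg_aut (F : {lrmorphism B -> B}) : injective F -> alg_aut (linfun F).
Proof.
move=> Fi; apply/alg_autP; split=> [x y||x y]; rewrite !lfunE /=.
- by rewrite rmorphM.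
- by rewrite rmorph1.
- exact: Fi.
Qed.

End AlgebraAutomorphisms.

Lemma alg_aut_SO3 (R : realType) (B : falgType R) (phi : {lrmorphism quat R -> B}) :
  bijective phi -> group_isog (alg_aut_group B) (SO3 R).
Proof.
move=> phi_bij; have [psi [phiK psiK]] := lrmorphism_inverse phi_bij.
have trans f : alg_aut f -> exists F : {lrmorphism quat R -> quat R},
    forall x, F x = psi (f (phi x)).
  move=> /alg_aut_lr[F FE]; pose G : {lrmorphism quat R -> quat R} := psi \o (F \o phi).
  by exists G => x; rewrite /= FE.
pose Phi (f : 'End(B)) := quat_mx (fun x => psi (f (phi x))).
have PhiE (f : 'End(B)) (F : {lrmorphism quat R -> quat R}) :
    (forall x, F x = psi (f (phi x))) -> Phi f = quat_mx F.
  by move=> FE; apply/matrixP => i j; rewrite !mxE FE.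
exists Phi; split.
- exact: alg_aut_group_group.
- apply: mulgrp_group => [|M N [/= MT dM] [NT dN]|M [/= MT dM]] /=.
  + by rewrite trmx1 mulmx1 det1.
  + by rewrite -mulmxE trmx_mul mulmxA -[M *m N *m _]mulmxA NT mulmx1 det_mulmx dM dN mulr1.
  + have Mu : M \is a GRing.unit by rewrite -[_ \is a _]/(M \in unitmx) unitmxE dM unitr1.
    have -> : M^-1 = M^T by apply: (mulrI Mu); rewrite mulrV // -mulmxE MT.
    by rewrite trmxK det_tr; split=> //; split=> //; apply: mulmx1C.
- split=> [f /trans[F FE]|f g /trans[F FE] /trans[G GE]].
    by rewrite (PhiE _ F) //; apply: quat_mx_SO3.
  rewrite (PhiE f F) // (PhiE g G) // -[RHS]quat_mx_comp.
  by apply/matrixP => i j; rewrite !mxE /= comp_lfunE FE GE psiK.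
split=> [f /trans[F FE]||M SM].
- by rewrite (PhiE _ F) //; apply: quat_mx_SO3.
- move=> f g /set_mem/trans[F FE] /set_mem/trans[G GE]; rewrite (PhiE f F) // (PhiE g G) //.
  move=> /quat_mx_inj FG; apply/lfunP => x.
  by rewrite -[x]psiK; apply: (can_inj psiK); rewrite -FE -GE FG.
- have [F FM] := quat_mx_surj SM.
  pose f : {lrmorphism B -> B} := phi \o (F \o psi).
  have fi : injective f.
    by move=> x y /= /(can_inj phiK) /quat_lr_injective /(can_inj psiK).
  exists (linfun f); first exact: lr_alg_aut.
  by rewrite (PhiE _ F) // => x; rewrite lfunE /= !phiK.
Qed.

(** * Cardinality of a product set *)

Local Open Scope card_scope.

Section HalfSpace.
Variables (R : numFieldType) (A : lmodType R).

(* Selects exactly one element of each pair [{x, - x}] with [x != 0]. *)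
Definition half (x : A) : bool := choose (pred2 x (- x)) x == x.

Lemma choose_opp (x : A) : choose (pred2 x (- x)) x = choose (pred2 (- x) (- - x)) (- x).
Proof.
have E : pred2 (- x) (- - x) =1 pred2 x (- x) by move=> y /=; rewrite opprK orbC.
rewrite (eq_choose E); apply: choose_id; by rewrite /= eqxx ?orbT.
Qed.

Lemma half_opp (x : A) : x != 0 -> half (- x) = ~~ half x.
Proof.
move=> x0; have xN : x != - x.
  by rewrite -subr_eq0 opprK -mulr2n -scaler_nat scaler_eq0 pnatr_eq0.
rewrite /half -choose_opp.
have /orP[/eqP->|/eqP->] : pred2 x (- x) (choose (pred2 x (- x)) x).
  by apply: chooseP; rewrite /= eqxx.
- by rewrite eqxx (negPf xN).
- by rewrite eqxx eq_sym (negPf xN).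
Qed.
End HalfSpace.

Section CoordNorm.
Variables (R : realFieldType) (A : vectType R).

Definition coord_norm (x : A) : R := \sum_i `|coord (vbasis {:A}) i x|.

Lemma coord_normZ k x : coord_norm (k *: x) = `|k| * coord_norm x.
Proof.
by rewrite /coord_norm mulr_sumr; apply: eq_bigr => i _; rewrite linearZ normrM.
Qed.

Lemma coord_norm_gt0 x : x != 0 -> 0 < coord_norm x.
Proof.
move=> x0; rewrite lt_neqAle sumr_ge0 // andbT eq_sym; apply: contra x0.
rewrite psumr_eq0 // => /allP H; apply/eqP; rewrite (coord_vbasis (memvf x)).
apply: big1 => i _; have := H i (mem_index_enum _); rewrite normr_eq0 => /eqP ->.
by rewrite scale0r.
Qed.
End CoordNorm.

(* [mulset X U] is [X * U] modulo a common sign.  The sign of the second factor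
   is recorded in the size of the first one, which is scaled below or above 1. *)
Lemma card_mulset (R : realFieldType) (A : falgType R) (X U : set A) :
    (forall x, X x -> x != 0) -> (forall u, U u -> u != 0) ->
    (forall k x, k != 0 -> X x -> X (k *: x)) -> (forall u, U u -> U (- u)) ->
    (forall x u y v, X x -> U u -> X y -> U v -> x * u = y * v ->
      (x = y /\ u = v) \/ (x = - y /\ u = - v)) ->
  mulset X U #= X `*` U.
Proof.
(* Cantor-Bernstein: multiplication maps X x U onto the product set, so an injection [g] back into
   it suffices. *)
move=> X0 U0 XZ UN XU; rewrite card_eq_le; apply/andP; split.
  have -> : mulset X U = (fun z => z.1 * z.2) @` (X `*` U).
    apply/seteqP; split=> [_ [x Xx [u Uu <-]]|_ [[x u] [/= Xx Uu] <-]]; first by exists (x, u).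
    by exists x => //; exists u.
  exact: card_image_le.
pose N := @coord_norm R A.
(* The two scalings turn a size t into t / (1 + t) < 1 and 1 + t > 1, both injective in t: the new
   size reveals the branch as well as the old size. *)
pose s (b : bool) (t : R) := if b then (1 + t)^-1 else (1 + t) / t.
pose g (z : A * A) := (s (half z.2) (N z.1) *: z.1) * (if half z.2 then z.2 else - z.2).
have sgt0 b t : 0 < t -> 0 < s b t.
  by move=> t0; rewrite /s; case: b; rewrite ?invr_gt0 ?divr_gt0 // addr_gt0.
have Ns b x : X x -> N (s b (N x) *: x) = if b then N x / (1 + N x) else 1 + N x.
  move=> /X0 /coord_norm_gt0; rewrite -/(N x) => N0.
  rewrite /N coord_normZ -/N ger0_norm ?ltW ?sgt0 // /s.
  by case: b; [rewrite mulrC|rewrite divfK ?lt0r_neq0].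
have gi : {in X `*` U &, injective g}.
  move=> [x u] [y v] /set_mem[/= Xx Uu] /set_mem[/= Xy Uv]; rewrite /g /= => E.
  have Xs b z : X z -> X (s b (N z) *: z).
    by move=> Xz; apply: XZ => //; rewrite lt0r_neq0 ?sgt0 // coord_norm_gt0 ?X0.
  have Us w : U w -> U (if half w then w else - w) by move=> Uw; case: ifP => // _; apply: UN.
  have Hs w : U w -> half (if half w then w else - w).
    by move=> Uw; case: ifP => // hw; rewrite half_opp ?U0 // hw.
  case: (XU _ _ _ _ (Xs _ _ Xx) (Us _ Uu) (Xs _ _ Xy) (Us _ Uv) E) => -[E1 E2]; last first.
    by have := Hs _ Uu; rewrite E2 half_opp ?(Hs _ Uv) // U0 //; apply: Us.
  have Nx := coord_norm_gt0 (X0 _ Xx); have Ny := coord_norm_gt0 (X0 _ Xy).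
  have NE : N x = N y /\ half u = half v.
    have := congr1 N E1; rewrite !Ns //; rewrite -/(N x) -/(N y) in Nx Ny.
    have small (t : R) : 0 < t -> t / (1 + t) < 1.
      by move=> t0; rewrite ltr_pdivrMr ?addr_gt0 // mul1r ltr_pwDl.
    case: (half u); case: (half v) => //.
    - move=> /eqP; rewrite eqr_div ?lt0r_neq0 ?addr_gt0 // => /eqP; lra.
    - by have := small _ Nx; lra.
    - by have := small _ Ny; lra.
    - by lra.
  case: NE => NE hE; rewrite NE hE in E1.
  have -> : x = y.
    by apply: (scalerI _ E1); rewrite lt0r_neq0 ?sgt0.
  by congr pair; move: E2; rewrite hE; case: ifP => // _ /oppr_inj.
have gL : g @` (X `*` U) `<=` mulset X U.
  move=> _ [[x u] [/= Xx Uu] <-]; exists (s (half u) (N x) *: x).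
    by apply: XZ => //; rewrite lt0r_neq0 ?sgt0 // coord_norm_gt0 ?X0.
  by exists (if half u then u else - u) => //; case: ifP => // _; apply: UN.
by rewrite -(card_le_eql (inj_card_eq gi)); apply: subset_card_le.
Qed.

(** * The Lipschitz group *)

Lemma mon_morph (R : numDomainType) (A B : algType R) (f : {lrmorphism A -> B})
  (e : nat -> A) s : f (mon e s) = mon (fun i => f (e i)) s.
Proof. by rewrite /mon rmorph_prod. Qed.

Lemma norm1_unit (R : fieldType) (B : unitAlgType R) (x y : R) (w : B) :
  x ^+ 2 + y ^+ 2 = 1 -> w * w = -1 ->
  (x%:A + y *: w) * (x%:A - y *: w) = 1 /\ x%:A + y *: w \is a GRing.unit.
Proof.
move=> xy ww.
have E (t : R) : t ^+ 2 = y ^+ 2 -> (x%:A + t *: w) * (x%:A - t *: w) = 1.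
  move=> ty; rewrite mulrDl !mulrBr !mulr_algl mulr_algr -scalerAl -scalerAr ww.
  by rewrite !scalerA scalerN opprK addrA subrK -scalerDl -!expr2 ty xy scale1r.
split; first exact: E.
apply/unitrP; exists (x%:A - y *: w); split; last exact: E.
by have := E (- y); rewrite sqrrN !scaleNr opprK; apply.
Qed.

(** * The irreducible module and its twisted commutants *)

Section CliffordModule.
Variables (R : realType) (V : vectType R) (h : {symmetric V}) (p q : nat).
Hypothesis hnd : nondegenerate h.
Variables (Cl : unitAlgType R) (iota : {linear V -> Cl}).
Hypothesis hCl : is_clifford_algebra h iota.
Variables (S : vectType R) (S_gt0 : (0 < dim S)%N).
Variable gamma : {lrmorphism Cl -> endo S_gt0}.
Hypothesis hirr : irreducible_rep gamma.
Variable e : (p + q).-tuple V.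
Hypothesis he : orthonormal_basis h e.

Local Notation d := (p + q)%N.
Local Notation A := (endo S_gt0).
Local Notation W := (clifford_image iota gamma).
Local Notation SS := (schur_algebra iota gamma).
Local Notation part := (clifford_part iota).

(** The same generators are needed in three places: in [Cl] ([gen]), in End(S) ([wgen]) and as
    matrices ([mgen]). *)
Definition gen (i : nat) : Cl := iota e`_i.
Definition wgen (i : nat) : A := gamma (gen i).
Definition mgen (i : nat) : 'M[R]_((dim S).-1.+1) := endo_mx (wgen i).
Local Notation w := wgen.
Local Notation m := mgen.

Lemma iota_anticomm u v : iota u * iota v + iota v * iota u = (2 * h u v)%:A.
Proof.
have [sq _] := hCl; have := sq (u + v).
rewrite linearD mulrDl !mulrDr !sq linearDl !linearDr /= (hermC h v u) expr0 mul1r /=.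
rewrite -[_ + _ + (_ + (h v v)%:A)]addrA [_ + (iota v * _ + _)]addrA.
rewrite !scalerDl -!addrA => /addrI; rewrite !addrA => /addIr ->.
by rewrite mulrDl !mul1r scalerDl.
Qed.

Lemma form_basis i : (i < d)%N -> forall j, (j < d)%N ->
  h e`_i e`_j = if i == j then sgn_at R p i else 0.
Proof.
move=> id j jd; have [_ /(_ (Ordinal id) (Ordinal jd))] := he.
by rewrite !(tnth_nth 0) /= => ->.
Qed.

Lemma gen_sq i : (i < d)%N -> gen i * gen i = (sgn_at R p i)%:A.
Proof. by move=> id; have [-> _] := hCl; rewrite form_basis // eqxx. Qed.

Lemma gen_ac i j : (i < d)%N -> (j < d)%N -> i != j -> gen i * gen j = - (gen j * gen i).
Proof.
move=> id jd ij; apply/eqP; rewrite -addr_eq0 iota_anticomm form_basis // (negPf ij).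
by rewrite mulr0 scale0r.
Qed.

Lemma w_sq i : (i < d)%N -> w i * w i = (sgn_at R p i)%:A.
Proof. by move=> id; rewrite /wgen -rmorphM /= gen_sq // rmorph_alg. Qed.

Lemma w_ac i j : (i < d)%N -> (j < d)%N -> i != j -> w i * w j = - (w j * w i).
Proof. by move=> id jd ij; rewrite /wgen -!rmorphM /= gen_ac // rmorphN. Qed.

Lemma m_sq i : (i < d)%N -> m i * m i = (sgn_at R p i)%:A.
Proof. by move=> id; rewrite /mgen -rmorphM /= w_sq // rmorph_alg. Qed.

Lemma m_ac i j : (i < d)%N -> (j < d)%N -> i != j -> m i * m j = - (m j * m i).
Proof. by move=> id jd ij; rewrite /mgen -rmorphM /= w_ac // rmorphN rmorphM. Qed.

(** If gamma(v) = 0, the image of the polarized relation gives h(v, u) = 0 for all u, and h is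
    nondegenerate. *)
Lemma gamma_iota_inj v : gamma (iota v) = 0 -> v = 0.
Proof.
move=> gv; apply/eqP; rewrite -memv0 -(eqP hnd); apply/mem_orthovP => u _.
have := congr1 gamma (iota_anticomm v u).
rewrite rmorphD !rmorphM /= gv mul0r mulr0 add0r /= rmorph_alg => /esym/eqP.
by rewrite scaler_eq0 oner_eq0 orbF mulf_eq0 pnatr_eq0 => /eqP.
Qed.

Lemma imageP x : reflect (exists v, x = gamma (iota v)) (x \in W).
Proof.
apply: (iffP memv_imgP) => [[v _ ->]|[v ->]]; first by exists v; rewrite lfunE.
by exists v; rewrite ?memvf ?lfunE.
Qed.

Lemma w_image i : w i \in W. Proof. by apply/imageP; exists e`_i. Qed.

Lemma basis_expand v : v = \sum_(i < d) coord e i v *: e`_i.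
Proof. by have [/coord_basis eb _] := he; apply: eb; rewrite memvf. Qed.

Lemma gamma_iotaE v : gamma (iota v) = \sum_(i < d) coord e i v *: w i.
Proof.
by rewrite {1}(basis_expand v) !raddf_sum; apply: eq_bigr => i _; rewrite /= !linearZ.
Qed.

Definition twisted (s : bool) (X : A) := forall x, x \in W -> X * x = (-1) ^+ s *: (x * X).

Lemma twisted_gen s X :
  twisted s X <-> forall j, (j < d)%N -> X * w j = (-1) ^+ s *: (w j * X).
Proof.
split=> H; first by move=> j _; apply/H/w_image.
move=> x /imageP[v ->]; rewrite gamma_iotaE mulr_suml mulr_sumr.
by rewrite scaler_sumr; apply: eq_bigr => i _ /=; rewrite -scalerAr H // -scalerAl !scalerA mulrC.
Qed.

Lemma schurP X : reflect (twisted false X) (X \in SS).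
Proof.
apply: (iffP idP) => [/centvP H x xW|H]; first by rewrite expr0 scale1r H.
by apply/centvP => x xW; rewrite H // expr0 scale1r.
Qed.

Lemma anticommutantP X : anticommutant iota gamma X <-> twisted true X.
Proof. by split=> H x xW; have := H x xW; rewrite expr1 scaleN1r. Qed.

Lemma twisted_part s X par a : twisted s X -> part par a ->
  X * gamma a = (-1) ^+ (s && par) *: (gamma a * X).
Proof.
move=> tX [n [c [l [lp ->]]]]; rewrite raddf_sum mulr_suml mulr_sumr scaler_sumr.
apply: eq_bigr => i _ /=; rewrite !linearZ /= -scalerAr -scalerAl scalerA.
rewrite mulrC -scalerA; congr (_ *: _); rewrite -(lp i) rmorph_prod.
elim: (l i) => [|v t IH]; first by rewrite big_nil andbF expr0 scale1r mulr1 mul1r.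
rewrite big_cons mulrA tX; last by apply/imageP; exists v.
rewrite -scalerAl -[_ * X * _]mulrA IH -scalerAr scalerA -signr_addb mulrA.
by congr (_ ^+ _ *: _); case: s {tX IH} => //=; case: (odd _).
Qed.

Lemma gamma_comm_SS x s : s \in SS -> gamma x * s = s * gamma x.
Proof.
move=> /schurP tX; have [a0 [a1 [p0 p1 ->]]] := clifford_split hCl x.
rewrite rmorphD /= mulrDl mulrDr (twisted_part tX p0) (twisted_part tX p1).
by rewrite !expr0 !scale1r.
Qed.

Lemma endo_unitP (a : A) : lker (a : 'End(S)) == 0%VS -> a \is a GRing.unit.
Proof.
move=> k0; apply/unitrP; exists ((a : 'End(S))^-1%VF : A).
by split; [exact: lker0_compVf|exact: lker0_compfV].
Qed.

(** Moving X past gamma(a0 + a1) changes at most the sign of the odd part, so the kernel of X is a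
    submodule even when X anticommutes with W. *)
Lemma twisted_unit s X : twisted s X -> X = 0 \/ X \is a GRing.unit.
Proof.
move=> tX; have [|/eqP k0|kf] := hirr (U := lker (X : 'End(S))).
- move=> a; have [a0 [a1 [p0 p1 ->]]] := clifford_split hCl a.
  apply/subvP => _ /memv_imgP[u uX ->]; rewrite memv_ker in uX; rewrite memv_ker.
  have E : X * gamma (a0 + a1) = gamma (a0 + (-1) ^+ s *: a1) * X.
    rewrite !rmorphD /= mulrDr (twisted_part tX p0) (twisted_part tX p1) linearZ /=.
    by rewrite andbF andbT expr0 scale1r mulrDl -scalerAl.
  have := congr1 (fun f : A => (f : 'End(S)) u) E; rewrite !comp_lfunE => ->.
  by rewrite (eqP uX) linear0.
- by right; apply: endo_unitP.
- left; apply/lfunP => u; rewrite zero_lfunE; apply/eqP.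
  by rewrite -memv_ker kf memvf.
Qed.

Local Notation rho := (@endo_mx R S S_gt0).
Local Notation Mtw := (twcomm p q m).
Local Notation l := (seq.iota 0 d).
Local Notation wmon := (mon w).

Lemma rho_inj : injective rho. Proof. exact: bij_inj (endo_mx_bij _). Qed.

Lemma rho_surj M : exists X, M = rho X.
Proof. by have [g _ gK] := endo_mx_bij S_gt0; exists (g M); rewrite gK. Qed.

Lemma twisted_mx s X : twisted s X <-> Mtw s (rho X).
Proof.
rewrite twisted_gen; split=> H j jd; first by rewrite -!rmorphM H // /= linearZ.
by apply: rho_inj; rewrite linearZ /= !rmorphM /= H.
Qed.

Lemma mx_schur s M : Mtw s M -> M = 0 \/ M \is a GRing.unit.
Proof.
have [X ->] := rho_surj M; move=> /twisted_mx /twisted_unit[->|Xu].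
  by left; rewrite raddf0.
by right; apply: rmorph_unit.
Qed.

Lemma rho_mon s : rho (wmon s) = mon m s.
Proof. exact: mon_morph. Qed.

Lemma gamma_mon s : gamma (mon gen s) = wmon s.
Proof. exact: mon_morph. Qed.

Definition nu : A := wmon l.

Lemma twisted_nu : twisted (~~ odd d) nu.
Proof. by apply/twisted_mx; rewrite rho_mon; apply: nu_twcomm m_ac. Qed.

Lemma mon_part s : part (odd (size s)) (mon gen s).
Proof.
elim: s => [|i s IH]; first by rewrite mon_nil; apply: part1.
by rewrite mon_cons; apply: (partM (par := true)) => //; apply: part_iota.
Qed.

Variable r : nat.
Hypotheses (r8 : (r < 8)%N) (pqr : p = (q + r)%N %[mod 8]).

Lemma nu_sqN : r \in [:: 3; 7]%N -> nu * nu = -1.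
Proof.
move=> ro; apply: rho_inj; rewrite rmorphM /= rho_mon (nu_sq_neg m_sq m_ac r8 pqr ro).
by rewrite rmorphN1.
Qed.

Lemma nu_1N1 : r \in [:: 1; 5]%N -> nu = 1 \/ nu = -1.
Proof.
move=> ro; have := nu_pm1 m_sq m_ac mx_schur r8 pqr ro; rewrite -rho_mon => -[] E.
  by left; apply: rho_inj; rewrite rmorph1.
by right; apply: rho_inj; rewrite rmorphN1.
Qed.

Lemma twisted_real X : r \in [:: 0; 1; 2]%N -> twisted false X -> exists k, X = k%:A.
Proof.
move=> ro /twisted_mx /(commutant_real m_sq m_ac mx_schur r8 pqr ro)[k E].
by exists k; apply: rho_inj; rewrite E rmorph_alg.
Qed.

Lemma twisted_complex X : r \in [:: 3; 7]%N -> twisted false X ->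
  exists a b, X = a%:A + b *: nu.
Proof.
move=> ro /twisted_mx /(commutant_complex m_sq m_ac mx_schur r8 pqr ro)[a [b E]].
by exists a, b; apply: rho_inj; rewrite E rmorphD /= rmorph_alg linearZ /= rho_mon.
Qed.

Lemma twisted_quaternion : r \in [:: 4; 5; 6]%N -> exists i j,
  [/\ twisted false i, twisted false j & i * i = -1] /\ [/\ j * j = -1, i * j = - (j * i) &
   forall X, twisted false X -> exists a b c k,
     X = a%:A + b *: i + c *: j + k *: (i * j)].
Proof.
move=> ro; have := commutant_quaternion m_sq m_ac mx_schur r8 pqr ro.
move=> [i' [j' []]]; have [i ->] := rho_surj i'; have [j ->] := rho_surj j'.
move=> [/twisted_mx ti /twisted_mx tj ii] [jj ij H]; exists i, j; split.
  by split=> //; apply: rho_inj; rewrite rmorphM /= ii rmorphN1.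
split; first by apply: rho_inj; rewrite rmorphM /= jj rmorphN1.
  by apply: rho_inj; rewrite rmorphN !rmorphM.
move=> X /twisted_mx /H[a [b [c [k E]]]]; exists a, b, c, k; apply: rho_inj.
by rewrite E !rmorphD /= rmorph_alg !linearZ /= rmorphM.
Qed.

Lemma twisted_anti_unit : r \in [:: 3; 7]%N ->
  exists2 u, twisted true u & u * u = ((-1) ^+ (r == 3))%:A.
Proof.
move=> ro; have [u' ] := anticommutant_unit m_sq m_ac mx_schur r8 pqr ro.
have [u ->] := rho_surj u' => /twisted_mx tu E; exists u => //; apply: rho_inj.
by rewrite rmorphM /= E rmorph_alg.
Qed.

Lemma commute_schur_gamma a : (forall X, X \in SS -> a * X = X * a) ->
  exists x, a = gamma x.
Proof.
move=> H; have [M MX|c E] := double_commutant m_sq m_ac mx_schur r8 pqr (a := rho a).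
  have [X E] := rho_surj M; move: MX; rewrite E -!rmorphM => /twisted_mx tX.
  by rewrite H //; apply/schurP.
exists (\sum_(t <- subs l) c t *: mon gen t); apply: rho_inj; rewrite E !raddf_sum /=.
by apply: eq_bigr => t _; rewrite !linearZ /= gamma_mon rho_mon.
Qed.

Lemma monspan_iota par v t : monspan gen l par t -> monspan gen l (~~ par) (iota v * t).
Proof.
move=> st; rewrite {1}(basis_expand v) raddf_sum mulr_suml; apply: monspan_sum => i _ /=.
rewrite linearZ /= -scalerAl; apply: monspanZ.
by apply: (monspanM gen_sq gen_ac); rewrite ?all_iota // mem_iota0.
Qed.

Lemma part_monspan par x : part par x -> monspan gen l par x.
Proof.
move=> [n [c [t [tp ->]]]]; apply: monspan_sum => i _; apply: monspanZ.
rewrite -(tp i); elim: (t i) => [|v s IH]; first by rewrite big_nil; apply: monspan1.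
by rewrite big_cons; apply: monspan_iota.
Qed.

(** A homogeneous element is a combination of monomials of one parity, and these are independent in
    End(S) by [mon_even_free]. *)
Lemma gamma_part_inj par x : part par x -> gamma x = 0 -> x = 0.
Proof.
move=> /part_monspan /(monspan_coef (iota_uniq 0 d))[c ->] /(congr1 rho).
rewrite raddf0 !raddf_sum /= => E; rewrite big_seq_cond big1 // => t /andP[tl /eqP tp].
rewrite (mon_even_free m_sq m_ac (c := c) (b := par)) ?scale0r //.
by rewrite -[RHS]E; apply: eq_bigr => s _; rewrite !linearZ /= gamma_mon rho_mon.
Qed.

Lemma part_split_eq0 a b : part false a -> part true b -> a + b = 0 -> a = 0 /\ b = 0.
Proof.
have [al alP] := grading_exists hCl; move=> /alP pa /alP pb ab.
have := congr1 al ab; rewrite raddfD /= pa pb raddf0 expr0 expr1 scale1r scaleN1r => /eqP.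
rewrite subr_eq0 => /eqP E; move: ab; rewrite E -mulr2n -scaler_nat => /eqP.
by rewrite scaler_eq0 pnatr_eq0 => /eqP ->.
Qed.

Lemma part_inv par a : a \is a GRing.unit -> part par a -> part par a^-1.
Proof.
have [al alP] := grading_exists hCl; move=> au /alP pa; apply/alP.
by rewrite rmorphV //= pa -signr_odd invrZ ?unitfE ?signr_eq0 // invr_sign.
Qed.

Lemma nu_unitA : nu \is a GRing.unit.
Proof.
have [E|//] := twisted_unit twisted_nu.
have := nu_unit m_sq; rewrite -rho_mon -/nu E raddf0.
by rewrite unitr0.
Qed.

(** For even d, [nu] itself anticommutes with W; for odd d the residue is 3 or 7, where
    [twisted_anti_unit] applies. *)
Lemma anti_unit_exists : r \notin [:: 1; 5]%N -> exists2 u, twisted true u & u \is a GRing.unit.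
Proof.
move=> rn; have [od|od] := boolP (odd d); last first.
  by exists nu; [have := twisted_nu; rewrite od|exact: nu_unitA].
have [|u tu uu] := twisted_anti_unit.
  by move: rn od r8 pqr; rewrite !inE; lia.
exists u => //; have [E|//] := twisted_unit tu.
move: uu; rewrite E mul0r => /esym/eqP.
by rewrite scaler_eq0 oner_eq0 orbF signr_eq0.
Qed.

(** Moving an invertible [u] that anticommutes with W past gamma(a + b) changes the sign of
    gamma(b). Hence gamma(a + b) = 0 forces both images to vanish, and each part is covered by
    [gamma_part_inj]. *)
Lemma gamma_inj : r \notin [:: 1; 5]%N -> injective gamma.
Proof.
move=> /anti_unit_exists[u tu uu]; apply: raddf_inj => x.
have [a [b [pa pb ->]]] := clifford_split hCl x; rewrite raddfD /= => ab.
have E : gamma a - gamma b = 0.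
  apply: (mulIr uu); rewrite mul0r mulrBl.
  have := congr1 (fun z => u * z) ab; rewrite mulr0 mulrDr.
  by rewrite (twisted_part tu pa) (twisted_part tu pb) expr0 expr1 scale1r scaleN1r.
have a0 : gamma a = 0.
  move/eqP: E; rewrite subr_eq0 => /eqP E; move: ab; rewrite -E -mulr2n -scaler_nat => /eqP.
  by rewrite scaler_eq0 pnatr_eq0 => /eqP.
rewrite (gamma_part_inj pa a0) (gamma_part_inj pb) ?addr0 //.
by move: E; rewrite a0 sub0r => /eqP; rewrite oppr_eq0 => /eqP.
Qed.

(** The volume element is odd and acts as 1 or -1, so multiplying by it replaces an odd element by
    an even one with the same image up to sign. *)
Lemma gamma_even x : r \in [:: 1; 5]%N -> exists2 y, part false y & gamma x = gamma y.
Proof.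
move=> ro; have [a [b [pa pb ->]]] := clifford_split hCl x.
have pv : part true (mon gen l).
  have := mon_part l; rewrite size_iota; have -> : odd d = true; last by [].
  by move: ro pqr; rewrite !inE; lia.
have pbv := partM pb pv; have gv : gamma (mon gen l) = nu := gamma_mon l.
have [E|E] := nu_1N1 ro.
  by exists (a + b * mon gen l); [exact: partD|rewrite !rmorphD rmorphM /= gv E mulr1].
exists (a - b * mon gen l); first by rewrite -scaleN1r; apply/partD/partZ.
by rewrite rmorphD rmorphB rmorphM /= gv E mulrN1 opprK.
Qed.

(** * The Lipschitz group and the kernel of the Schur representation *)

Local Notation L := (lipschitz_group iota gamma).
Local Notation Ge := (ext_clifford_group iota).
Local Notation Gpar := (clifford_group_part iota).

Definition conj_lfun (a : A) : 'End(A) := (amull a \o amulr (a^-1)%R)%VF.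

Lemma conj_lfunE a y : conj_lfun a y = Ad a y.
Proof. by rewrite comp_lfunE !lfunE /= mulrA. Qed.

(** Membership only demands a W a^-1 within W; conjugation is injective and W finite-dimensional, so
    equality holds. *)
Lemma lipschitzV a : L a -> L a^-1.
Proof.
move=> [au aW]; split=> [|x xW]; first by rewrite unitrV.
pose f := conj_lfun a; have fE y : f y = a * y / a := conj_lfunE a y.
have f0 : (W :&: lker f)%VS = 0%VS.
  apply/eqP; rewrite -subv0; apply/subvP => y; rewrite memv_cap memv_ker fE memv0.
  move=> /andP[_ /eqP E]; apply/eqP/(mulrI au)/(mulIr (etrans (unitrV a) au)).
  by rewrite E mulr0 mul0r.
have fW : (f @: W)%VS = W.
  apply/eqP; rewrite eqEdim (limg_dim_eq f0) leqnn andbT; apply/subvP => _ /memv_imgP[y yW ->].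
  by rewrite fE; apply: aW.
move: xW; rewrite -{1}fW => /memv_imgP[y yW ->]; rewrite fE /Ad invrK.
by rewrite !mulrA mulVr // mul1r mulrVK.
Qed.

Lemma lipschitzM a b : L a -> L b -> L (a * b).
Proof.
move=> [au aW] [bu bW]; split=> [|x xW]; first by rewrite unitrMl.
by have := aW _ (bW _ xW); rewrite /Ad invrM // !mulrA.
Qed.

Lemma lipschitz1 : L 1.
Proof. by split=> [|x xW]; rewrite ?unitr1 // /Ad invr1 mul1r mulr1. Qed.

Lemma lipschitz_twisted s a X : L a -> twisted s X -> twisted s (Ad a X).
Proof.
move=> La tX x xW; have [au _] := La; have [_ aW'] := lipschitzV La.
have := tX _ (aW' _ xW); rewrite /Ad invrK => /(congr1 (fun y => a * y / a)).
by rewrite -scalerAr -scalerAl !mulrA mulrV // mul1r mulrK.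
Qed.

Lemma twisted_lipschitz s u : u \is a GRing.unit -> twisted s u -> L u.
Proof.
move=> uu tu; split=> // x xW; rewrite /Ad tu // -scalerAl mulrK //.
by apply: memvZ.
Qed.

(** One inclusion suffices: the other holds in W by [lipschitzV] and is pulled back by injectivity
    of [gamma] on V. *)
Lemma ext_cliffordP a : Ge a <->
  a \is a GRing.unit /\ forall v, exists v', a * iota v / a = iota v'.
Proof.
split=> [[au aV]|[au aV]]; split=> //.
  move=> v; have : range iota (a * iota v / a).
    by rewrite -aV; exists (iota v) => //; exists v.
  by move=> [v' _ <-]; exists v'.
have Lg : L (gamma a).
  split; first exact: rmorph_unit.
  move=> x /imageP[v ->]; have [v' E] := aV v; apply/imageP; exists v'.
  by rewrite -E /Ad rmorph_div // rmorphM.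
apply/seteqP; split=> [_ [_ [v _ <-] <-]|_ [v _ <-]].
  by have [v' ->] := aV v; exists v'.
have [_ /(_ (gamma (iota v)))] := lipschitzV Lg.
have vW : gamma (iota v) \in W by apply/imageP; exists v.
move=> /(_ vW) /imageP[v']; rewrite /Ad invrK => E.
exists (iota v'); first by exists v'.
have [v'' E2] := aV v'; rewrite E2; congr (iota _); apply/eqP; rewrite -subr_eq0; apply/eqP.
apply: gamma_iota_inj; rewrite !raddfB /= -E2 rmorph_div // rmorphM /= -E.
have gu : gamma a \is a GRing.unit := rmorph_unit _ au.
by rewrite !mulrA mulrV // mul1r mulrK // subrr.
Qed.

Lemma ext_clifford_lipschitz a : Ge a -> L (gamma a).
Proof.
move=> /ext_cliffordP[au aV]; split; first exact: rmorph_unit.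
move=> x /imageP[v ->]; have [v' E] := aV v; apply/imageP; exists v'.
by rewrite -E /Ad rmorph_div // rmorphM.
Qed.

(** The equation a v a^-1 = v' is checked after applying [gamma]. Either [gamma] is injective, or
    both sides are odd because [a] is homogeneous, and [gamma] is injective on the odd part. *)
Lemma lipschitz_ext_clifford a : a \is a GRing.unit -> L (gamma a) ->
  (r \notin [:: 1; 5]%N \/ exists par, part par a) -> Ge a.
Proof.
move=> au La hyp; apply/ext_cliffordP; split=> // v.
have [_ /(_ (gamma (iota v)))] := La.
have vW : gamma (iota v) \in W by apply/imageP; exists v.
move=> /(_ vW) /imageP[v']; rewrite /Ad => E; exists v'; apply/eqP; rewrite -subr_eq0.
have E0 : gamma (a * iota v / a - iota v') = 0.
  by rewrite raddfB /= rmorph_div // rmorphM /= E subrr.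
case: hyp => [rn|[par pa]]; first by apply/eqP/(gamma_inj rn); rewrite E0 raddf0.
apply/eqP/(@gamma_part_inj true) => //; rewrite -scaleN1r; apply: partD; last exact/partZ/part_iota.
by have := partM (partM pa (part_iota iota v)) (part_inv au pa); rewrite addbT addNb addbb.
Qed.

Definition image_basis : d.-tuple A := [tuple of map (linfun (gamma \o iota)) e].

Lemma image_basisP : basis_of W image_basis.
Proof.
apply: limg_basis_of; last by have [] := he.
apply/eqP; rewrite -subv0; apply/subvP => v; rewrite memv_cap memv_ker lfunE memv0 /=.
by move=> /andP[_ /eqP /gamma_iota_inj ->].
Qed.

Lemma tnth_image_basis i : tnth image_basis i = w i.
Proof. by rewrite tnth_map lfunE /= (tnth_nth 0). Qed.

Lemma nuE : nu = \prod_(i < d) w i.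
Proof. by rewrite /nu /mon -[d in seq.iota 0 d]subn0 -/(index_iota 0 d) big_mkord. Qed.

Lemma AdM (a x y : A) : a \is a GRing.unit -> Ad a (x * y) = Ad a x * Ad a y.
Proof. by move=> au; rewrite /Ad !mulrA mulrVK. Qed.

(** [nu] is the product of the images of an orthonormal basis, and Ad(a) carries them to another
    anticommuting family in W: [prod_anticomm_det] produces the determinant. *)
Lemma Ad_nu a : L a -> Ad a nu = det_Ad0 iota gamma a *: nu.
Proof.
move=> La; have [au aW] := La.
pose M := \matrix_(i < d, j < d) coord image_basis j (conj_lfun a (tnth image_basis i)).
have -> : det_Ad0 iota gamma a = \det M.
  rewrite (det_basis_change image_basisP (vbasisP W)) => [|x xW]; last first.
    by rewrite conj_lfunE; apply: aW.
  by congr (\det _); apply/matrixP => i j; rewrite !mxE conj_lfunE.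
have ME (i : 'I_d) : Ad a (w i) = \sum_j M i j *: w j.
  rewrite {1}(coord_basis image_basisP (aW _ (w_image i))); apply: eq_bigr => j _.
  by rewrite mxE conj_lfunE tnth_image_basis -tnth_nth tnth_image_basis.
have wa : anticommuting (fun i : 'I_d => w i).
  by move=> i j ij; apply: w_ac.
rewrite nuE -prod_anticomm_det //.
  transitivity (\prod_(i < d) Ad a (w i)); last by apply: eq_bigr => i _.
  by apply: (big_morph (Ad a)) => [x y|]; [exact: AdM|rewrite /Ad mulr1 mulrV].
move=> i j ij; rewrite -!ME -!AdM // wa //.
by rewrite /Ad mulrN mulNr.
Qed.

Lemma nu_sq_scalar : exists k, nu * nu = k%:A.
Proof.
have := mon_sq m_sq m_ac (all_iota p q); rewrite -rho_mon -/nu => E.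
by eexists; apply: rho_inj; rewrite rmorphM /= E rmorph_alg.
Qed.

(** Ad(a) fixes the invertible scalar [nu * nu] and multiplies it by the squared determinant. *)
Lemma det_Ad0_sq a : L a -> det_Ad0 iota gamma a ^+ 2 = 1.
Proof.
move=> La; have [au _] := La; have [k kE] := nu_sq_scalar.
have E : Ad a nu * Ad a nu = nu * nu.
  by rewrite /Ad !mulrA mulrVK // -[a * nu * nu]mulrA kE mulr_algr -scalerAl mulrV.
have nn : nu * nu \is a GRing.unit by rewrite unitrMl nu_unitA.
move: E; rewrite Ad_nu // -scalerAl -scalerAr scalerA -expr2 => /eqP.
rewrite -subr_eq0 -{2}[nu * nu]scale1r -scalerBl scaler_eq0 subr_eq0.
by case/orP=> [/eqP //|/eqP n0]; rewrite n0 unitr0 in nn.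
Qed.

Lemma lipschitz_split : L = lipschitz_group0 iota gamma `|` lipschitz_group1 iota gamma.
Proof.
apply/seteqP; split=> [a La|a [[]|[]] //].
have /eqP := det_Ad0_sq La; rewrite sqrf_eq1 => /orP[] /eqP; [by left|by right].
Qed.

Lemma lipschitz_disj : lipschitz_group0 iota gamma `&` lipschitz_group1 iota gamma = set0.
Proof.
apply/seteqP; split=> // a [[_ E] [_]]; rewrite E => /eqP.
by rewrite -subr_eq0 opprK -mulr2n pnatr_eq0.
Qed.

Hypothesis rz : ((p%:Z - q%:Z) %% 8)%Z = r%:Z.

(** This is exactness at L. An element of L commuting with the Schur algebra is some gamma(x), and
    so is its inverse, which makes x invertible. For residues 1 and 5 both preimages are taken even,
    where [gamma] is injective. *)
Lemma lipschitz_gammaP a : lipschitz_gamma p q iota gamma a <->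
  L a /\ forall X, X \in SS -> a * X = X * a.
Proof.
have rE : (((p%:Z - q%:Z) %% 8)%Z \in [:: 1; 5 : int]) = (r \in [:: 1; 5]%N).
  by rewrite rz !inE.
rewrite /lipschitz_gamma rE; split.
  have [ro|rn] := boolP (r \in _).
    by move=> [x [xG px] <-]; split; [exact: ext_clifford_lipschitz|move=> X; exact: gamma_comm_SS].
  by move=> [x xG <-]; split; [exact: ext_clifford_lipschitz|move=> X; exact: gamma_comm_SS].
move=> [La aS]; have [au _] := La.
have aVS X : X \in SS -> a^-1 * X = X * a^-1.
  by move=> XS; apply: (mulrI au); rewrite !mulrA mulrV // mul1r aS // mulrK.
have [x xE] := commute_schur_gamma aS; have [y yE] := commute_schur_gamma aVS.
have [ro|rn] := boolP (r \in _).
  have [x' px' xE'] := gamma_even x ro; have [y' py' yE'] := gamma_even y ro.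
  have eq1 z : part false z -> gamma z = 1 -> z = 1.
    move=> pz gz; apply/eqP; rewrite -subr_eq0; apply/eqP/(@gamma_part_inj false).
      by apply: partD => //; rewrite -scaleN1r; apply/partZ/part1.
    by rewrite rmorphB rmorph1 /= gz subrr.
  have x'u : x' \is a GRing.unit.
    apply/unitrP; exists y'; split; apply: eq1;
      rewrite ?rmorphM /= -?xE' -?yE' -?xE -?yE ?mulVr ?mulrV //.
      exact: (partM py' px').
    exact: (partM px' py').
  exists x'; last by rewrite -xE' -xE.
  split=> //; apply: lipschitz_ext_clifford => //; last by right; exists false.
  by rewrite -xE' -xE.
have xu : x \is a GRing.unit.
  apply/unitrP; exists y; split; apply: (gamma_inj rn);
    by rewrite rmorphM rmorph1 /= -xE -yE ?mulVr ?mulrV.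
exists x => //; apply: lipschitz_ext_clifford => //; last by left.
by rewrite -xE.
Qed.

Lemma ext_clifford_group_group : is_group (mulgrp Ge).
Proof.
apply: mulgrp_group => [|a b Ga Gb|a Ga].
- by apply/ext_cliffordP; split=> [|v]; [exact: unitr1|exists v; rewrite mul1r invr1 mulr1].
- move: Ga Gb => /ext_cliffordP[au aV] /ext_cliffordP[bu bV]; apply/ext_cliffordP.
  split=> [|v]; first by rewrite unitrMl.
  have [v' E] := bV v; have [v'' E'] := aV v'; exists v''.
  by rewrite invrM // -E' -E !mulrA.
- have [au aV] := Ga; split=> //; apply/ext_cliffordP; split=> [|v]; first by rewrite unitrV.
  have : range iota (iota v) by exists v.
  rewrite -aV => -[_ [v' _ <-] E]; exists v'.
  by rewrite -E invrK !mulrA mulVr // mul1r mulrVK.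
Qed.

Lemma GeM a b : Ge a -> Ge b -> Ge (a * b).
Proof. by have [_ GM _ _ _] := ext_clifford_group_group; apply: GM. Qed.

Lemma GeV a : Ge a -> a \is a GRing.unit /\ Ge a^-1.
Proof. exact: group_unit ext_clifford_group_group. Qed.

Lemma Ge_scalar k : k != 0 -> Ge k%:A.
Proof.
move=> k0; have ku : (k%:A : Cl) \is a GRing.unit.
  by rewrite scaler_unit ?unitr1 // unitfE.
by apply/ext_cliffordP; split=> // v; exists v; rewrite mulr_algl -mulr_algr mulrK.
Qed.

Local Notation Gp := (Gpar false).
Local Notation Gm := (Gpar true).
Local Notation G := (clifford_group iota).

Lemma GparM par par' a b : Gpar par a -> Gpar par' b -> Gpar (par (+) par') (a * b).
Proof. by move=> [Ga pa] [Gb pb]; split; [exact: GeM|exact: partM]. Qed.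

Lemma GparV par a : Gpar par a -> a \is a GRing.unit /\ Gpar par a^-1.
Proof. by move=> [Ga pa]; have [au aV] := GeV Ga; split=> //; split=> //; apply: part_inv. Qed.

Lemma Gpar_scalar k : k != 0 -> Gp k%:A.
Proof. by move=> k0; split; [exact: Ge_scalar|apply/partZ/part1]. Qed.

Lemma GparZ par k a : k != 0 -> Gpar par a -> Gpar par (k *: a).
Proof. by move=> k0 Ga; have := GparM (Gpar_scalar k0) Ga; rewrite mulr_algl. Qed.

Lemma Gp1 : Gp 1.
Proof. by rewrite -[1]scale1r; apply/Gpar_scalar/oner_neq0. Qed.

Lemma Gp_group : is_group (mulgrp Gp).
Proof.
apply: mulgrp_group => [|a b Ga Gb|a]; [exact: Gp1|exact: GparM Ga Gb|exact: GparV].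
Qed.

Lemma G_group : is_group (mulgrp G).
Proof.
apply: mulgrp_group => [|a b [Ga|Ga] [Gb|Gb]|a [Ga|Ga]].
- by left; apply: Gp1.
- by left; have := GparM Ga Gb.
- by right; have := GparM Ga Gb.
- by right; have := GparM Ga Gb.
- by left; have := GparM Ga Gb.
- by have [au aV] := GparV Ga; split=> //; left.
- by have [au aV] := GparV Ga; split=> //; right.
Qed.

Lemma GpN1 : Gp (-1).
Proof. by rewrite -scaleN1r; apply: GparZ Gp1; rewrite oppr_eq0 oner_neq0. Qed.

Lemma gamma_inj_Gp : {in Gp &, injective gamma}.
Proof.
move=> a b /set_mem[_ pa] /set_mem[_ pb] E; apply/eqP; rewrite -subr_eq0; apply/eqP.
apply: (@gamma_part_inj false); last by rewrite raddfB /= E subrr.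
by apply: partD => //; rewrite -scaleN1r; apply: partZ.
Qed.

Lemma iso_image (X : set Cl) : is_group (mulgrp X) -> {in X &, injective gamma} ->
  is_group_iso (mulgrp X) (mulgrp (gamma @` X)) gamma.
Proof. by move=> gX Xi; apply: image_group_iso. Qed.

Lemma SS1 : 1 \in SS.
Proof. by apply/schurP => x xW; rewrite mul1r mulr1 scale1r. Qed.

Lemma SS_unit s : s \in SS -> s != 0 -> s \is a GRing.unit.
Proof. by move=> /schurP/twisted_unit[->|//]; rewrite eqxx. Qed.

Lemma SS_lipschitz s : s \in SS -> s != 0 -> L s.
Proof. by move=> sS s0; apply: twisted_lipschitz (SS_unit sS s0) (elimT (schurP _) sS). Qed.

Local Notation sval := (aspace_val SS1).

Lemma svalD x y : sval (x + y) = sval x + sval y. Proof. exact: linearD. Qed.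
Lemma svalZ k x : sval (k *: x) = k *: sval x. Proof. exact: linearZ. Qed.
Lemma svalN x : sval (- x) = - sval x. Proof. exact: linearN. Qed.
Lemma svalM x y : sval (x * y) = sval x * sval y. Proof. exact: rmorphM. Qed.
Lemma sval1 : sval 1 = 1. Proof. exact: rmorph1. Qed.

Lemma schur_quat : r \in [:: 4; 5; 6]%N ->
  exists phi : {lrmorphism quat R -> subvs_of SS}, bijective phi.
Proof.
move=> ro; have [i [j [[/schurP iS /schurP jS ii] [jj ij H]]]] := twisted_quaternion ro.
pose i' := Subvs iS; pose j' := Subvs jS.
have inj := @aspace_val_inj _ _ _ SS1.
have ii' : i' * i' = -1 by apply: inj; rewrite rmorphM rmorphN1.
have jj' : j' * j' = -1 by apply: inj; rewrite rmorphM rmorphN1.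
have ij' : i' * j' = - (j' * i') by apply: inj; rewrite rmorphN !rmorphM.
pose phi : {lrmorphism quat R -> subvs_of SS} := quat_map ii' jj' ij'.
exists phi.
have surj y : exists x, phi x = y.
  have [a [b [c [k E]]]] := H _ (elimT (schurP _) (valP y)).
  exists (Quat a b c k); apply: inj; rewrite [RHS]E.
  rewrite -[LHS]/(sval (a%:A + b *: i' + c *: j' + k *: (i' * j'))).
  by rewrite !svalD !svalZ svalM sval1.
have [g gK] := choice surj.
by exists g => // x; apply: (@quat_lr_injective _ _ phi); rewrite gK.
Qed.

Lemma schur_complex : r \in [:: 3; 7]%N ->
  exists phi : {lrmorphism Rcomplex R -> subvs_of SS}, bijective phi /\
    forall z, vsval (phi z) = (complex.Re z)%:A + complex.Im z *: nu.
Proof.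
move=> ro; have nuS : nu \in SS.
  apply/schurP; have := twisted_nu; have -> // : odd d = true.
  by move: ro pqr; rewrite !inE; lia.
pose j' := Subvs nuS; have inj := @aspace_val_inj _ _ _ SS1.
have jj' : j' * j' = -1 by apply: inj; rewrite rmorphM rmorphN1 /= nu_sqN.
pose phi : {lrmorphism Rcomplex R -> subvs_of SS} := complex_map jj'.
have phiE z : vsval (phi z) = (complex.Re z)%:A + complex.Im z *: nu.
  rewrite -[LHS]/(sval ((complex.Re z)%:A + complex.Im z *: j')).
  by rewrite svalD !svalZ sval1.
exists phi; split=> //.
have surj y : exists x, phi x = y.
  have [a [b E]] := twisted_complex ro (elimT (schurP _) (valP y)).
  by exists (Complex a b); apply: inj; rewrite [RHS]E -[LHS]/(vsval _) phiE.
have [g gK] := choice surj.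
by exists g => // x; apply: (@complex_map_inj _ _ _ jj'); rewrite -/phi gK.
Qed.

Local Notation US := (schur_unit_group iota gamma).
Local Notation Ads := (@Ad_s _ _ _ iota _ _ gamma).
Local Notation Aut := (schur_aut_group iota gamma).
Local Notation Lg := (lipschitz_gamma p q iota gamma).

(** Two identifications of the Schur algebra with the quaternions differ by an automorphism of the
    quaternions, which preserves the norm. *)
Lemma schur_unitE (phi : {lrmorphism quat R -> subvs_of SS}) : bijective phi ->
  US = (sval \o phi) @` @Sp1 R.
Proof.
move=> bphi; have [psi [phiK psiK]] := lrmorphism_inverse bphi.
apply/seteqP; split=> [a [phi' [_ [x Sx ->]]]|_ [x Sx <-]]; last first.
  by exists phi; split=> //; exists x.
pose F : {lrmorphism quat R -> quat R} := psi \o phi'.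
exists (F x); last by rewrite /= psiK.
by apply/Sp1E; rewrite quat_lr_nsq; apply/Sp1E.
Qed.

Lemma Ad_sE a s : L a -> vsval (Ads a s) = Ad a (vsval s).
Proof.
move=> La.
have lin : linear (fun s : subvs_of SS => vsproj SS (Ad a (vsval s))).
  move=> k x y; rewrite -linearP; congr (vsproj _ _).
  by rewrite linearP /Ad mulrDr mulrDl -scalerAr -scalerAl.
(* [linfun] evaluates as expected on functions declared linear, so the plain function inside [Ad_s]
   is packed with its linearity. *)
pose F : {linear subvs_of SS -> subvs_of SS} := HB.pack_for {linear subvs_of SS -> subvs_of SS}
  (fun s : subvs_of SS => vsproj SS (Ad a (vsval s)))
  (GRing.isLinear.Build R (subvs_of SS) (subvs_of SS) _ _ lin).
have -> : Ads a s = F s by rewrite -(lfunE F).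
rewrite /= vsprojK //; apply/schurP/lipschitz_twisted => //.
exact/schurP/(valP s).
Qed.

Lemma Ad_s_aut a : L a -> alg_aut (Ads a).
Proof.
move=> La; have [au _] := La; apply/alg_autP.
have inj := @aspace_val_inj _ _ _ SS1.
split=> [x y||x y xy].
- apply: inj; rewrite rmorphM /= [LHS]Ad_sE // -[vsval (x * y)]/(sval (x * y)).
  by rewrite rmorphM AdM // -!Ad_sE.
- apply: inj; rewrite rmorph1 [LHS]Ad_sE // -[vsval 1]/(sval 1) rmorph1.
  by rewrite /Ad mulr1 mulrV.
- apply: inj; apply: (mulrI au); apply: (mulIr (etrans (unitrV a) au)).
  by rewrite -[LHS]/(Ad a (vsval x)) -[RHS]/(Ad a (vsval y)) -!Ad_sE // xy.
Qed.

Lemma Ad_s_comp a b : L a -> L b -> Ads (a * b) = (Ads a \o Ads b)%VF.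
Proof.
move=> La Lb; have [au _] := La; have [bu _] := Lb; have Lab := lipschitzM La Lb.
apply/lfunP => s; apply: val_inj; rewrite comp_lfunE /= !Ad_sE //.
by rewrite /Ad invrM // !mulrA.
Qed.

Lemma Ad_s_id a : L a -> (Ads a = \1%VF <-> forall s, s \in SS -> a * s = s * a).
Proof.
move=> La; have [au _] := La; split=> [E s sS|H].
  have := congr1 (fun f : 'End(subvs_of SS) => vsval (f (Subvs sS))) E.
  by rewrite Ad_sE // id_lfunE /Ad /= => {2}<-; rewrite mulrVK.
apply/lfunP => s; apply: val_inj; rewrite /= Ad_sE // id_lfunE /Ad H ?mulrK //.
exact: (valP s).
Qed.

Lemma Ad_s_inner (f : 'End(subvs_of SS)) (u : A) : L u ->
  (forall s : subvs_of SS, vsval (f s) * u = u * vsval s) -> Ads u = f.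
Proof.
move=> Lu H; have [uu _] := Lu; apply/lfunP => s; apply: val_inj.
by rewrite /= Ad_sE // /Ad -H mulrK.
Qed.

Lemma L_group : is_group (mulgrp L).
Proof.
apply: mulgrp_group => [|a b|a La]; [exact: lipschitz1|exact: lipschitzM|].
by have [au _] := La; split=> //; apply: lipschitzV.
Qed.

Lemma Lg_group : is_group (mulgrp Lg).
Proof.
apply: mulgrp_group => [|a b|a].
- by apply/lipschitz_gammaP; split=> [|s _]; [exact: lipschitz1|rewrite mul1r mulr1].
- move=> /lipschitz_gammaP[La Ha] /lipschitz_gammaP[Lb Hb]; apply/lipschitz_gammaP.
  by split=> [|s sS]; [exact: lipschitzM|rewrite -mulrA Hb // mulrA Ha // mulrA].
- move=> /lipschitz_gammaP[La Ha]; have [au _] := La; split=> //; apply/lipschitz_gammaP.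
  split=> [|s sS]; first exact: lipschitzV.
  by apply: (mulrI au); rewrite !mulrA mulrV // mul1r Ha // mulrK.
Qed.

Lemma Aut_real f : r \in [:: 0; 1; 2]%N -> alg_aut f -> f = \1%VF :> 'End(subvs_of SS).
Proof.
move=> ro /alg_autP[fM f1 fi]; apply/lfunP => s; rewrite id_lfunE.
have [k E] := twisted_real ro (elimT (schurP _) (valP s)).
have -> : s = k%:A by apply: (@aspace_val_inj _ _ _ SS1); rewrite [LHS]E svalZ sval1.
by rewrite linearZ /= f1.
Qed.

Lemma Aut_quat f : r \in [:: 4; 5; 6]%N -> alg_aut f ->
  exists2 u : A, u \in SS /\ u != 0 & Ads u = f.
Proof.
move=> ro /alg_aut_lr[F FE]; have [phi bphi] := schur_quat ro.
have [psi [phiK psiK]] := lrmorphism_inverse bphi.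
have [u u1 uF] := quat_inner (psi \o (F \o phi) : {lrmorphism quat R -> quat R}).
have u0 : vsval (phi u) != 0.
  apply/eqP => E; have : phi u = 0 by apply: val_inj; rewrite /= E.
  move=> /(congr1 psi); rewrite phiK raddf0 => E'.
  by move: u1; rewrite E' /= !expr0n /= !addr0 => /eqP; rewrite eq_sym oner_eq0.
have uS : vsval (phi u) \in SS := valP (phi u).
exists (vsval (phi u)) => //; apply: Ad_s_inner; first exact: SS_lipschitz.
move=> s; have := congr1 (fun x => sval (phi x)) (uF (psi s)).
by rewrite !rmorphM /= !psiK FE.
Qed.

(** An automorphism sends j to a square root of -1 commuting with j. The nonzero elements of the
    Schur algebra are invertible, so the image is j or -j, and conjugation by [u] realizes -j. *)
Lemma Aut_complex : r \in [:: 3; 7]%N -> forall u, twisted true u -> u \is a GRing.unit ->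
  Ads u <> \1%VF /\ forall f, alg_aut f -> f = \1%VF \/ f = Ads u.
Proof.
move=> ro u tu uu; have Lu := twisted_lipschitz uu tu.
have [phi [bphi phiE]] := schur_complex ro; have [psi phiK psiK] := bphi.
have od : odd d by move: ro pqr; rewrite !inE; lia.
have unu : u * nu = - (nu * u).
  by have := twisted_part tu (mon_part l); rewrite gamma_mon size_iota od /= expr1 scaleN1r.
pose j := phi (Complex 0 1); have jE : vsval j = nu by rewrite phiE /= scale0r add0r scale1r.
have j2 : j * j = -1.
  apply: (@aspace_val_inj _ _ _ SS1); rewrite svalM svalN sval1 -[sval j]/(vsval j) jE.
  exact: nu_sqN.
have sE s : exists a b, s = a%:A + b *: j.
  exists (complex.Re (psi s)), (complex.Im (psi s)).
  apply: (@aspace_val_inj _ _ _ SS1); rewrite svalD !svalZ sval1 -[sval j]/(vsval j) jE.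
  by rewrite -[LHS]/(vsval s) -{1}[s]psiK phiE.
have nu0 : nu != 0 by apply: contraTneq nu_unitA => ->; rewrite unitr0.
have uj : Ads u j = - j.
  apply: (@aspace_val_inj _ _ _ SS1); rewrite svalN -[sval j]/(vsval j) jE.
  by rewrite -[LHS]/(vsval _) Ad_sE // jE /Ad unu mulNr mulrK.
have jN : j <> - j.
  move=> /eqP; rewrite -subr_eq0 opprK -mulr2n -scaler_nat scaler_eq0 pnatr_eq0 /= => /eqP j0.
  by move: nu0; rewrite -jE j0 linear0 eqxx.
split=> [E|f /alg_autP[fM f1 fi]]; first by apply: jN; rewrite -uj E id_lfunE.
have [_ Ad1 _] := (alg_autP _).1 (Ad_s_aut Lu).
have [a [b fj]] := sE (f j).
have fext g : alg_aut g -> f j = g j -> f = g.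
  move=> /alg_autP[gM g1 gi] E; apply/lfunP => s; have [x [y ->]] := sE s.
  by rewrite !linearD !linearZ /= f1 g1 E.
have f2 : f j * f j = -1 by rewrite -fM j2 linearN /= f1.
have cj : f j * j = j * f j.
  by rewrite fj mulrDl mulrDr mulr_algl mulr_algr -scalerAl -scalerAr.
have : (f j - j) * (f j + j) = 0.
  by rewrite mulrDr !mulrBl f2 j2 cj opprK addrA subrK addrC subrr.
move=> /(congr1 sval); rewrite rmorphM raddf0.
have [E _|n0 E] := eqVneq (f j - j) 0.
  by left; apply: fext; [exact: alg_aut_id|rewrite id_lfunE; apply/eqP; rewrite -subr_eq0 E].
right; apply: fext; first exact: Ad_s_aut.
rewrite uj; apply/eqP; rewrite -addr_eq0; apply/eqP/(@aspace_val_inj _ _ _ SS1).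
have nu : sval (f j - j) \is a GRing.unit.
  apply: SS_unit; first exact: (valP (f j - j)).
  by rewrite raddf_eq0 //; apply: aspace_val_inj.
by apply: (mulrI nu); rewrite E raddf0 mulr0.
Qed.

Lemma residue_cases : [|| r \in [:: 0; 1; 2]%N, r \in [:: 3; 7]%N | r \in [:: 4; 5; 6]%N].
Proof. by move: r8; rewrite !inE; lia. Qed.

Lemma lipschitz_exact : short_exact Lg L Aut Ads.
Proof.
split.
- by split; [exact: Lg_group|exact: L_group|exact: alg_aut_group_group].
- by split=> [a La|a b La Lb]; [exact: Ad_s_aut|exact: Ad_s_comp].
- by move=> a /lipschitz_gammaP[].
- apply/seteqP; split=> [a [La /(Ad_s_id La) H]|a /lipschitz_gammaP[La H]].
    exact/lipschitz_gammaP.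
  by split=> //; apply/Ad_s_id.
apply/seteqP; split=> [_ [a La <-]|f Af]; first exact: Ad_s_aut.
have idL : exists2 a, L a & Ads a = \1%VF.
  by exists 1; [exact: lipschitz1|apply/Ad_s_id=> [|s _]; [exact: lipschitz1|rewrite mul1r mulr1]].
have /or3P[ro|ro|ro] := residue_cases.
- by rewrite (Aut_real ro Af).
- have rn : r \notin [:: 1; 5]%N by move: ro; rewrite !inE; lia.
  have [u tu uu] := anti_unit_exists rn.
  have [_ /(_ f Af)[->|->]] := Aut_complex ro tu uu; first exact: idL.
  by exists u => //; apply: twisted_lipschitz tu.
- have [u [uS u0] <-] := Aut_quat ro Af; exists u => //; exact: SS_lipschitz.
Qed.

(** * Homogeneous elements of the extended Clifford group *)

Local Notation vol := (mon gen l).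

Lemma volumeE : volume iota e = vol.
Proof.
rewrite /volume /mon (big_nth 0) size_tuple big_mkord -[d in seq.iota 0 d]subn0.
by rewrite -/(index_iota 0 d) big_mkord.
Qed.

Lemma volume_sq : r \in [:: 3; 7]%N -> vol * vol = -1.
Proof.
move=> ro; have rn : r \notin [:: 1; 5]%N by move: ro; rewrite !inE; lia.
by apply: (gamma_inj rn); rewrite rmorphM rmorphN1 /= gamma_mon -/nu nu_sqN.
Qed.

Lemma volume_central v : r \in [:: 3; 7]%N -> vol * iota v = iota v * vol.
Proof.
move=> ro; have rn : r \notin [:: 1; 5]%N by move: ro; rewrite !inE; lia.
apply: (gamma_inj rn); rewrite !rmorphM /= gamma_mon -/nu.
have -> := twisted_nu; last by apply/imageP; exists v.
have -> : odd d = true by move: ro pqr; rewrite !inE; lia.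
by rewrite expr0 scale1r.
Qed.

Lemma part_vol : part (odd d) vol.
Proof. by have := mon_part l; rewrite size_iota. Qed.

(** In the quaternionic case gamma(z) also commutes with the Schur algebra, as all of gamma(Cl)
    does. It is therefore a central quaternion, hence real. *)
Lemma center_real z : r \in [:: 0; 2; 4; 6]%N -> gamma z \in SS -> exists k, z = k%:A.
Proof.
move=> ro zS; have rn : r \notin [:: 1; 5]%N by move: ro; rewrite !inE; lia.
suff [k E] : exists k, gamma z = k%:A.
  by exists k; apply: (gamma_inj rn); rewrite E rmorph_alg.
have [r02|r46] := boolP (r \in [:: 0; 1; 2]%N); first exact: twisted_real (elimT (schurP _) zS).
have ro' : r \in [:: 4; 5; 6]%N by move: ro r46; rewrite !inE; lia.
have [phi [psi phiK psiK]] := schur_quat ro'.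
pose x := psi (Subvs zS); exists (qr x).
have xC y : x * y = y * x.
  apply: (can_inj phiK); apply: (@aspace_val_inj _ _ _ SS1).
  rewrite !rmorphM /= psiK /= gamma_comm_SS //; exact: (valP (phi y)).
have xE : x = (qr x)%:A.
  have := xC (quat_I R); have := xC (quat_J R); case: (x) => a b c k.
  rewrite /quat_I /quat_J => -[E1 E2 E3 E4] [F1 F2 F3 F4].
  by congr Quat; rewrite /=; lra.
have -> : gamma z = sval (phi x) by rewrite /= psiK.
have -> : phi x = (qr x)%:A by rewrite {1}xE linearZ rmorph1.
by rewrite svalZ sval1.
Qed.

Lemma center_complex z : r \in [:: 3; 7]%N -> gamma z \in SS ->
  exists a b, z = a%:A + b *: vol.
Proof.
move=> ro zS; have rn : r \notin [:: 1; 5]%N by move: ro; rewrite !inE; lia.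
have [a [b E]] := twisted_complex ro (elimT (schurP _) zS); exists a, b.
by apply: (gamma_inj rn); rewrite E rmorphD /= rmorph_alg linearZ /= gamma_mon.
Qed.

(** The equation a v = v' a splits by parity, so a0 v = v' a0 with the same v', and a^-1 a0 commutes
    with V. *)
Lemma ext_clifford_even_part a0 a1 : part false a0 -> part true a1 -> Ge (a0 + a1) ->
  exists2 z, gamma z \in SS & a0 = (a0 + a1) * z.
Proof.
move=> p0 p1 Ga; have [au aV] := (ext_cliffordP _).1 Ga.
set a := a0 + a1 in Ga au aV *; exists (a^-1 * a0); last by rewrite mulVKr.
apply/schurP => x /imageP[v ->]; rewrite expr0 scale1r -!rmorphM /=; congr (gamma _).
have [v' E] := aV v.
have E1 : a * iota v = iota v' * a by rewrite -E mulrVK.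
have E0 : a0 * iota v = iota v' * a0.
  have [|||_ /eqP E0] := @part_split_eq0 (a1 * iota v - iota v' * a1) (a0 * iota v - iota v' * a0).
  - apply: partD; first exact: (partM p1 (part_iota iota v)).
    by rewrite -scaleN1r; apply: partZ; apply: (partM (part_iota iota v') p1).
  - apply: partD; first exact: (partM p0 (part_iota iota v)).
    by rewrite -scaleN1r; apply: partZ; apply: (partM (part_iota iota v') p0).
  - rewrite addrACA -opprD -mulrDl -mulrDr [a1 + a0]addrC -/a E1 subrr //.
  - by move: E0; rewrite subr_eq0 => /eqP.
by apply: (mulrI au); rewrite !mulrA mulrV // mul1r E0 E.
Qed.

Lemma Ge_central a c : Ge a -> c \is a GRing.unit ->
  (forall v, c * iota v = iota v * c) -> Ge (a * c).
Proof.
move=> Ga cu cv; apply: GeM => //; apply/ext_cliffordP; split=> // v; exists v.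
by rewrite cv mulrK.
Qed.

(** The centre is real, so a0 = k a for a scalar k. Comparing parities, either k = 0 and a is odd,
    or the odd part is 0. *)
Lemma ext_clifford_even : r \in [:: 0; 2; 4; 6]%N -> Ge = G.
Proof.
move=> ro; apply/seteqP; split=> [a Ga|a [[]|[]] //].
have [a0 [a1 [p0 p1 aE]]] := clifford_split hCl a; rewrite aE in Ga *.
have [z zS E] := ext_clifford_even_part p0 p1 Ga; have [k kE] := center_real ro zS.
rewrite kE mulr_algr scalerDr in E.
have [|||E0 E1] := @part_split_eq0 (k *: a0 - a0) (k *: a1).
- by apply: partD; [exact: partZ|rewrite -scaleN1r; apply: partZ].
- exact: partZ.
- by rewrite addrAC -E subrr.
have [k0|k0] := eqVneq k 0.
  move/eqP: E0; rewrite k0 scale0r sub0r oppr_eq0 => /eqP E0.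
  by right; split=> //; rewrite E0 add0r.
left; split=> //; move/eqP: E1; rewrite scaler_eq0 (negPf k0) /= => /eqP ->.
by rewrite addr0.
Qed.

(** Here a0 = a (x + y vol). The odd part of this equation gives a1 = t a0 vol with t = -y / x, so a
    = a0 (1 + t vol) with an even first factor and a central second one. *)
Lemma ext_clifford_complex : r \in [:: 3; 7]%N -> Ge `<=` mulset G (clifford_U1 h iota p q).
Proof.
move=> ro a Ga.
have od : odd d by move: ro pqr; rewrite !inE; lia.
have pv : part true vol by have := part_vol; rewrite od.
have U1_1 : clifford_U1 h iota p q 1.
  by exists e, 1, 0; split=> //; rewrite ?scale1r ?scale0r ?addr0 // expr1n expr0n addr0.
have [a0 [a1 [p0 p1 aE]]] := clifford_split hCl a; rewrite aE in Ga *.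
have hom par : part par (a0 + a1) -> mulset G (clifford_U1 h iota p q) (a0 + a1).
  move=> pa; exists (a0 + a1); last by exists 1; rewrite ?mulr1.
  by case: par pa => pa; [right|left].
have [a00|a00] := eqVneq a0 0; first by apply: (hom true); rewrite a00 add0r.
have [z zS E] := ext_clifford_even_part p0 p1 Ga; have [x [y zE]] := center_complex ro zS.
have vu : vol \is a GRing.unit.
  by apply/unitrP; exists (- vol); rewrite mulNr mulrN volume_sq // opprK.
rewrite zE mulrDr mulr_algr -scalerAr mulrDl !scalerDr in E.
have [|||E0 E1] := @part_split_eq0 (x *: a0 + y *: (a1 * vol) - a0) (x *: a1 + y *: (a0 * vol)).
- apply: partD; last by rewrite -scaleN1r; apply: partZ.
  by apply: partD; apply: partZ => //; apply: (partM p1 pv).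
- by apply: partD; apply: partZ => //; apply: (partM p0 pv).
- rewrite addrAC; apply/eqP; rewrite subr_eq0; apply/eqP.
  by rewrite [RHS]E addrACA; congr (_ + _); rewrite addrC.
have x0 : x != 0.
  apply/eqP => x0; move: E0 E1; rewrite x0 !scale0r !add0r => E0 /eqP.
  rewrite scaler_eq0 => /orP[/eqP y0|/eqP av].
    by move: E0; rewrite y0 scale0r sub0r => /eqP; rewrite oppr_eq0 (negPf a00).
  by move: a00; rewrite -[a0](mulrK vu) av mul0r eqxx.
pose t := - (y / x).
have a1E : a1 = t *: (a0 * vol).
  apply: (scalerI x0); rewrite scalerA /t mulrN mulrCA divff // mulr1 scaleNr.
  by apply/eqP; rewrite -addr_eq0 E1.
(* [s] brings 1 + t vol to norm one; its inverse effect is absorbed by the even factor. *)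
pose s := Num.sqrt (1 + t ^+ 2).
have s2 : s ^+ 2 = 1 + t ^+ 2 by rewrite sqr_sqrtr // addr_ge0 ?sqr_ge0.
have s0 : s != 0.
  apply/eqP => s0; move: s2; rewrite s0 expr0n /= => /eqP.
  by rewrite eq_sym paddr_eq0 ?sqr_ge0 // oner_eq0.
have fac : a0 + a1 = (s *: a0) * (s^-1%:A + (t / s) *: vol).
  rewrite -scalerAl mulrDr mulr_algr -scalerAr scalerDr !scalerA divff // scale1r.
  by rewrite mulrCA divff // mulr1 -a1E.
exists (s *: a0); last first.
  exists (s^-1%:A + (t / s) *: vol); last by rewrite -fac.
  exists e, s^-1, (t / s); split=> //; last by rewrite volumeE.
  by rewrite expr_div_n exprVn -[X in X + _]mul1r -mulrDl s2 divff // -s2 expf_neq0.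
left; split; last exact: partZ.
pose c : Cl := s^-1%:A + (t / s) *: vol; rewrite -/c in fac.
have [cc cu] : c * (s^-1%:A - (t / s) *: vol) = 1 /\ c \is a GRing.unit.
  apply: norm1_unit; rewrite ?volume_sq // expr_div_n exprVn -[X in X + _]mul1r -mulrDl.
  by rewrite -s2 divff // expf_neq0.
have -> : s *: a0 = (a0 + a1) * c^-1 by rewrite fac mulrK.
apply: Ge_central => //; first by rewrite unitrV.
have cv v : c * iota v = iota v * c.
  by rewrite /c mulrDl mulrDr mulr_algl mulr_algr -scalerAl -scalerAr volume_central.
by move=> v; apply: (mulrI cu); rewrite mulVKr // mulrA cv mulrK.
Qed.

(** * The two components of the Lipschitz group, residue by residue *)

Local Notation L0 := (lipschitz_group0 iota gamma).
Local Notation L1 := (lipschitz_group1 iota gamma).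

Lemma nu_neq0 : nu != 0.
Proof. by apply: contraTneq nu_unitA => ->; rewrite unitr0. Qed.

Lemma det_Ad0P a k : L a -> (det_Ad0 iota gamma a = k <-> a * nu = k *: (nu * a)).
Proof.
move=> La; have [au _] := La; have E := Ad_nu La.
have -> : a * nu = det_Ad0 iota gamma a *: (nu * a).
  by rewrite scalerAl -E /Ad mulrVK.
split=> [->//|/eqP]; rewrite -subr_eq0 -scalerBl scaler_eq0 subr_eq0.
case/orP=> [/eqP //|/eqP /(congr1 (fun x => x / a))]; rewrite mulrK // mul0r => n0.
by have := nu_neq0; rewrite n0 eqxx.
Qed.

Lemma lipschitz0P a : L0 a <-> L a /\ a * nu = nu * a.
Proof.
by split=> -[La E]; split=> //; move: E; rewrite (det_Ad0P 1 La) scale1r.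
Qed.

Lemma lipschitz1P a : L1 a <-> L a /\ a * nu = - (nu * a).
Proof.
by split=> -[La E]; split=> //; move: E; rewrite (det_Ad0P (-1) La) scaleN1r.
Qed.

(** [nu] lies in gamma(Cl), so it commutes with s; for even d it anticommutes with W, so it commutes
    with gamma(g) up to the sign of the parity of g. *)
Lemma det_gamma_schur par g s : ~~ odd d -> Gpar par g -> s \in SS -> s != 0 ->
  det_Ad0 iota gamma (gamma g * s) = (-1) ^+ par.
Proof.
move=> od [Gg pg] sS s0; have Lg := ext_clifford_lipschitz Gg.
have Ls := SS_lipschitz sS s0; apply/(det_Ad0P _ (lipschitzM Lg Ls)).
have tn := twisted_nu; rewrite od in tn.
rewrite -mulrA -[s * nu](_ : nu * s = _); last by rewrite /nu -gamma_mon gamma_comm_SS.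
by rewrite !mulrA (twisted_part tn pg) -scalerAl scalerA -expr2 sqrr_sign scale1r.
Qed.

Lemma lipschitz_gammaE : Lg = gamma @` (if r \in [:: 1; 5]%N then Gp else Ge).
Proof.
rewrite /lipschitz_gamma.
have -> : (((p%:Z - q%:Z) %% 8)%Z \in [:: 1; 5 : int]) = (r \in [:: 1; 5]%N).
  by rewrite rz !inE.
by case: ifP.
Qed.

Lemma lipschitz_gamma_even : r \in [:: 0; 2; 4; 6]%N -> Lg = gamma @` G.
Proof.
move=> ro; rewrite lipschitz_gammaE ifF; first by rewrite ext_clifford_even.
by move: ro; rewrite !inE; lia.
Qed.

Lemma lipschitz_gamma_odd : r \in [:: 1; 5]%N -> Lg = gamma @` Gp.
Proof. by move=> ro; rewrite lipschitz_gammaE ro. Qed.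

Lemma Aut_trivial : r \in [:: 0; 1; 2]%N -> group_isog Aut trivgrp.
Proof.
move=> ro; exists (fun _ => tt); split.
- exact: alg_aut_group_group.
- by split=> // [[] _|[] _]; last exists tt.
- by [].
split=> // [f g /set_mem Af /set_mem Ag _|[] _]; first by rewrite (Aut_real ro Af) (Aut_real ro Ag).
by exists \1%VF => //; apply: alg_aut_id.
Qed.

Lemma lipschitz_real : r \in [:: 0; 1; 2]%N -> L = Lg.
Proof.
move=> ro; apply/seteqP; split=> [a La|a /lipschitz_gammaP[]//].
by apply/lipschitz_gammaP; split=> //; apply/Ad_s_id => //; apply/(Aut_real ro)/Ad_s_aut.
Qed.

(** [nu] is 1 or -1 and thus fixed by every conjugation. *)
Lemma lipschitz_eq_lipschitz0 : r \in [:: 1; 5]%N -> L = L0.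
Proof.
move=> ro; apply/seteqP; split=> [a La|a []//]; apply/lipschitz0P; split=> //.
by case: (nu_1N1 ro) => ->; rewrite ?mulr1 ?mul1r // mulrN1 mulN1r.
Qed.

Lemma gamma_inj_on (X : set Cl) : r \notin [:: 1; 5]%N -> {in X &, injective gamma}.
Proof. by move=> rn a b _ _; apply: (gamma_inj rn). Qed.

Lemma lipschitz_residue_0_2 : r \in [:: 0; 2]%N ->
  [/\ group_isog Aut trivgrp,
      [/\ L = Lg, Lg = gamma @` G & is_group_iso (mulgrp G) (mulgrp L) gamma],
      L0 = gamma @` Gp /\ is_group_iso (mulgrp Gp) (mulgrp L0) gamma &
      L1 = gamma @` Gm /\ set_bij Gm L1 gamma].
Proof.
move=> ro; have r012 : r \in [:: 0; 1; 2]%N by move: ro; rewrite !inE; lia.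
have re : r \in [:: 0; 2; 4; 6]%N by move: ro; rewrite !inE; lia.
have rn : r \notin [:: 1; 5]%N by move: ro; rewrite !inE; lia.
have od : ~~ odd d by move: ro pqr; rewrite !inE; lia.
have LE := lipschitz_real r012; have LgE := lipschitz_gamma_even re.
(* Both components are treated at once: the determinant of gamma(g) is the parity sign of g and so
   recovers the parity. *)
have Lpar (par : bool) : [set a | L a /\ det_Ad0 iota gamma a = (-1) ^+ par] = gamma @` Gpar par.
  have dg (par' : bool) g : Gpar par' g -> det_Ad0 iota gamma (gamma g) = (-1) ^+ par'.
    by move=> Gg; rewrite -[gamma g]mulr1 (det_gamma_schur od Gg SS1) // oner_neq0.
  apply/seteqP; split=> [a [La]|_ [g Gg <-]]; last first.
    by split; [apply: ext_clifford_lipschitz; case: Gg|exact: dg].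
  move: (La); rewrite LE LgE => -[g Gg <-].
  case: Gg => Gg; rewrite (dg _ _ Gg) => /signr_inj par_eq; exists g => //; by rewrite -par_eq.
have L0E : L0 = gamma @` Gp by rewrite -Lpar expr0.
have L1E : L1 = gamma @` Gm by rewrite -Lpar expr1.
split; first exact: Aut_trivial.
- by split=> //; rewrite LE LgE; apply: iso_image G_group (gamma_inj_on rn).
- by split=> //; rewrite L0E; apply: iso_image Gp_group (gamma_inj_on rn).
- split=> //; rewrite L1E; split=> [a Ga|a b _ _|//]; first by exists a.
  exact: gamma_inj.
Qed.

Lemma lipschitz_residue_1 : r = 1%N ->
  [/\ group_isog Aut trivgrp, L = Lg, Lg = L0, L0 = gamma @` Gp &
      is_group_iso (mulgrp Gp) (mulgrp L) gamma].
Proof.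
move=> r1; have r012 : r \in [:: 0; 1; 2]%N by rewrite r1.
have r15 : r \in [:: 1; 5]%N by rewrite r1.
have LE := lipschitz_real r012; have LgE := lipschitz_gamma_odd r15.
have LL0 := lipschitz_eq_lipschitz0 r15.
split; [exact: Aut_trivial|by []|by rewrite -LE|by rewrite -LL0 LE|].
by rewrite LE LgE; apply: iso_image Gp_group gamma_inj_Gp.
Qed.

Section Quaternionic.
Hypothesis r456 : r \in [:: 4; 5; 6]%N.
Variable phi : {lrmorphism quat R -> subvs_of SS}.
Hypothesis bphi : bijective phi.
Local Notation sv := (sval \o phi).

Lemma sv_inj : injective sv.
Proof. by move=> x y /= /aspace_val_inj /quat_lr_injective. Qed.

Lemma sv_SS x : sv x \in SS. Proof. exact: (valP (phi x)). Qed.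

Lemma sv_surj s : s \in SS -> exists x, s = sv x.
Proof. by move=> sS; have [psi _ psiK] := bphi; exists (psi (Subvs sS)); rewrite /= psiK. Qed.

Lemma svM x y : sv (x * y) = sv x * sv y. Proof. by rewrite rmorphM. Qed.

Lemma sv1 : sv 1 = 1. Proof. by rewrite rmorph1. Qed.

Lemma sv_scalar k x : sv (k *: x) = k *: sv x.
Proof. by rewrite /= linearZ svalZ. Qed.

Lemma schur_unit_group_group : is_group (mulgrp US).
Proof.
rewrite (schur_unitE bphi).
have svi : {in @Sp1 R &, injective sv} by move=> x y _ _; apply: sv_inj.
have [g1 gM gA g1l gV] := Sp1_group R; apply: mulgrp_group.
- by exists 1; rewrite ?rmorph1.
- by move=> _ _ [x Sx <-] [y Sy <-]; exists (x * y); [exact: gM|rewrite rmorphM].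
- move=> _ [x /gV[y Sy /= [xy yx]] <-].
  have [xy' yx'] : sv x * sv y = 1 /\ sv y * sv x = 1.
    by rewrite -!svM xy yx sv1.
  have xu : sv x \is a GRing.unit by apply/unitrP; exists (sv y).
  by split=> //; exists y => //; rewrite -[RHS]mulr1 -xy' mulKr.
Qed.

Lemma schur_unit_SS s : US s -> s \in SS /\ s != 0.
Proof.
rewrite (schur_unitE bphi) => -[x /Sp1E Sx <-]; split; first exact: sv_SS.
apply/eqP => E; have x0 : x = 0 by apply: sv_inj; rewrite E raddf0.
by move: Sx; rewrite x0 /= expr0n /= !addr0 => /eqP; rewrite eq_sym oner_eq0.
Qed.

Lemma schur_unitN s : US s -> US (- s).
Proof.
rewrite (schur_unitE bphi) => -[x /Sp1E Sx <-]; exists (- x); last by rewrite rmorphN.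
by apply/Sp1E; rewrite -scaleN1r quat_nsqZ sqrrN expr1n mul1r.
Qed.

(** Everything in gamma(Cl) commutes with the Schur algebra, so such an element is a central
    quaternion of norm one. This is the source of the sign quotient in the central products. *)
Lemma gamma_schur_unit x : US (gamma x) -> gamma x = 1 \/ gamma x = -1.
Proof.
move=> Ux; have [xS _] := schur_unit_SS Ux; move: Ux; rewrite (schur_unitE bphi).
move=> [y Sy yE].
have yC z : y * z = z * y.
  by apply: sv_inj; rewrite !svM yE gamma_comm_SS // sv_SS.
have [k kE] : exists k, y = k%:A.
  exists (qr y); have := yC (quat_I R); have := yC (quat_J R); case: (y) => a b c k.
  rewrite /quat_I /quat_J => -[E1 E2 E3 E4] [F1 F2 F3 F4].
  by congr Quat; rewrite /=; lra.
move/Sp1E: Sy; rewrite kE quat_nsqZ => /eqP.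
rewrite /= expr1n expr0n /= !addr0 mulr1 sqrf_eq1 -yE kE sv_scalar sv1.
by case/orP=> /eqP->; [left; rewrite scale1r|right; rewrite scaleN1r].
Qed.

Lemma schur_normalize s : s \in SS -> s != 0 -> exists2 k, k != 0 & US (k *: s).
Proof.
move=> sS s0; have [x xE] := sv_surj sS.
have x0 : x != 0 by apply: contraNneq s0 => E; rewrite xE E raddf0.
have [k k0 kx] := quat_normalize x0; exists k; first exact: lt0r_neq0.
by rewrite (schur_unitE bphi) xE -sv_scalar; exists (k *: x) => //; apply/Sp1E.
Qed.

Lemma mulset_central (X : set Cl) : is_group (mulgrp X) -> X (-1) ->
    {in X &, injective gamma} ->
  group_isog (mulgrp (mulset (gamma @` X) US)) (central_prod (gamma @` X) US) /\
  group_isog (central_prod (gamma @` X) US) (central_prod X (@Sp1 R)).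
Proof.
move=> gX XN Xi; have ggX : is_group (mulgrp (gamma @` X)) by have [] := iso_image gX Xi.
have gU := schur_unit_group_group.
split.
  apply: mulset_isog => //.
  - by move=> _ s [x _ <-] /schur_unit_SS[sS _]; rewrite gamma_comm_SS.
  - by exists (-1) => //; rewrite rmorphN1.
  - by apply: schur_unitN; have [] := gU.
  - by move=> _ [x _ <-]; apply: gamma_schur_unit.
apply: group_isog_sym; rewrite (schur_unitE bphi) in gU *.
apply: central_prod_isog => //; first exact: Sp1_group.
  exact: Sp1N1.
by move=> x y _ _; apply: sv_inj.
Qed.

(** Ad_s(a) is conjugation by some s in the Schur algebra, so a s^-1 lies in the kernel. The scalar
    that normalizes s is compensated by the closure of X under scaling. *)
Lemma lipschitz_mulset (X : set Cl) : Lg = gamma @` X ->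
    (forall k x, k != 0 -> X x -> X (k *: x)) ->
  L = mulset (gamma @` X) US.
Proof.
move=> LgE XZ; apply/seteqP; split=> [a La|_ [b Xb [s Us <-]]]; last first.
  have [sS s0] := schur_unit_SS Us; apply: lipschitzM; last exact: SS_lipschitz.
  by have /lipschitz_gammaP[] : Lg b by rewrite LgE.
have [s [sS s0] sE] := Aut_quat r456 (Ad_s_aut La).
have su := SS_unit sS s0; have Ls := SS_lipschitz sS s0; have LsV := lipschitzV Ls.
have : Lg (a * s^-1).
  apply/lipschitz_gammaP; have Las := lipschitzM La LsV; split=> //; apply/Ad_s_id => //.
  rewrite Ad_s_comp // -sE -Ad_s_comp // mulrV //; apply/Ad_s_id => [|t _].
    exact: lipschitz1.
  by rewrite mul1r mulr1.
rewrite LgE => -[x Xx xE]; have [k k0 kU] := schur_normalize sS s0.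
exists (gamma (k^-1 *: x)); first by exists (k^-1 *: x) => //; apply: XZ; rewrite ?invr_eq0.
exists (k *: s) => //; rewrite linearZ /= xE -scalerAl -scalerAr scalerA mulVf //.
by rewrite scale1r mulrVK.
Qed.

End Quaternionic.

Lemma GZ k x : k != 0 -> G x -> G (k *: x).
Proof. by move=> k0 [Gx|Gx]; [left|right]; apply: GparZ. Qed.

Lemma lipschitz_residue_4_6 : r \in [:: 4; 6]%N ->
    [/\ group_isog Aut (SO3 R),
        Lg = gamma @` G /\ is_group_iso (mulgrp G) (mulgrp Lg) gamma,
        [/\ L = mulset (gamma @` G) US,
            group_isog (mulgrp L) (central_prod (gamma @` G) US) &
            group_isog (central_prod (gamma @` G) US) (central_prod G (@Sp1 R))],
        [/\ L0 = mulset (gamma @` Gp) US,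
            group_isog (mulgrp L0) (central_prod (gamma @` Gp) US) &
            group_isog (central_prod (gamma @` Gp) US) (central_prod Gp (@Sp1 R))] &
        [/\ L1 = mulset (gamma @` Gm) US,
            (L1 #= (gamma @` Gm) `*` US)%card &
            ((gamma @` Gm) `*` US #= Gm `*` @Sp1 R)%card]].
Proof.
move=> ro; have r456 : r \in [:: 4; 5; 6]%N by move: ro; rewrite !inE; lia.
have re : r \in [:: 0; 2; 4; 6]%N by move: ro; rewrite !inE; lia.
have rn : r \notin [:: 1; 5]%N by move: ro; rewrite !inE; lia.
have od : ~~ odd d by move: ro pqr; rewrite !inE; lia.
have [phi bphi] := schur_quat r456.
have LgE := lipschitz_gamma_even re.
have LE := lipschitz_mulset r456 bphi LgE GZ.
have Lpar (par : bool) : [set a | L a /\ det_Ad0 iota gamma a = (-1) ^+ par] =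
    mulset (gamma @` Gpar par) US.
  apply/seteqP; split=> [a [La]|_ [_ [g Gg <-] [s Us <-]]]; last first.
    have [sS s0] := schur_unit_SS bphi Us.
    split; last exact: det_gamma_schur.
    apply: lipschitzM; last exact: SS_lipschitz.
    by apply: ext_clifford_lipschitz; case: Gg.
  rewrite LE in La; have [_ [g Gg <-] [s Us <-]] := La.
  have [sS s0] := schur_unit_SS bphi Us.
  case: Gg => Gg; rewrite (det_gamma_schur od Gg sS s0) => /signr_inj par_eq;
    by exists (gamma g); [exists g; rewrite -?par_eq|exists s].
have L0E : L0 = mulset (gamma @` Gp) US by rewrite -Lpar expr0.
have L1E : L1 = mulset (gamma @` Gm) US by rewrite -Lpar expr1.
have [GI1 GI2] := mulset_central bphi G_group (or_introl GpN1) (gamma_inj_on rn).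
have [PI1 PI2] := mulset_central bphi Gp_group GpN1 (gamma_inj_on rn).
split.
- exact: alg_aut_SO3 bphi.
- by split=> //; rewrite LgE; apply: iso_image G_group (gamma_inj_on rn).
- by split=> //; rewrite LE.
- by split=> //; rewrite L0E.
split=> //.
  rewrite L1E; apply: card_mulset.
  - move=> _ [g [Gg _] <-]; have [gu _] := GeV Gg.
    by apply/eqP => E; have := rmorph_unit gamma gu; rewrite /= E unitr0.
  - by move=> s /(schur_unit_SS bphi)[].
  - by move=> k _ k0 [g Gg <-]; exists (k *: g); [exact: GparZ|rewrite linearZ].
  - by move=> s; apply: (schur_unitN bphi).
  - move=> _ s _ t [g Gg <-] Us [g' Gg' <-] Ut E.
    have [gu gV] := GparV Gg'; have [_ UM _ _ _] := schur_unit_group_group bphi.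
    have [tu tV] := group_unit (schur_unit_group_group bphi) Ut.
    have [su sV] := group_unit (schur_unit_group_group bphi) Us.
    have gu' : gamma g' \is a GRing.unit by apply: rmorph_unit.
    (* Two factorizations of one element differ by an element of gamma(Cl) of unit norm in the Schur
       algebra, that is by a sign. *)
    have E2 : gamma (g'^-1 * g) = t * s^-1.
      rewrite rmorphM rmorphV //=; apply: (mulrI gu'); apply: (mulIr su).
      by rewrite mulrA mulrV // mul1r E mulrA mulrVK.
    have : US (gamma (g'^-1 * g)) by rewrite E2; apply: UM.
    move=> /(gamma_schur_unit bphi) [] E3.
      left; move: E3; rewrite {1}rmorphM rmorphV //= => E3; split.
        by rewrite -[gamma g](mulVKr gu') E3 mulr1.
      move: E2; rewrite rmorphM rmorphV //= E3 => /(congr1 (fun x => x * s)).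
      by rewrite mul1r mulrVK.
    right; move: E3; rewrite {1}rmorphM rmorphV //= => E3; split.
      by rewrite -[gamma g](mulVKr gu') E3 mulrN1.
    move: E2; rewrite rmorphM rmorphV //= E3 => /(congr1 (fun x => x * s)).
    by rewrite mulN1r mulrVK // => <-; rewrite opprK.
have -> : (gamma @` Gm) `*` US = (fun z => (gamma z.1, (sval \o phi) z.2)) @` (Gm `*` @Sp1 R).
  rewrite (schur_unitE bphi); apply/seteqP.
  split=> [[a b] [/= [g Gg <-] [x Sx <-]]|_ [[g x] [/= Gg Sx] <-]].
    by exists (g, x).
  by split; [exists g|exists x].
apply: inj_card_eq => -[g x] [g' x'] _ _ [/= /(gamma_inj rn) -> E].
by rewrite (sv_inj (x1 := x) (x2 := x') E).
Qed.

Lemma lipschitz_residue_5 : r = 5%N ->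
  [/\ group_isog Aut (SO3 R),
        Lg = gamma @` Gp /\ is_group_iso (mulgrp Gp) (mulgrp Lg) gamma,
        L = L0 /\ L = mulset (gamma @` Gp) US,
        group_isog (mulgrp L) (central_prod (gamma @` Gp) US) &
        group_isog (central_prod (gamma @` Gp) US) (central_prod Gp (@Sp1 R))].
Proof.
move=> r5; have r456 : r \in [:: 4; 5; 6]%N by rewrite r5.
have r15 : r \in [:: 1; 5]%N by rewrite r5.
have [phi bphi] := schur_quat r456; have LgE := lipschitz_gamma_odd r15.
have LE := lipschitz_mulset r456 bphi LgE (fun k x k0 => @GparZ false k x k0).
have [PI1 PI2] := mulset_central bphi Gp_group GpN1 gamma_inj_Gp.
split=> //.
- exact: alg_aut_SO3 bphi.
- by split=> //; rewrite LgE; apply: iso_image Gp_group gamma_inj_Gp.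
- by split; first exact: lipschitz_eq_lipschitz0.
- by rewrite LE.
Qed.

(** With p - q = 8k + r, the exponent is 2k + 1 for r = 3 and 2k + 2 for r = 7. *)
Lemma anticomm_sign : r \in [:: 3; 7]%N ->
  ((-1) ^ ((p%:Z - q%:Z + 1) %/ 4)%Z : R) = (-1) ^+ (r == 3%N).
Proof.
move=> ro; have m1 (k : int) : ((-1) ^ (2 * k)%R : R) = 1.
  by rewrite -exprz_exp -[(-1) ^ 2]/((-1) ^+ 2) sqrrN expr1n exp1rz.
have [k kE] : exists k : int, p%:Z - q%:Z = k * 8 + r%:Z.
  by exists ((p%:Z - q%:Z) %/ 8)%Z; rewrite -rz -divz_eq.
have -> : ((p%:Z - q%:Z + 1) %/ 4)%Z = 2 * k + (if r == 3%N then 1 else 2).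
  by rewrite kE; move: ro; rewrite !inE; case/orP => /eqP -> /=; lia.
rewrite expfzDr ?oppr_eq0 ?oner_eq0 // m1 mul1r.
by case: (r == 3%N); [rewrite expr1z|exact: (m1 1)].
Qed.

(** The Schur algebra is R + R nu, so commuting with it amounts to commuting with [nu]. *)
Lemma lipschitz_gamma_complex : r \in [:: 3; 7]%N -> Lg = L0.
Proof.
move=> ro; have od : odd d by move: ro pqr; rewrite !inE; lia.
have nuS : nu \in SS by apply/schurP; have := twisted_nu; rewrite od.
apply/seteqP; split=> a.
  by move=> /lipschitz_gammaP[La H]; apply/lipschitz0P; split=> //; apply: H.
move=> /lipschitz0P[La an]; apply/lipschitz_gammaP; split=> // s sS.
have [x [y ->]] := twisted_complex ro (elimT (schurP _) sS).
by rewrite mulrDl mulrDr mulr_algl mulr_algr -scalerAl -scalerAr an.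
Qed.

Lemma twisted_nu_anti u : r \in [:: 3; 7]%N -> twisted true u -> u * nu = - (nu * u).
Proof.
move=> ro tu; have od : odd d by move: ro pqr; rewrite !inE; lia.
by have := twisted_part tu (mon_part l); rewrite gamma_mon size_iota od /= expr1 scaleN1r.
Qed.

(** Multiplication by [u], on either side, exchanges the elements of L commuting with [nu] and those
    anticommuting with it. *)
Lemma lipschitz1_coset u : r \in [:: 3; 7]%N -> twisted true u -> u \is a GRing.unit ->
  L1 = [set u * a | a in L0] /\ L1 = [set a * u | a in L0].
Proof.
move=> ro tu uu; have Lu := twisted_lipschitz uu tu; have LuV := lipschitzV Lu.
have un := twisted_nu_anti ro tu.
have uVn : u^-1 * nu = - (nu * u^-1).
  by apply: (mulrI uu); apply: (mulIr uu); rewrite mulVKr // mulrN mulNr !mulrA mulrVK // un opprK.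
split; apply/seteqP; split.
- move=> a /lipschitz1P[La an]; exists (u^-1 * a); last by rewrite mulVKr.
  apply/lipschitz0P; split; first exact: lipschitzM.
  by rewrite -mulrA an mulrN mulrA uVn mulNr opprK mulrA.
- move=> _ [a /lipschitz0P[La an] <-]; apply/lipschitz1P; split; first exact: lipschitzM.
  by rewrite -mulrA an mulrA un mulNr mulrA.
- move=> a /lipschitz1P[La an]; exists (a * u^-1); last by rewrite mulrVK.
  apply/lipschitz0P; split; first exact: lipschitzM.
  by rewrite -mulrA uVn mulrN !mulrA an !mulNr opprK.
- move=> _ [a /lipschitz0P[La an] <-]; apply/lipschitz1P; split; first exact: lipschitzM.
  by rewrite -mulrA un mulrN !mulrA an.
Qed.

Lemma lipschitz_residue_3_7 : r \in [:: 3; 7]%N ->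
    exists c : 'End(subvs_of SS),
    let adapted (u : endo S_gt0) :=
      [/\ is_anticommutant_basis iota gamma u,
          u * u = ((-1) ^ ((p%:Z - q%:Z + 1) %/ 4)%Z : R)%:A &
          forall s : subvs_of SS, u * vsval s / u = vsval (c s)] in
    [/\ is_schur_conjugation c,
        gset Aut = [set \1%VF; c] /\ group_isog Aut (addgrp 'Z_2),
        [/\ Lg = L0, L0 = gamma @` Ge &
            is_group_iso (mulgrp Ge) (mulgrp L0) gamma],
        [/\ exists u, adapted u,
            forall u, adapted u ->
              L1 = [set u * a | a in L0] /\ L1 = [set a * u | a in L0] &
            (L1 #= L0)%card] &
        (forall a, L0 a -> Ads a = \1%VF) /\
        (forall a, L1 a -> Ads a = c)].
Proof.
move=> ro; have rn : r \notin [:: 1; 5]%N by move: ro; rewrite !inE; lia.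
have [u0 tu0 u0u0] := twisted_anti_unit ro.
have unit_sq (u : A) (b : bool) : u * u = ((-1) ^+ b)%:A -> u \is a GRing.unit.
  move=> uu; apply/unitrP; exists ((-1) ^+ b *: u).
  by rewrite -scalerAl -scalerAr uu scalerA -expr2 sqrr_sign scale1r.
have uu0 := unit_sq _ _ u0u0; have Lu0 := twisted_lipschitz uu0 tu0.
(* Conjugation by [u0] sends [nu] to [- nu], so it is the complex conjugation of the Schur
   algebra. *)
exists (Ads u0) => adapted; have [c1 cAut] := Aut_complex ro tu0 uu0.
have Ac : alg_aut (Ads u0) := Ad_s_aut Lu0.
have LgL0 := lipschitz_gamma_complex ro.
have LgE : Lg = gamma @` Ge by rewrite lipschitz_gammaE (negPf rn).
have L1E := lipschitz1_coset ro tu0 uu0.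
have Ad0 a : L0 a -> Ads a = \1%VF.
  by rewrite -LgL0 => /lipschitz_gammaP[La H]; apply/Ad_s_id.
split.
- have [phi [bphi phiE]] := schur_complex ro; exists phi; split=> // z.
  apply: val_inj; rewrite /= Ad_sE // !phiE /Ad mulrDr mulrDl mulr_algr -scalerAl mulrV //.
  rewrite -scalerAr -scalerAl (twisted_nu_anti ro tu0) mulNr mulrK // scalerN.
  by case: z => a b; rewrite /= scaleNr.
- have AutE : gset Aut = [set \1%VF; Ads u0].
    apply/seteqP; split=> [f /cAut[]|f [->|->]] //; [by left|by right|exact: alg_aut_id].
  split=> //.
  have cc : (Ads u0 \o Ads u0)%VF = \1%VF.
    have [|//|] := cAut (Ads u0 \o Ads u0)%VF.
      by have [_ AM _ _ _] := alg_aut_group_group (subvs_of SS); apply: AM.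
    move=> E; case: c1; apply/lfunP => s; rewrite id_lfunE.
    have [_ _ ci] := (alg_autP _).1 Ac; apply: ci.
    by rewrite -comp_lfunE E.
  exists (fun f => if f == \1%VF then 0 else 1); split.
  + exact: alg_aut_group_group.
  + split=> //= [x y z _ _ _|x _|x _]; [exact: addrA|by rewrite add0r addr0|].
    by exists (- x) => //; rewrite subrr addNr.
  + split=> // f g; rewrite AutE => -[->|->] [->|->] /=.
    * by rewrite comp_lfun1l eqxx addr0.
    * by rewrite comp_lfun1l eqxx add0r.
    * by rewrite comp_lfun1r eqxx addr0.
    * by rewrite cc eqxx; case: eqP => // _; apply: val_inj.
  + split=> //.
      move=> f g; rewrite AutE => /set_mem[->|->] /set_mem[->|->] //; rewrite eqxx; case: eqP => //.
    move=> [[|[|//]] xP] _.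
      by exists \1%VF; [exact: alg_aut_id|rewrite eqxx; apply: val_inj].
    by exists (Ads u0) => //; case: eqP => // _; apply: val_inj.
- split=> //; first by rewrite -LgL0.
  by rewrite -LgL0 LgE; apply: iso_image ext_clifford_group_group (gamma_inj_on rn).
- split.
  + exists u0; split; last by move=> s; rewrite Ad_sE.
      split; first exact/anticommutantP.
      move=> a /anticommutantP ta.
      (* A product of two elements anticommuting with W commutes with W; this one is the coordinate
         of [a] in the basis [u0]. *)
      have aS : a * u0^-1 \in SS.
        apply/schurP => x xW; rewrite expr0 scale1r.
        have ux := tu0 x xW; have ax := ta x xW; rewrite !expr1 !scaleN1r in ux ax.
        have uVx : u0^-1 * x = - (x * u0^-1).
          apply: (mulrI uu0); apply: (mulIr uu0).
          by rewrite mulVKr // mulrN mulNr !mulrA mulrVK // ux opprK.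
        by rewrite -mulrA uVx mulrN !mulrA ax !mulNr opprK.
      exists (Subvs aS); split=> [|s sE]; first by rewrite /= mulrVK.
      by apply: val_inj; rewrite /= sE mulrK.
    by rewrite u0u0 anticomm_sign.
  + move=> u [[/anticommutantP tu _] uu _]; apply: lipschitz1_coset => //.
    by apply: (unit_sq _ (r == 3%N)); rewrite uu anticomm_sign.
  + have [-> _] := L1E; apply: inj_card_eq => a b _ _; exact: mulrI.
split=> // a; have [-> _] := L1E; move=> [b L0b <-].
have [Lb _] := L0b; rewrite Ad_s_comp // (Ad0 b) //.
by apply/lfunP => s; rewrite comp_lfunE id_lfunE.
Qed.

End CliffordModule.

(** [clifford_U1] ranges over all orthonormal bases. Outside the section, the facts on the volume
    element are available for an arbitrary basis [e'] as well as for the fixed [e]. *)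
Lemma ext_clifford_complexE (R : realType) (V : vectType R) (h : {symmetric V}) (p q : nat)
    (Cl : unitAlgType R) (iota : {linear V -> Cl}) (S : vectType R) (S_gt0 : (0 < dim S)%N)
    (gamma : {lrmorphism Cl -> endo S_gt0}) (e : (p + q).-tuple V) (r : nat) :
  nondegenerate h -> is_clifford_algebra h iota -> irreducible_rep gamma ->
  orthonormal_basis h e -> (r < 8)%N -> p = (q + r)%N %[mod 8] ->
  ((p%:Z - q%:Z) %% 8)%Z = r%:Z -> r \in [:: 3; 7]%N ->
  ext_clifford_group iota = mulset (clifford_group iota) (clifford_U1 h iota p q).
Proof.
move=> hnd hCl hirr he r8 pqr rz ro; apply/seteqP; split.
  exact: (ext_clifford_complex hnd hCl hirr he r8 pqr rz ro).
move=> _ [g Gg [_ [e' [x [y [he' xy ->]]]] <-]].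
have Geg : ext_clifford_group iota g by case: Gg => -[].
have ww := volume_sq hnd hCl hirr he' r8 pqr rz ro.
have wc v := volume_central hnd hCl hirr he' r8 pqr rz v ro.
rewrite volumeE; apply: (Ge_central hnd hCl gamma Geg); first by have [] := norm1_unit xy ww.
by move=> v; rewrite mulrDl mulrDr mulr_algl mulr_algr -scalerAl -scalerAr wc.
Qed.

Theorem theorem5p10 (R : realType) (V : vectType R) (h : {symmetric V})
    (p q : nat) (hV : is_quadratic_space h p q)
    (Cl : unitAlgType R) (iota : {linear V -> Cl})
    (hCl : is_clifford_algebra h iota)
    (S : vectType R) (S_gt0 : (0 < dim S)%N)
    (gamma : {lrmorphism Cl -> endo S_gt0})
    (hgamma : irreducible_rep gamma) :
  let G := clifford_group iota in
  let Gp := clifford_group_part iota false in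
  let Gm := clifford_group_part iota true in
  let Ge := ext_clifford_group iota in
  let L := lipschitz_group iota gamma in
  let L0 := lipschitz_group0 iota gamma in
  let L1 := lipschitz_group1 iota gamma in
  let Lg := lipschitz_gamma p q iota gamma in
  let SS := schur_algebra iota gamma in
  let US := schur_unit_group iota gamma in
  let Sp := @Sp1 R in
  let Aut := schur_aut_group iota gamma in
  let Ads := @Ad_s _ _ _ iota _ _ gamma in
  let r := ((p%:Z - q%:Z) %% 8)%Z in
  (L = L0 `|` L1 /\ L0 `&` L1 = set0) /\
  short_exact Lg L Aut Ads /\
  (r \in [:: 0; 2] ->
    [/\ group_isog Aut trivgrp,
        [/\ L = Lg, Lg = gamma @` G & is_group_iso (mulgrp G) (mulgrp L) gamma],
        L0 = gamma @` Gp /\ is_group_iso (mulgrp Gp) (mulgrp L0) gamma &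
        L1 = gamma @` Gm /\ set_bij Gm L1 gamma]) /\
  (r \in [:: 3; 7] ->
    exists c : 'End(subvs_of SS),
    let adapted (u : endo S_gt0) :=
      [/\ is_anticommutant_basis iota gamma u,
          u * u = ((-1) ^ ((p%:Z - q%:Z + 1) %/ 4)%Z : R)%:A &
          forall s : subvs_of SS, u * vsval s / u = vsval (c s)] in
    [/\ is_schur_conjugation c,
        gset Aut = [set \1%VF; c] /\ group_isog Aut (addgrp 'Z_2),
        [/\ Lg = L0, L0 = gamma @` Ge,
            is_group_iso (mulgrp Ge) (mulgrp L0) gamma &
            Ge = mulset G (clifford_U1 h iota p q)],
        [/\ exists u, adapted u,
            forall u, adapted u ->
              L1 = [set u * a | a in L0] /\ L1 = [set a * u | a in L0] &
            L1 #= L0] &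
        (forall a, L0 a -> Ads a = \1%VF) /\
        (forall a, L1 a -> Ads a = c)]) /\
  (r \in [:: 4; 6] ->
    [/\ group_isog Aut (SO3 R),
        Lg = gamma @` G /\ is_group_iso (mulgrp G) (mulgrp Lg) gamma,
        [/\ L = mulset (gamma @` G) US,
            group_isog (mulgrp L) (central_prod (gamma @` G) US) &
            group_isog (central_prod (gamma @` G) US) (central_prod G Sp)],
        [/\ L0 = mulset (gamma @` Gp) US,
            group_isog (mulgrp L0) (central_prod (gamma @` Gp) US) &
            group_isog (central_prod (gamma @` Gp) US) (central_prod Gp Sp)] &
        [/\ L1 = mulset (gamma @` Gm) US,
            L1 #= (gamma @` Gm) `*` US &
            (gamma @` Gm) `*` US #= Gm `*` Sp]]) /\
  (r = 1 ->
    [/\ group_isog Aut trivgrp, L = Lg, Lg = L0, L0 = gamma @` Gp &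
        is_group_iso (mulgrp Gp) (mulgrp L) gamma]) /\
  (r = 5 ->
    [/\ group_isog Aut (SO3 R),
        Lg = gamma @` Gp /\ is_group_iso (mulgrp Gp) (mulgrp Lg) gamma,
        L = L0 /\ L = mulset (gamma @` Gp) US,
        group_isog (mulgrp L) (central_prod (gamma @` Gp) US) &
        group_isog (central_prod (gamma @` Gp) US) (central_prod Gp Sp)]).

Proof.
move=> G Gp Gm Ge L L0 L1 Lg SS US Sp Aut Ads r.
have [_ hnd [e he]] := hV; have [n rn] : exists n : nat, r = n%:Z.
  by exists `|r|%N; rewrite gez0_abs // modz_ge0.
have n8 : (n < 8)%N by have := ltz_pmod (p%:Z - q%:Z) (isT : 0 < 8 :> int); rewrite -/r rn.
(* The residue of the integer p - q is restated as a congruence of naturals, which covers p < q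
   without truncated subtraction. *)
have pqn : p = (q + n)%N %[mod 8] by move: (divz_eq (p%:Z - q%:Z) 8); rewrite -/r rn; lia.
split; first exact: conj (lipschitz_split hnd hCl hgamma he) (lipschitz_disj _ _).
split; first exact: (lipschitz_exact hnd hCl hgamma he n8 pqn rn).
rewrite rn; split; first exact: (lipschitz_residue_0_2 hnd hCl hgamma he n8 pqn rn).
split.
  move=> ro; have [c] := lipschitz_residue_3_7 hnd hCl hgamma he n8 pqn rn ro.
  move=> [c1 c2 [c3 c4 c5] c6 c7]; exists c; split=> //; split=> //.
  exact: (ext_clifford_complexE hnd hCl hgamma he n8 pqn rn ro).
split; first exact: (lipschitz_residue_4_6 hnd hCl hgamma he n8 pqn rn).
split=> -[]; first exact: (lipschitz_residue_1 hnd hCl hgamma he n8 pqn rn).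
exact: (lipschitz_residue_5 hnd hCl hgamma he n8 pqn rn).
Qed.
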